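(* Let $n\ge 3$. Let $U\subset \mathcal{S}^{n\times n}$ be an open set such that (i) $O^{-1}UO=U$ for all $O\in O(n)$, and (ii) for all $M\in\mathcal{S}^{n\times n}$ and $N\in\mathcal{S}^{n\times n}_+$, the set $U\cap\{M+tN \mid 0<t<\infty\}$ is convex. Let $F\in C^2(U)$ be a real-valued function such that (iii) $F(O^{-1}MO)=F(M)$ for all $M\in U$ and $O\in O(n)$, and (iv) the matrix $\left(F_{ij}(M)\right)$ is positive definite for all $M\in U$. Let $-\infty<p\le\frac{n+2}{n-2}$, and let $u\in C^2(\mathbb{R}^n)$ be a superharmonic function (i.e. $\Delta u\le 0$ on $\mathbb{R}^n$) satisfying $$F(A^u)=u^{p-\frac{n+2}{n-2}},\quad A^u\in U,\quad u>0\quad\text{on } \mathbb{R}^n.$$ Then either $u$ is constant, or $p=\frac{n+2}{n-2}$ and, for some $\bar x\in\mathbb{R}^n$ and some positive constants $a$ and $b$ satisfying $2b^2a^{-2}I\in U$ and $F(2b^2a^{-2}I)=1$, $$u(x)=\left(\frac{a}{1+b^2|x-\bar x|^2}\right)^{\frac{n-2}{2}}\qquad\text{for all } x\in\mathbb{R}^n.$$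
   Context: $\mathcal{S}^{n\times n}$ is the set of $n\times n$ real symmetric matrices, $\mathcal{S}^{n\times n}_+\subset\mathcal{S}^{n\times n}$ is the set of positive definite matrices, $O(n)$ is the set of $n\times n$ real orthogonal matrices, and $I$ is the $n\times n$ identity matrix. $F_{ij}(M):=\frac{\partial F}{\partial M_{ij}}(M)$. For a positive $C^2$ function $u$, $$A^u:=-\frac{2}{n-2}u^{-\frac{n+2}{n-2}}\nabla^2u+\frac{2n}{(n-2)^2}u^{-\frac{2n}{n-2}}\nabla u\otimes\nabla u-\frac{2}{(n-2)^2}u^{-\frac{2n}{n-2}}|\nabla u|^2 I,$$ a function with values in $\mathcal{S}^{n\times n}$; the condition $A^u\in U$ on $\mathbb{R}^n$ means $A^u(x)\in U$ for every $x\in\mathbb{R}^n$. *)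

(* Defs.v *)
(* Points of R^n are row vectors. *)
From HB Require Import structures.
From mathcomp Require Import all_boot all_order all_algebra.
From mathcomp Require Import all_classical all_reals all_analysis.

Set Implicit Arguments.
Unset Strict Implicit.
Unset Printing Implicit Defensive.

Import Order.TTheory GRing.Theory Num.Theory.
Import numFieldNormedType.Exports.

Local Open Scope classical_set_scope.
Local Open Scope ring_scope.

Definition sym_mx {R : realType} {n : nat} : set 'M[R]_n :=
  [set M | M \is symmetricmx].

Definition posdef_mx {R : realType} {n : nat} : set 'M[R]_n :=
  [set M | sym_mx M /\
           forall v : 'rV[R]_n, v != 0 -> 0 < (v *m M *m v^T) 0 0].

Definition orthogonal_mx {R : realType} {n : nat} : set 'M[R]_n :=
  [set O | O^T *m O = 1%:M].

(* The matrix norm of the library is the sup norm, hence the need for an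
   explicit squared Euclidean norm. *)
Definition sqnorm {R : realType} {n : nat} (x : 'rV[R]_n) : R :=
  \sum_(i < n) x 0 i ^+ 2.

(* [f] is of class C^2 on [D], with respect to the coordinate directions [e]:
   the partial derivatives of order at most 2 along [e] exist and are
   continuous on [D]. When every x + t e_i stays in D for small t, this only
   depends on the values of [f] on [D]. *)
Definition C2_on {R : realType} {V : normedModType R} {I : Type}
    (e : I -> V) (D : set V) (f : V -> R) : Prop :=
  [/\ {within D, continuous f},
      forall i, (forall x, D x -> derivable f x (e i)) /\
                {within D, continuous ('D_(e i) f)} &
      forall i j, (forall x, D x -> derivable ('D_(e i) f) x (e j)) /\
                  {within D, continuous ('D_(e j) ('D_(e i) f))}].

Definition unit_rV {R : realType} {n : nat} (i : 'I_n) : 'rV[R]_n :=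
  delta_mx 0 i.

(* (E_ij + E_ji) / 2: these directions span the symmetric matrices. *)
Definition unit_sym {R : realType} {n : nat} (ij : 'I_n * 'I_n) : 'M[R]_n :=
  2^-1 *: (delta_mx ij.1 ij.2 + delta_mx ij.2 ij.1).

Definition gradient {R : realType} {n : nat} (u : 'rV[R]_n -> R)
    (x : 'rV[R]_n) : 'rV[R]_n :=
  \row_i 'D_(unit_rV i) u x.

Definition hessian {R : realType} {n : nat} (u : 'rV[R]_n -> R)
    (x : 'rV[R]_n) : 'M[R]_n :=
  \matrix_(i, j) 'D_(unit_rV j) ('D_(unit_rV i) u) x.

Definition laplacian {R : realType} {n : nat} (u : 'rV[R]_n -> R)
    (x : 'rV[R]_n) : R :=
  \sum_(i < n) 'D_(unit_rV i) ('D_(unit_rV i) u) x.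

(* (F_ij(M)) for F defined on symmetric matrices: the symmetric matrix with
   dF(M)(H) = \sum_(i, j) F_ij(M) H_ij for all symmetric H. *)
Definition mx_gradient {R : realType} {n : nat} (F : 'M[R]_n -> R)
    (M : 'M[R]_n) : 'M[R]_n :=
  \matrix_(i, j) 'D_(unit_sym (i, j)) F M.

Definition conf_hessian {R : realType} {n : nat} (u : 'rV[R]_n -> R)
    (x : 'rV[R]_n) : 'M[R]_n :=
  - (2 / (n%:R - 2) * u x `^ (- ((n%:R + 2) / (n%:R - 2)))) *: hessian u x
  + (2 * n%:R / (n%:R - 2) ^+ 2 * u x `^ (- (2 * n%:R / (n%:R - 2))))
      *: ((gradient u x)^T *m gradient u x)
  - (2 / (n%:R - 2) ^+ 2 * u x `^ (- (2 * n%:R / (n%:R - 2)))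
      * sqnorm (gradient u x))%:M.

(* Main.v *)
Require Import Defs.
From HB Require Import structures.
From mathcomp Require Import all_boot all_order all_algebra.
From mathcomp Require Import all_classical all_reals all_analysis.
From mathcomp Require Import ring lra.

Set Implicit Arguments.
Unset Strict Implicit.
Unset Printing Implicit Defensive.

Import Order.TTheory GRing.Theory Num.Theory.
Import numFieldNormedType.Exports.

Local Open Scope classical_set_scope.
Local Open Scope ring_scope.

(** The unknown is replaced by v = u^(-2/(n-2)). The conformal Hessian becomes
    the polynomial expression A = v D^2 v - |grad v|^2 / 2 I ([conf_mx],
    [conf_mx_powR]), and the equation becomes F(A) = v^tau, where
    tau = (n-2)/2 ((n+2)/(n-2) - p) is nonnegative. The proof is the method of
    moving spheres. Inversion in the sphere of radius L about a point x,
    which is taken as the origin, turns v into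
    w(y) = |y|^2 / L^2 v(L^2 y / |y|^2) and conjugates A by a reflection
    ([kelvin_conf_mx]). By the orthogonal invariance of U and F, and since tau
    is nonnegative, w is a supersolution outside the sphere. Differentiability
    is used through second order Peano expansions ([jet2]).

    The spheres. The inequality v <= w outside the sphere ([below_kelvin]) holds
    for small L: superharmonicity of u gives v = O(|y|^2)
    ([superharmonic_lower]). Let beta be the upper limit of v(y) / |y|^2 at
    infinity. As long as beta L^2 < v(x), the inequality is strict near infinity
    ([kelvin_far]); a Hopf lemma for the fully nonlinear equation ([hopf]),
    which rests on the ellipticity of F and on the convexity of U along positive
    definite directions ([F_strict], [F_mono]), makes it strict everywhere
    outside the sphere ([kelvin_strict]) and gives a sign to a radial derivative
    on the sphere ([kelvin_radial]). So the radius can be increased, and all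
    spheres with beta L^2 <= v(x) are reached ([below_kelvin_all]).

    The conclusion. If beta = 0, every sphere is admissible, and large spheres
    exchanging two given points show that v is constant. If beta > 0, the sphere
    about x with beta L^2 = v(x) yields the one-sided expansion
    v(x + y) <= beta |y|^2 + grad v(x) . y + o(|y|) at infinity. If the slope
    2 beta x - grad v(x) took two values, two such expansions about a common
    centre would have opposite linear terms, and v would be at most
    beta |y|^2 - |b . y| + o(|y|) with b nonzero. The superharmonic function
    v^(-(n-2)/2) would then exceed on a large sphere what beta allows by a term
    of positive mean, and comparison with a barrier would give a larger
    coefficient of |y|^(2-n) in a lower bound of u, which contradicts the choice
    of beta ([no_competing_slopes]). Hence the slope is constant and
    v = beta |y - xbar|^2 + k. For this v the matrix A is 2 beta k I, the
    equation says that v^tau is constant, and therefore tau = 0. *)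

(** * Euclidean geometry of row vectors *)

Section Euclidean.
Context {R : realType} {n : nat}.
Implicit Types (x y z : 'rV[R]_n) (a : R) (H : 'M[R]_n).

Definition dot x y : R := (x *m y^T) 0 0.

Definition enorm x : R := Num.sqrt (sqnorm x).

Lemma dotE x y : dot x y = \sum_i x 0 i * y 0 i.
Proof. by rewrite /dot mxE; apply: eq_bigr => i _; rewrite mxE. Qed.

Lemma sqnormE x : sqnorm x = dot x x.
Proof. by rewrite dotE; apply: eq_bigr => i _; rewrite expr2. Qed.

Lemma dotC x y : dot x y = dot y x.
Proof. by rewrite !dotE; apply: eq_bigr => i _; rewrite mulrC. Qed.

Lemma dotDl x y z : dot (x + y) z = dot x z + dot y z.
Proof. by rewrite /dot mulmxDl mxE. Qed.

Lemma dotDr x y z : dot z (x + y) = dot z x + dot z y.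
Proof. by rewrite dotC dotDl !(dotC z). Qed.

Lemma dotZl a x y : dot (a *: x) y = a * dot x y.
Proof. by rewrite /dot -scalemxAl mxE. Qed.

Lemma dotZr a x y : dot x (a *: y) = a * dot x y.
Proof. by rewrite dotC dotZl dotC. Qed.

Lemma dotNl x y : dot (- x) y = - dot x y.
Proof. by rewrite -scaleN1r dotZl mulN1r. Qed.

Lemma dotNr x y : dot x (- y) = - dot x y.
Proof. by rewrite dotC dotNl dotC. Qed.

Lemma dotBl x y z : dot (x - y) z = dot x z - dot y z.
Proof. by rewrite dotDl dotNl. Qed.

Lemma dotBr x y z : dot z (x - y) = dot z x - dot z y.
Proof. by rewrite dotDr dotNr. Qed.

Lemma dot0l x : dot 0 x = 0.
Proof. by rewrite -(scale0r 0) dotZl mul0r. Qed.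

Lemma dot0r x : dot x 0 = 0.
Proof. by rewrite dotC dot0l. Qed.

Lemma dot_mulmx x H y : dot (x *m H) y = dot x (y *m H^T).
Proof. by rewrite /dot trmx_mul trmxK mulmxA. Qed.

Lemma mulmx_rank1 x y z : x *m (y^T *m z) = dot x y *: z.
Proof.
by rewrite mulmxA [x *m y^T]mx11_scalar mul_scalar_mx.
Qed.

Lemma dot_scalar_mx a x y : dot (x *m a%:M) y = a * dot x y.
Proof. by rewrite mul_mx_scalar dotZl. Qed.

Lemma sqnorm_ge0 x : 0 <= sqnorm x.
Proof. by apply: sumr_ge0 => i _; exact: sqr_ge0. Qed.

Lemma sqnormZ a x : sqnorm (a *: x) = a ^+ 2 * sqnorm x.
Proof. by rewrite !sqnormE dotZl dotZr mulrA expr2. Qed.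

Lemma sqnormN x : sqnorm (- x) = sqnorm x.
Proof. by rewrite -scaleN1r sqnormZ sqrrN expr1n mul1r. Qed.

Lemma sqnorm0 : sqnorm (0 : 'rV[R]_n) = 0.
Proof. by rewrite sqnormE dot0l. Qed.

Lemma sqnormD x y : sqnorm (x + y) = sqnorm x + 2 * dot x y + sqnorm y.
Proof. by rewrite !sqnormE dotDl !dotDr (dotC y x); ring. Qed.

Lemma sqnormB x y : sqnorm (x - y) = sqnorm x - 2 * dot x y + sqnorm y.
Proof. by rewrite sqnormD dotNr sqnormN mulrN. Qed.

Lemma coord_sqr_le x i : x 0 i ^+ 2 <= sqnorm x.
Proof. by rewrite /sqnorm (bigD1 i)//= lerDl sumr_ge0// => j _; exact: sqr_ge0. Qed.

Lemma sqnorm_eq0 x : (sqnorm x == 0) = (x == 0).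
Proof.
apply/eqP/eqP => [x0|->]; last exact: sqnorm0.
apply/rowP => i; rewrite mxE; apply/eqP; rewrite -sqrf_eq0 eq_le sqr_ge0 andbT.
by rewrite -x0 coord_sqr_le.
Qed.

Lemma sqnorm_gt0 x : (0 < sqnorm x) = (x != 0).
Proof. by rewrite lt0r sqnorm_eq0 sqnorm_ge0 andbT. Qed.

Lemma enorm_ge0 x : 0 <= enorm x.
Proof. exact: sqrtr_ge0. Qed.

Lemma enorm_sqr x : enorm x ^+ 2 = sqnorm x.
Proof. by rewrite sqr_sqrtr// sqnorm_ge0. Qed.

Lemma enorm_gt0 x : (0 < enorm x) = (x != 0).
Proof. by rewrite sqrtr_gt0 sqnorm_gt0. Qed.

Lemma enorm0 : enorm 0 = 0.
Proof. by rewrite /enorm sqnorm0 sqrtr0. Qed.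

Lemma enormZ a x : enorm (a *: x) = `|a| * enorm x.
Proof. by rewrite /enorm sqnormZ sqrtrM ?sqr_ge0// sqrtr_sqr. Qed.

Lemma enormN x : enorm (- x) = enorm x.
Proof. by rewrite /enorm sqnormN. Qed.

Lemma ler_enorm a x : 0 <= a -> (enorm x <= a) = (sqnorm x <= a ^+ 2).
Proof.
move=> a0; rewrite -enorm_sqr ler_sqr ?nnegrE ?enorm_ge0//.
Qed.

Lemma ltr_enorm a x : 0 <= a -> (enorm x < a) = (sqnorm x < a ^+ 2).
Proof.
move=> a0; rewrite -enorm_sqr ltr_sqr ?nnegrE ?enorm_ge0//.
Qed.

(** The discriminant argument: [y] minus its projection on [x] has a
    nonnegative squared norm. *)
Lemma dot_sqr_le x y : dot x y ^+ 2 <= sqnorm x * sqnorm y.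
Proof.
have [->|x0] := eqVneq x 0.
  by rewrite dot0l expr0n/= mulr_ge0// sqnorm_ge0.
have sx : 0 < sqnorm x by rewrite sqnorm_gt0.
have := sqnorm_ge0 (sqnorm x *: y - dot x y *: x).
rewrite sqnormB !sqnormZ dotZl dotZr (dotC y x).
rewrite (_ : _ + _ = sqnorm x * (sqnorm x * sqnorm y - dot x y ^+ 2)); last by ring.
by rewrite pmulr_rge0// subr_ge0.
Qed.

Lemma dot_le x y : `|dot x y| <= enorm x * enorm y.
Proof.
rewrite -(@ler_pXn2r _ 2)// ?nnegrE ?mulr_ge0 ?enorm_ge0//.
by rewrite exprMn !enorm_sqr real_normK ?num_real// dot_sqr_le.
Qed.

Lemma ler_enormD x y : enorm (x + y) <= enorm x + enorm y.
Proof.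
rewrite ler_enorm ?addr_ge0 ?enorm_ge0// sqnormD sqrrD !enorm_sqr lerD2r lerD2l.
by rewrite -[leRHS]mulr_natl ler_pM2l// (le_trans (ler_norm _) (dot_le _ _)).
Qed.

Lemma ler_enormB x y : enorm (x - y) <= enorm x + enorm y.
Proof. by rewrite -[in leRHS](enormN y) ler_enormD. Qed.

Lemma lerB_enormD x y : enorm x - enorm y <= enorm (x + y).
Proof. by rewrite lerBlDr -{1}(addrK y x) ler_enormB. Qed.

Lemma coord_le_enorm x i : `|x 0 i| <= enorm x.
Proof. by rewrite -sqrtr_sqr ler_sqrt ?sqnorm_ge0// coord_sqr_le. Qed.

Lemma norm_le_enorm x : `|x| <= enorm x.
Proof.
rewrite [leLHS]/Num.Def.normr/= mx_normrE; apply/bigmax_leP; split; first exact: enorm_ge0.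
by move=> [i j] _ /=; rewrite (ord1 i) coord_le_enorm.
Qed.

Lemma mx_coord_le_norm m k (A : 'M[R]_(m, k)) i j : `|A i j| <= `|A|.
Proof.
by rewrite [leRHS]/Num.Def.normr/= mx_normrE; apply/bigmax_geP; right; exists (i, j).
Qed.

Lemma enorm_le_norm x : enorm x <= n%:R * `|x|.
Proof.
rewrite ler_enorm ?mulr_ge0 ?ler0n//.
apply: (@le_trans _ _ (\sum_(i < n) `|x| ^+ 2)).
  apply: ler_sum => i _; rewrite -[leLHS]real_normK ?num_real//.
  by rewrite lerXn2r ?nnegrE ?normr_ge0// mx_coord_le_norm.
rewrite sumr_const card_ord exprMn -[leLHS]mulr_natl ler_wpM2r ?sqr_ge0//.
by rewrite -natrX ler_nat; case: (n) => // k; rewrite leq_pmulr.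
Qed.

Lemma near_enormP (x : 'rV[R]_n) (P : 'rV[R]_n -> Prop) :
  (\forall y \near x, P y) <->
  exists2 d, 0 < d & forall y, enorm (y - x) < d -> P y.
Proof.
split.
  move=> /nbhs_normP[d /= d0 dP]; exists d => // y yx; apply: dP => /=.
  by rewrite distrC (le_lt_trans (norm_le_enorm _)).
move=> [d d0 dP]; apply/nbhs_normP; exists (d / n.+1%:R) => /=.
  by rewrite divr_gt0.
move=> y /=; rewrite distrC ltr_pdivlMr// => yx; apply: dP.
rewrite (le_lt_trans (enorm_le_norm _))// (le_lt_trans _ yx)// mulrC.
by rewrite ler_wpM2l// ler_nat.
Qed.

Lemma near0_enormP (P : 'rV[R]_n -> Prop) :
  (\forall h \near (0 : 'rV[R]_n), P h) <->
  exists2 d, 0 < d & forall h, enorm h < d -> P h.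
Proof.
by rewrite near_enormP; split=> -[d d0 dP]; exists d => // h; have := dP h;
   rewrite subr0.
Qed.

Lemma near_shift0 (x : 'rV[R]_n) (P : 'rV[R]_n -> Prop) :
  (\forall y \near x, P y) <-> (\forall h \near (0 : 'rV[R]_n), P (x + h)).
Proof.
rewrite near_enormP near0_enormP; split=> -[d d0 dP]; exists d => // y yd.
  by apply: dP; rewrite addrC addKr.
by rewrite -(subrKC x y); exact: dP.
Qed.

End Euclidean.

(** * Continuity of matrix operations *)

Section MatrixContinuity.
Context {R : realType} {T : Type} {F : set_system T} {FF : Filter F}.

Lemma cvg_mx m k (f : T -> 'M[R]_(m, k)) (A : 'M[R]_(m, k)) :
  (forall i j, f t i j @[t --> F] --> A i j) -> f @ F --> A.
Proof.
move=> fA; apply/cvgrPdist_lt => e e0.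
have : \forall t \near F, forall ij : 'I_m * 'I_k, `|A ij.1 ij.2 - f t ij.1 ij.2| < e.
  apply: filter_forall => -[i j] /=.
  by have /cvgrPdist_lt/(_ e e0) := fA i j.
apply: filterS => t ft; rewrite [ltLHS]/Num.Def.normr/= mx_normrE; apply/bigmax_ltP.
by split=> // -[i j] _ /=; rewrite !mxE; exact: (ft (i, j)).
Qed.

Lemma cvg_coord m k (f : T -> 'M[R]_(m, k)) (A : 'M[R]_(m, k)) i j :
  f @ F --> A -> f t i j @[t --> F] --> A i j.
Proof. move=> fA; apply: (@cvg_comp _ _ _ f (fun M : 'M[R]_(m, k) => M i j) _ _ _ fA).
exact: coord_continuous. Qed.

Lemma cvg_sum_ord k (f : 'I_k -> T -> R) (a : 'I_k -> R) :
  (forall i, f i @ F --> a i) -> \sum_i f i t @[t --> F] --> \sum_i a i.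
Proof.
move=> fa; apply: cvg_big => //.
by move=> x; exact: add_continuous.
Qed.

Lemma cvg_mulmx m k l (f : T -> 'M[R]_(m, k)) (g : T -> 'M[R]_(k, l))
    (A : 'M[R]_(m, k)) (B : 'M[R]_(k, l)) :
  f @ F --> A -> g @ F --> B -> f t *m g t @[t --> F] --> A *m B.
Proof.
move=> fA gB; apply: cvg_mx => i j; rewrite mxE.
rewrite (_ : (fun t => _) = fun t => \sum_h f t i h * g t h j); last first.
  by apply/funext => t; rewrite mxE.
apply: cvg_sum_ord => h; apply: cvgM; exact: cvg_coord.
Qed.

Lemma cvg_trmx m k (f : T -> 'M[R]_(m, k)) (A : 'M[R]_(m, k)) :
  f @ F --> A -> (f t)^T @[t --> F] --> A^T.
Proof.
move=> fA; apply: cvg_mx => i j; rewrite mxE.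
rewrite (_ : (fun t => _) = fun t => f t j i); last by apply/funext => t; rewrite mxE.
exact: cvg_coord.
Qed.

Lemma cvg_scalar_mx n (f : T -> R) a :
  f @ F --> a -> ((f t)%:M : 'M[R]_n) @[t --> F] --> (a%:M : 'M[R]_n).
Proof.
move=> fa; rewrite -scalemx1.
rewrite (_ : (fun t => _) = fun t => f t *: (1%:M : 'M[R]_n)); last first.
  by apply/funext => t; rewrite scalemx1.
exact: cvgZr_tmp.
Qed.

Lemma cvg_dot n (f g : T -> 'rV[R]_n) (x y : 'rV[R]_n) :
  f @ F --> x -> g @ F --> y -> dot (f t) (g t) @[t --> F] --> dot x y.
Proof.
by move=> fx gy; apply: cvg_coord; apply: cvg_mulmx => //; exact: cvg_trmx.
Qed.

Lemma cvg_sqnorm n (f : T -> 'rV[R]_n) (x : 'rV[R]_n) :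
  f @ F --> x -> sqnorm (f t) @[t --> F] --> sqnorm x.
Proof.
move=> fx; rewrite sqnormE (_ : (fun t => _) = fun t => dot (f t) (f t)).
  exact: cvg_dot.
by apply/funext => t; rewrite sqnormE.
Qed.

Lemma cvg_enorm n (f : T -> 'rV[R]_n) (x : 'rV[R]_n) :
  f @ F --> x -> enorm (f t) @[t --> F] --> enorm x.
Proof.
move=> fx; apply: (@cvg_comp _ _ _ (sqnorm \o f) Num.sqrt _ _ _ (cvg_sqnorm fx)).
exact: sqrt_continuous.
Qed.

End MatrixContinuity.

(** * Second order Taylor expansions *)

Section Jets.
Context {R : realType} {n : nat}.
Implicit Types (x y z h p q : 'rV[R]_n) (a b e c : R) (H K : 'M[R]_n).
Implicit Types f g r s : 'rV[R]_n -> R.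

Definition o2 r := forall e, 0 < e ->
  \forall h \near (0 : 'rV[R]_n), `|r h| <= e * sqnorm h.

Definition bigO k r := exists2 C, 0 <= C &
  \forall h \near (0 : 'rV[R]_n), `|r h| <= C * enorm h ^+ k.

(** Peano expansions rather than iterated derivatives: they compose
    algebraically, and an extremum is tested on them directly. *)
Definition jet2 f x p H :=
  o2 (fun h => f (x + h) - f x - dot p h - 2^-1 * dot (h *m H) h).

Definition norm1 H : R := \sum_i \sum_j `|H i j|.

Lemma norm1_ge0 H : 0 <= norm1 H.
Proof. by apply: sumr_ge0 => i _; apply: sumr_ge0. Qed.

Lemma dot_mulmxE x H y :
  dot (x *m H) y = \sum_i \sum_j x 0 i * H i j * y 0 j.
Proof.
rewrite dotE; under eq_bigr do rewrite mxE big_distrl/=.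
by rewrite exchange_big.
Qed.

Lemma dot_mulmx_le x H y : `|dot (x *m H) y| <= norm1 H * enorm x * enorm y.
Proof.
rewrite dot_mulmxE /norm1 -mulrA big_distrl/=.
apply: le_trans (ler_norm_sum _ _ _) _; apply: ler_sum => i _.
rewrite big_distrl/=; apply: le_trans (ler_norm_sum _ _ _) _.
apply: ler_sum => j _; rewrite !normrM mulrAC mulrC.
rewrite ler_wpM2l// ler_pM// coord_le_enorm//.
Qed.

Lemma o2_eq r s : r =1 s -> o2 r -> o2 s.
Proof. by move=> /funext->. Qed.

Lemma bigO_eq k r s : r =1 s -> bigO k r -> bigO k s.
Proof. by move=> /funext->. Qed.

Lemma o2D r s : o2 r -> o2 s -> o2 (r \+ s).
Proof.
move=> ro so e e0; have e20 : 0 < e / 2 by rewrite divr_gt0.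
near=> h; rewrite [e]splitr mulrDl (le_trans (ler_normD _ _))// lerD//.
  by near: h; exact: ro.
by near: h; exact: so.
Unshelve. all: by end_near. Qed.

Lemma o2Z a r : o2 r -> o2 (fun h => a * r h).
Proof.
move=> ro e e0; have e20 : 0 < e / (`|a| + 1).
  by rewrite divr_gt0// ltr_wpDl.
near=> h; rewrite normrM.
have rh : `|r h| <= e / (`|a| + 1) * sqnorm h by near: h; exact: ro.
rewrite (le_trans (ler_wpM2l _ rh))// mulrA ler_wpM2r ?sqnorm_ge0//.
rewrite mulrCA ger_pMr// ler_pdivrMr ?mul1r ?lerDl// ltr_wpDl//.
Unshelve. all: by end_near. Qed.

Lemma o2_bigO r : o2 r -> bigO 2 r.
Proof.
move=> ro; exists 1; rewrite ?ler01//; have := ro 1 ltr01.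
by apply: filterS => h; rewrite enorm_sqr.
Qed.

Lemma bigOD k r s : bigO k r -> bigO k s -> bigO k (r \+ s).
Proof.
move=> [C C0 rC] [D D0 sD]; exists (C + D); rewrite ?addr_ge0//.
near=> h; rewrite mulrDl (le_trans (ler_normD _ _))// lerD//.
  by near: h.
by near: h.
Unshelve. all: by end_near. Qed.

Lemma bigOM k l r s : bigO k r -> bigO l s -> bigO (k + l) (fun h => r h * s h).
Proof.
move=> [C C0 rC] [D D0 sD]; exists (C * D); rewrite ?mulr_ge0//.
near=> h; rewrite normrM exprD mulrACA ler_pM//.
  by near: h.
by near: h.
Unshelve. all: by end_near. Qed.

Lemma bigO_cst a : bigO 0 (fun=> a).
Proof. by exists `|a| => //; near=> h; rewrite expr0 mulr1. Unshelve. all: by end_near. Qed.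

Lemma near_enorm_le e : 0 < e -> \forall h \near (0 : 'rV[R]_n), enorm h <= e.
Proof. by move=> e0; apply/near0_enormP; exists e => // h /ltW. Qed.

Lemma bigOS k r : bigO k.+1 r -> bigO k r.
Proof.
move=> [C C0 rC]; exists C => //; near=> h.
have rh : `|r h| <= C * enorm h ^+ k.+1 by near: h.
have h1 : enorm h <= 1 by near: h; exact: near_enorm_le.
by rewrite (le_trans rh)// ler_wpM2l// exprS ler_piMl// exprn_ge0// enorm_ge0.
Unshelve. all: by end_near. Qed.

Lemma bigO3_o2 r : bigO 3 r -> o2 r.
Proof.
move=> [C C0 rC] e e0; near=> h.
have rh : `|r h| <= C * enorm h ^+ 3 by near: h.
rewrite (le_trans rh)// exprS mulrA enorm_sqr ler_wpM2r ?sqnorm_ge0//.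
have h1 : enorm h <= e / (C + 1).
  by near: h; apply: near_enorm_le; rewrite divr_gt0// ltr_wpDl.
rewrite (le_trans (ler_wpM2l C0 h1))// mulrCA ger_pMr// ler_pdivrMr ?ltr_wpDl//.
by rewrite mul1r lerDl.
Unshelve. all: by end_near. Qed.

Lemma bigO_dot p : bigO 1 (dot p).
Proof.
exists (enorm p); rewrite ?enorm_ge0//; near=> h.
by rewrite expr1 dot_le.
Unshelve. all: by end_near. Qed.

Lemma bigO_quad H : bigO 2 (fun h => dot (h *m H) h).
Proof.
exists (norm1 H); rewrite ?norm1_ge0//; near=> h.
by rewrite expr2 mulrA dot_mulmx_le.
Unshelve. all: by end_near. Qed.

Lemma bigO_sqnorm : bigO 2 (@sqnorm R n).
Proof.
by exists 1 => //; near=> h; rewrite mul1r enorm_sqr ger0_norm// sqnorm_ge0.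
Unshelve. all: by end_near. Qed.

Lemma jet2_rem1 f x p H : jet2 f x p H ->
  bigO 2 (fun h => f (x + h) - f x - dot p h).
Proof.
move=> /o2_bigO j; apply: bigO_eq (bigOD j (bigOM (bigO_cst 2^-1) (bigO_quad H))).
by move=> h /=; ring.
Qed.

Lemma jet2_rem0 f x p H : jet2 f x p H -> bigO 1 (fun h => f (x + h) - f x).
Proof.
move=> /jet2_rem1/bigOS j; apply: bigO_eq (bigOD j (bigO_dot p)).
by move=> h /=; ring.
Qed.

Lemma jet2_cont f x p H : jet2 f x p H -> f @ x --> f x.
Proof.
move=> /jet2_rem0[C C0 fC]; apply/(@cvgrPdist_le R R 'rV[R]_n (nbhs x)) => e e0.
apply/near_shift0; near=> h.
have fh : `|f (x + h) - f x| <= C * enorm h ^+ 1 by near: h.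
rewrite distrC (le_trans fh)// expr1.
have h1 : enorm h <= e / (C + 1).
  by near: h; apply: near_enorm_le; rewrite divr_gt0// ltr_wpDl.
rewrite (le_trans (ler_wpM2l C0 h1))// mulrCA ger_pMr// ler_pdivrMr ?ltr_wpDl//.
by rewrite mul1r lerDl.
Unshelve. all: by end_near. Qed.

Lemma jet2_eq f g x p q H K : f =1 g -> p = q -> H = K ->
  jet2 f x p H -> jet2 g x q K.
Proof. by move=> /funext-> -> ->. Qed.

Lemma jet2_cst a x : jet2 (fun=> a) x 0 0.
Proof.
move=> e e0; near=> h; rewrite mulmx0 !dot0l subrr mulr0 !subr0 normr0.
by rewrite mulr_ge0 ?sqnorm_ge0// ltW.
Unshelve. all: by end_near. Qed.

Lemma jet2_dot p x : jet2 (dot p) x p 0.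
Proof.
move=> e e0; near=> h; rewrite mulmx0 dot0l mulr0 subr0 dotDr.
by rewrite (_ : _ - _ = 0) ?normr0 ?mulr_ge0 ?sqnorm_ge0// ?ltW//; ring.
Unshelve. all: by end_near. Qed.

Lemma jet2_sqnorm x : jet2 (@sqnorm R n) x (2 *: x) (2 *: 1%:M).
Proof.
move=> e e0; near=> h; rewrite -scalemxAr mulmx1 sqnormD !dotZl -sqnormE.
rewrite (_ : _ - _ = 0) ?normr0 ?mulr_ge0 ?sqnorm_ge0// ?ltW//.
by field.
Unshelve. all: by end_near. Qed.

Lemma jet2D f g x p q H K : jet2 f x p H -> jet2 g x q K ->
  jet2 (f \+ g) x (p + q) (H + K).
Proof.
move=> jf jg; apply: o2_eq (o2D jf jg) => h /=.
by rewrite mulmxDr !dotDl; ring.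
Qed.

Lemma jet2Z a f x p H : jet2 f x p H ->
  jet2 (fun y => a * f y) x (a *: p) (a *: H).
Proof.
move=> jf; apply: o2_eq (o2Z a jf) => h /=.
by rewrite -scalemxAr !dotZl; ring.
Qed.

Lemma jet2N f x p H : jet2 f x p H -> jet2 (fun y => - f y) x (- p) (- H).
Proof.
move=> /(jet2Z (-1)); apply: jet2_eq => [y| |]; by rewrite ?mulN1r ?scaleN1r.
Qed.

Lemma jet2B f g x p q H K : jet2 f x p H -> jet2 g x q K ->
  jet2 (f \- g) x (p - q) (H - K).
Proof. by move=> jf /jet2N; exact: jet2D. Qed.

Lemma jet2M f g x p q H K : jet2 f x p H -> jet2 g x q K ->
  jet2 (fun y => f y * g y) x (g x *: p + f x *: q)
       (g x *: H + f x *: K + p^T *m q + q^T *m p).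
Proof.
move=> jf jg.
pose a h := f (x + h) - f x; pose b h := g (x + h) - g x.
have ab : o2 (fun h => a h * b h - dot p h * dot q h).
  apply: bigO3_o2; apply: bigO_eq (bigOD (bigOM (jet2_rem1 jf) (jet2_rem0 jg))
    (bigOM (bigO_dot p) (jet2_rem1 jg))).
  by move=> h /=; rewrite /a /b; ring.
apply: o2_eq (o2D (o2D (o2Z (g x) jf) (o2Z (f x) jg)) ab) => h /=.
rewrite !mulmxDr !mulmx_rank1 -!scalemxAr !dotDl !dotZl /a /b (dotC h) (dotC h).
by field.
Qed.

(** The analogue of [jet2] for functions of one variable, which are the outer
    functions of the compositions. *)
Definition sjet (phi : R -> R) t0 d1 d2 := forall e, 0 < e ->
  \forall t \near (0 : R),
    `|phi (t0 + t) - phi t0 - d1 * t - 2^-1 * d2 * t ^+ 2| <= e * t ^+ 2.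

Lemma jet2_comp (phi : R -> R) d1 d2 f x p H :
  sjet phi (f x) d1 d2 -> jet2 f x p H ->
  jet2 (phi \o f) x (d1 *: p) (d1 *: H + d2 *: (p^T *m p)).
Proof.
move=> jphi jf; pose a h := f (x + h) - f x.
have aO : bigO 1 a by exact: jet2_rem0 jf.
have ra : o2 (fun h => phi (f x + a h) - phi (f x) - d1 * a h
                        - 2^-1 * d2 * a h ^+ 2).
  case: aO => C C0 aC e e0.
  have e10 : 0 < e / (C ^+ 2 + 1) by rewrite divr_gt0// ltr_wpDl ?sqr_ge0.
  have /nbhs_norm0P[d /= d0 dP] := jphi _ e10.
  near=> h.
  have ah : `|a h| <= C * enorm h by rewrite -[enorm h]expr1; near: h.
  have h1 : enorm h <= d / (C + 1) / 2.
    by near: h; apply: near_enorm_le; rewrite !divr_gt0// ltr_wpDl.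
  apply: le_trans (dP _ _) _ => /=.
    rewrite (le_lt_trans ah)// (le_lt_trans (ler_wpM2l C0 h1))//.
    rewrite !mulrA ltr_pdivrMr// ltr_pdivrMr ?ltr_wpDl//.
    nra.
  apply: (@le_trans _ _ (e / (C ^+ 2 + 1) * (C ^+ 2 * sqnorm h))).
    rewrite ler_wpM2l ?(ltW e10)// -enorm_sqr -exprMn -real_normK ?num_real//.
    by rewrite lerXn2r ?nnegrE// mulr_ge0// enorm_ge0.
  rewrite mulrA ler_wpM2r ?sqnorm_ge0// -mulrA ger_pMr// mulrC.
  by rewrite ler_pdivrMr ?mul1r ?lerDl// ltr_wpDl ?sqr_ge0.
have a2 : o2 (fun h => a h ^+ 2 - dot p h ^+ 2).
  apply: bigO3_o2; apply: bigO_eq (bigOM (jet2_rem1 jf)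
     (bigOD (jet2_rem0 jf) (bigO_dot p))).
  by move=> h /=; rewrite /a; ring.
apply: o2_eq (o2D (o2D ra (o2Z d1 jf)) (o2Z (2^-1 * d2) a2)) => h /=.
rewrite !mulmxDr -!scalemxAr mulmx_rank1 !dotDl !dotZl (dotC h) /a subrKC.
by field.
Unshelve. all: by end_near. Qed.

(** At a minimum, the expansion along a line through the point forces the
    linear term to vanish and the quadratic one to be nonnegative. *)
Lemma jet2_min f x p H : jet2 f x p H ->
  (\forall y \near x, f x <= f y) ->
  p = 0 /\ forall z, 0 <= dot (z *m H) z.
Proof.
move=> jf /near_shift0 fmin.
have key z e : 0 < e -> exists2 d, 0 < d & forall t, `|t| <= d ->
    0 <= t * dot p z + t ^+ 2 * (2^-1 * dot (z *m H) z + e * sqnorm z).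
  move=> e0; have /near0_enormP[d d0 dP] : \forall h \near (0 : 'rV[R]_n),
      0 <= dot p h + 2^-1 * dot (h *m H) h + e * sqnorm h.
    near=> h; have fh : f x <= f (x + h) by near: h.
    have : `|f (x + h) - f x - dot p h - 2^-1 * dot (h *m H) h| <= e * sqnorm h.
      by near: h; exact: jf.
    by move=> /ler_normlP[_]; lra.
  exists (d / (enorm z + 1) / 2).
    by rewrite !divr_gt0// ltr_wpDl// enorm_ge0.
  move=> t td; have := dP (t *: z).
  rewrite enormZ => /(_ _)/wrap[|].
    have z0 := enorm_ge0 z; rewrite (le_lt_trans (ler_wpM2r z0 td))//.
    rewrite mulrAC ltr_pdivrMr// mulrAC ltr_pdivrMr ?ltr_wpDl//.
    by nra.
  by rewrite dotZr -scalemxAl dotZl dotZr sqnormZ; congr (0 <= _); ring.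
have p0 z : 0 <= dot p z.
  have [d d0 dP] := key z 1 ltr01.
  rewrite leNgt; apply/negP => pz.
  set Q := 2^-1 * _ + _ in dP.
  pose t := Num.min d (- dot p z / (`|Q| + 1) / 2).
  have t0 : 0 < t.
    by rewrite lt_min d0 !divr_gt0 ?oppr_gt0// ltr_wpDl.
  have td : `|t| <= d by rewrite gtr0_norm// ge_min lexx.
  have tQ : t * (`|Q| + 1) <= - dot p z / 2.
    by rewrite -ler_pdivlMr ?ltr_wpDl// mulrAC ge_min lexx orbT.
  have := dP _ td; rewrite expr2 -mulrA -mulrDr pmulr_rge0//.
  have := ler_norm Q; nra.
have pE : p = 0.
  apply/eqP; rewrite -sqnorm_eq0 sqnormE eq_le p0 andbT.
  by have := p0 (- p); rewrite dotNr oppr_ge0.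
split=> // z; rewrite leNgt; apply/negP => Hz.
have z0 := sqnorm_ge0 z.
have e0 : 0 < - dot (z *m H) z / (sqnorm z + 1) / 4.
  by rewrite !divr_gt0 ?oppr_gt0// ltr_wpDl.
have [d d0 dP] := key z _ e0.
have := dP d; rewrite gtr0_norm// lexx => /(_ isT).
rewrite pE dot0l mulr0 add0r pmulr_rge0 ?exprn_gt0//.
set Q := dot _ _ in Hz *.
have : - Q / (sqnorm z + 1) / 4 * sqnorm z <= - Q / 4.
  rewrite mulrAC ler_pM2r// mulrAC ler_pdivrMr ?ltr_wpDl//.
  by nra.
lra.
Unshelve. all: by end_near. Qed.

Lemma jet2_slope f x p H z e t0 : jet2 f x p H -> f x = 0 -> 0 < t0 ->
  (forall t, 0 <= t <= t0 -> e * t <= f (x + t *: z)) -> e <= dot p z.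
Proof.
move=> /jet2_rem1[C C0 /near0_enormP[d d0 dP]] fx0 t00 fe.
rewrite leNgt; apply/negP => pz; set q := dot p z in pz.
pose N := enorm z + 1; have N0 : 0 < N by rewrite ltr_wpDl// enorm_ge0.
have CN0 : 0 < (C + 1) * N ^+ 2 by rewrite mulr_gt0 ?exprn_gt0// ltr_wpDl.
pose t := Num.min t0 (Num.min (d / N / 2) ((e - q) / ((C + 1) * N ^+ 2) / 2)).
have t_gt0 : 0 < t by rewrite !lt_min t00 !divr_gt0// subr_gt0.
have tN : t * N <= d / 2.
  by rewrite -ler_pdivlMr// mulrAC /t !ge_min lexx !orbT.
have tC : t * ((C + 1) * N ^+ 2) <= (e - q) / 2.
  by rewrite -ler_pdivlMr// mulrAC /t !ge_min lexx !orbT.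
have tz : enorm (t *: z) <= t * N by rewrite enormZ gtr0_norm// ler_pM2l// lerDl.
have := dP (t *: z); rewrite fx0 subr0 dotZr -/q => /(_ _)/wrap[|].
  by rewrite (le_lt_trans tz)// (le_lt_trans tN)// ltr_pdivrMr// mulr_natr mulr2n ltrDl.
move=> /ler_normlP[_ fle].
have te : e * t <= f (x + t *: z) by apply: fe; rewrite ltW//= /t ge_min lexx.
have tz2 : C * enorm (t *: z) ^+ 2 <= t * (t * ((C + 1) * N ^+ 2)).
  rewrite [leRHS](_ : _ = (C + 1) * (t * N) ^+ 2); last by ring.
  by rewrite ler_pM ?exprn_ge0 ?enorm_ge0 ?lerDl// lerXn2r ?nnegrE ?enorm_ge0 ?mulr_ge0// ltW.
have tt : t * (t * ((C + 1) * N ^+ 2)) <= t * ((e - q) / 2) by rewrite ler_pM2l.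
have : 0 < t * (e - q) by rewrite mulr_gt0// subr_gt0.
by rewrite mulrBr; lra.
Qed.

(** The difference of two expansions of one function is an expansion of 0, for
    which every point is both a minimum and a maximum; polarization then gives
    the quadratic part. *)
Lemma jet2_unique f x p q H K : H^T = H -> K^T = K ->
  jet2 f x p H -> jet2 f x q K -> p = q /\ H = K.
Proof.
move=> Hs Ks jf jg; have := jet2B jf jg.
have min0 g : g =1 (fun=> 0) -> \forall y \near x, g x <= g y.
  by move=> g0; near=> y; rewrite !g0.
move=> j; have [|/subr0_eq pq Q1] := jet2_min j; first by apply: min0 => y; rewrite /= subrr.
have [|_ Q2] := jet2_min (jet2N j); first by apply: min0 => y; rewrite /= subrr oppr0.
split=> //; apply/subr0_eq; set M := H - K in Q1 Q2 *.
have Ms : M^T = M by rewrite /M linearB/= Hs Ks.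
have Q0 z : dot (z *m M) z = 0.
  by apply/eqP; rewrite eq_le Q1 andbT -oppr_ge0 -dotNl -mulmxN Q2.
have B0 y z : dot (y *m M) z = 0.
  have := Q0 (y + z); rewrite mulmxDl dotDl !dotDr !Q0 (dot_mulmx z) Ms (dotC z).
  by lra.
apply/matrixP => i j'; rewrite [RHS]mxE -(B0 (delta_mx 0 i) (delta_mx 0 j')).
by rewrite -rowE dotC /dot -rowE !mxE.
Unshelve. all: by end_near. Qed.

End Jets.

(** * From continuous partial derivatives to expansions *)

Section OneVariable.
Context {R : realType}.
Implicit Types (f g df : R -> R) (a b c d e s t : R).

Lemma MVT_between f df a b :
  (forall s, Num.min a b <= s <= Num.max a b -> is_derive s 1 f (df s)) ->
  exists2 c, Num.min a b <= c <= Num.max a b & f b - f a = df c * (b - a).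
Proof.
have main x y : x <= y -> (forall s, x <= s <= y -> is_derive s 1 f (df s)) ->
    exists2 c, x <= c <= y & f y - f x = df c * (y - x).
  move=> xy fd; have [||c] := @MVT_segment R f df x y xy.
  - by move=> s /[!in_itv]/= /andP[xs sy]; apply: fd; rewrite !ltW.
  - apply: derivable_within_continuous => s; rewrite in_itv/= => sxy.
    by apply: ex_derive; exact: fd.
  - by rewrite in_itv/= => cxy fE; exists c.
have [ab|/ltW ba] := leP a b; first exact: main.
move=> fd; have [c cab fE] := main b a ba fd; exists c => //.
by rewrite -[LHS]opprB fE -mulrN opprB.
Qed.

Lemma MVT_bound f df (M : R) a b :
  (forall s, Num.min a b <= s <= Num.max a b -> is_derive s 1 f (df s)) ->
  (forall s, Num.min a b <= s <= Num.max a b -> `|df s| <= M) ->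
  `|f b - f a| <= M * `|b - a|.
Proof.
move=> fd dM; have [c cab ->] := MVT_between fd.
by rewrite normrM ler_wpM2r// dM.
Qed.

Lemma near0_lt e : 0 < e -> \forall h \near (0 : R), `|h| < e.
Proof. by move=> e0; apply/nbhs_norm0P; exists e. Qed.

(** The derivative as a first order Peano expansion, which is the form in which
    expansions along lines are obtained. *)
Lemma is_deriveP_le f t d :
  is_derive t 1 f d <->
  (forall e, 0 < e ->
     \forall h \near (0 : R), `|f (t + h) - f t - d * h| <= e * `|h|).
Proof.
have E h : h != 0 -> `|d - h^-1 *: ((f \o shift t) (h *: 1) - f t)| =
    `|f (t + h) - f t - d * h| / `|h|.
  move=> h0; rewrite -normfV -normrM distrC /= /shift/= /GRing.scale/= mulr1.
  by congr `|_|; rewrite (addrC h); field.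
split=> [fd e e0|fd].
  have fdv : derivable f t 1 by exact: ex_derive.
  have : h^-1 *: ((f \o shift t) (h *: 1) - f t) @[h --> 0^'] --> 'D_1 f t.
    exact: fdv.
  rewrite (@derive_val _ _ _ _ _ _ _ fd) => /cvgrPdist_le/(_ _ e0) fe.
  have {}fe : \forall h \near (0 : R), h != 0 ->
    `|d - h^-1 *: ((f \o shift t) (h *: 1) - f t)| <= e by exact: fe.
  near=> h.
  have [->|h0] := eqVneq h 0; first by rewrite addr0 mulr0 subr0 subrr normr0 mulr0.
  have : h != 0 -> `|d - h^-1 *: ((f \o shift t) (h *: 1) - f t)| <= e by near: h.
  by move=> /(_ h0); rewrite E// ler_pdivrMr ?normr_gt0.
have fl : h^-1 *: ((f \o shift t) (h *: 1) - f t) @[h --> 0^'] --> d.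
  apply/cvgrPdist_le => e e0.
  suff : \forall h \near (0 : R), h != 0 ->
    `|d - h^-1 *: ((f \o shift t) (h *: 1) - f t)| <= e by [].
  near=> h => h0.
  by rewrite E// ler_pdivrMr ?normr_gt0//; near: h; exact: fd.
split; first by apply/cvg_ex; exists d.
by rewrite /derive; exact: cvg_lim fl.
Unshelve. all: by end_near. Qed.

(** The remainder has a derivative of size o(t), so the mean value inequality
    makes it o(t^2). *)
Lemma taylor2 f df t c :
  (\forall s \near t, is_derive (s : R) 1 f (df s)) -> is_derive t 1 df c ->
  sjet f t (df t) c.
Proof.
move=> fd /is_deriveP_le ddf e e0.
have /nbhs_norm0P[d1 /= d10 d1P] := ddf e e0.
have /nbhs_normP[d2 /= d20 d2P] := fd.
near=> h.
have h1 : `|h| < d1 by near: h; exact: near0_lt.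
have h2 : `|h| < d2 by near: h; exact: near0_lt.
have between s : Num.min 0 h <= s <= Num.max 0 h -> `|s| <= `|h|.
  have [h0|/ltW h0] := leP 0 h => /andP[s1 s2].
    by rewrite !ger0_norm.
  by rewrite !ler0_norm// lerN2.
pose g s := f (t + s) - df t * s - 2^-1 * c * s ^+ 2.
have gd s : Num.min 0 h <= s <= Num.max 0 h ->
    is_derive s 1 g (df (t + s) - df t - c * s).
  move=> /between sh.
  have fs : is_derive s 1 (fun s => f (t + s)) (df (t + s)).
    apply/is_deriveP_le => e' e'0.
    have /is_deriveP_le/(_ _ e'0) : is_derive (t + s) 1 f (df (t + s)).
      by apply: d2P => /=; rewrite opprD addNKr normrN (le_lt_trans sh).
    by apply: filterS => k; rewrite addrA.
  have -> : g = (fun s => f (t + s)) \- (df t \*: id) \- ((2^-1 * c) \*: (id * id)).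
    by apply/funext => r; rewrite /g expr2.
  apply: is_derive_eq.
  change (df (t + s) - df t * 1 - (2^-1 * c) * (s * 1 + s * 1) = df (t + s) - df t - c * s).
  by field.
have : `|g h - g 0| <= e * `|h| * `|h - 0|.
  apply: MVT_bound gd _ => s /between sh; apply: le_trans (d1P s _) _ => /=.
    by rewrite (le_lt_trans sh).
  by rewrite ler_wpM2l// ltW.
rewrite subr0 -mulrA -expr2 real_normK ?num_real// /g addr0.
by congr (`|_| <= _); ring.
Unshelve. all: by end_near. Qed.

Lemma sjet_powR a s : 0 < s ->
  sjet (fun t => t `^ a) s (a * s `^ (a - 1)) (a * (a - 1) * s `^ (a - 2)).
Proof.
move=> s0; apply: (@taylor2 _ (fun t => a * t `^ (a - 1))).
  by near=> t; apply: is_derive1_powR; near: t; exact: lt_nbhsr.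
have -> : (fun t => a * t `^ (a - 1)) = a \*: (fun t => t `^ (a - 1)) by [].
have pd := is_derive1_powR (a - 1) s0.
apply: is_derive_eq.
change (a * ((a - 1) * s `^ (a - 1 - 1)) = a * (a - 1) * s `^ (a - 2)).
by rewrite mulrA -(addrA a (-1)) -opprD.
Unshelve. all: by end_near. Qed.

Lemma is_derive_line (V : normedModType R) (f : V -> R) x v t :
  derivable f (x + t *: v) v ->
  is_derive t 1 (fun s => f (x + s *: v)) ('D_v f (x + t *: v)).
Proof.
move=> fd.
have E : (fun h => h^-1 *: (((fun s => f (x + s *: v)) \o shift t) (h *: 1) -
      f (x + t *: v))) =
   (fun h => h^-1 *: ((f \o shift (x + t *: v)) (h *: v) - f (x + t *: v))).
  apply/funext => h /=; rewrite /shift/= [h%:A]mulr1 scalerDl.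
  by rewrite addrCA.
by split; rewrite /derivable /derive E.
Qed.

End OneVariable.

Lemma jet2_ray {R : realType} {n : nat} (f : 'rV[R]_n -> R) (y p : 'rV[R]_n)
    (H : 'M[R]_n) (s : R) :
  jet2 f (s *: y) p H -> is_derive s 1 (fun t => f (t *: y)) (dot p y).
Proof.
move=> /jet2_rem1[C C0 /near0_enormP[d d0 dP]].
apply/is_deriveP_le => e e0.
pose N := enorm y + 1.
have N0 : 0 < N by rewrite ltr_wpDl// enorm_ge0.
near=> h.
have hN : enorm (h *: y) <= `|h| * N by rewrite enormZ ler_wpM2l// lerDl.
have hd : enorm (h *: y) < d.
  rewrite (le_lt_trans hN)// -ltr_pdivlMr//.
  by near: h; apply: near0_lt; rewrite divr_gt0.
have := dP _ hd; rewrite scalerDl dotZr (mulrC h) => /le_trans; apply.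
rewrite (@le_trans _ _ (C * (`|h| * N) ^+ 2))//.
  by rewrite ler_wpM2l// lerXn2r ?nnegrE ?enorm_ge0// mulr_ge0// ltW.
have CN0 : 0 < (C + 1) * N ^+ 2 by rewrite mulr_gt0 ?exprn_gt0// ltr_wpDl.
have hC : `|h| <= e / ((C + 1) * N ^+ 2).
  apply: ltW; near: h; apply: near0_lt.
  by rewrite divr_gt0// mulr_gt0 ?exprn_gt0// ltr_wpDl.
rewrite ler_pdivlMr// in hC.
rewrite (_ : C * _ = `|h| * (C * N ^+ 2) * `|h|); last by ring.
rewrite ler_wpM2r// (le_trans _ hC)// ler_wpM2l// ler_wpM2r ?exprn_ge0 ?(ltW N0)//.
by rewrite lerDl.
Unshelve. all: by end_near. Qed.

Section ContinuousPartials.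
Context {R : realType} {V : normedModType R} {I : finType}.
Variables (e : I -> V) (f : V -> R) (x0 : V) (d eta : R) (w : I -> R).

Let pt (c : I -> R) := x0 + \sum_i c i *: e i.

Hypothesis f_near : forall c : I -> R, (forall i, `|c i| < d) ->
  forall i, derivable f (pt c) (e i) /\ `|'D_(e i) f (pt c) - w i| <= eta.

Let dist (c c' : I -> R) := \sum_i `|c i - c' i|.

Let step (c c' : I -> R) (i : I) : (forall j, `|c j| < d) ->
  (forall j, `|c' j| < d) -> (forall j, j != i -> c j = c' j) ->
  `|f (pt c) - f (pt c') - \sum_j w j * (c j - c' j)| <= eta * dist c c'.
Proof.
move=> cd c'd cE.
have -> : \sum_j w j * (c j - c' j) = w i * (c i - c' i).
  by rewrite (bigD1 i)//= big1 ?addr0// => j ji; rewrite cE// subrr mulr0.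
have -> : dist c c' = `|c i - c' i|.
  by rewrite /dist (bigD1 i)//= big1 ?addr0// => j ji; rewrite cE// subrr normr0.
pose ct t j := if j == i then t else c j.
have ptE t : pt (ct t) = pt (ct 0) + t *: e i.
  rewrite /pt -addrA; congr (_ + _); rewrite (bigD1 i)//= [in RHS](bigD1 i)//=.
  rewrite /ct eqxx scale0r add0r addrC; congr (_ + _).
  by apply: eq_bigr => j /negPf ji; rewrite ji.
have cE1 : pt c = pt (ct (c i)).
  by congr pt; apply/funext => j; rewrite /ct; case: eqVneq => // ->.
have cE2 : pt c' = pt (ct (c' i)).
  by congr pt; apply/funext => j; rewrite /ct; case: eqVneq => [->//|/cE].
have ctd s : Num.min (c' i) (c i) <= s <= Num.max (c' i) (c i) ->
    forall j, `|ct s j| < d.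
  move=> sc j; rewrite /ct; case: eqVneq => // _.
  have := cd i; have := c'd i; rewrite !ltr_norml.
  move: sc; rewrite ge_min le_max => /andP[/orP[?|?] /orP[?|?]] /andP[? ?] /andP[? ?];
  by apply/andP; split; lra.
pose g s := f (pt (ct 0) + s *: e i) - w i * s.
have gd s : Num.min (c' i) (c i) <= s <= Num.max (c' i) (c i) ->
    is_derive s 1 g ('D_(e i) f (pt (ct s)) - w i).
  move=> sc; rewrite ptE.
  have fs : is_derive s 1 (fun s => f (pt (ct 0) + s *: e i))
      ('D_(e i) f (pt (ct 0) + s *: e i)).
    by apply: is_derive_line; rewrite -ptE; have [] := f_near (ctd _ sc) i.
  have -> : g = (fun s => f (pt (ct 0) + s *: e i)) \- (w i \*: id) by [].
  by apply: is_derive_eq; rewrite /GRing.scale/= mulr1.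
have := @MVT_bound R g _ eta (c' i) (c i) gd.
rewrite /g -!ptE -cE1 -cE2 => H.
have {H} := H (fun s sc => (f_near (ctd s sc) i).2).
by congr (`|_| <= _); ring.
Qed.

(** Changing the coordinates one at a time reduces the increment to mean
    values of the partial derivatives. *)
Lemma partials_strict (c c' : I -> R) : (forall j, `|c j| < d) ->
  (forall j, `|c' j| < d) ->
  `|f (pt c) - f (pt c') - \sum_j w j * (c j - c' j)| <= eta * dist c c'.
Proof.
move=> cd c'd.
suff main (r : seq I) : forall c, (forall j, `|c j| < d) ->
    (forall j, j \notin r -> c j = c' j) ->
    `|f (pt c) - f (pt c') - \sum_j w j * (c j - c' j)| <= eta * dist c c'.
  by apply: (main (enum I)) => // j; rewrite mem_enum.
elim: r => [|i r IH] {cd} {}c cd cE.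
  have -> : c = c' by apply/funext => j; rewrite cE.
  rewrite /dist subrr big1 ?subr0 ?normr0 => [|j _]; last by rewrite subrr mulr0.
  by rewrite big1 ?mulr0// => j _; rewrite subrr normr0.
pose c1 j := if j == i then c' j else c j.
have c1d j : `|c1 j| < d by rewrite /c1; case: ifP.
have c1E j : j \notin r -> c1 j = c' j.
  by rewrite /c1; case: eqVneq => // ji jr; rewrite cE// inE negb_or ji.
have cc1 j : j != i -> c j = c1 j by rewrite /c1 => /negPf->.
have := ler_normD (f (pt c) - f (pt c1) - \sum_j w j * (c j - c1 j))
  (f (pt c1) - f (pt c') - \sum_j w j * (c1 j - c' j)).
have -> : forall a b s1 b1 s2 : R, a - b - s1 + (b - b1 - s2) = a - b1 - (s1 + s2).
  by move=> *; ring.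
rewrite -big_split/=; under eq_bigr do rewrite -mulrDr subrKA.
move=> /le_trans; apply; rewrite (le_trans (lerD (step cd c1d cc1) (IH _ c1d c1E)))//.
rewrite -mulrDr (_ : dist c c1 + _ = dist c c')//.
rewrite /dist -big_split/=; apply: eq_bigr => j _; rewrite /c1.
by case: eqP => _; rewrite subrr normr0 ?addr0 ?add0r.
Qed.

End ContinuousPartials.

Section C2Jets.
Context {R : realType} {n : nat}.
Implicit Types (u f : 'rV[R]_n -> R) (x h : 'rV[R]_n).

Lemma sum_norm_le (h : 'rV[R]_n) : \sum_i `|h 0 i| <= n%:R * enorm h.
Proof.
apply: (@le_trans _ _ (\sum_(i < n) enorm h)).
  by apply: ler_sum => i _; exact: coord_le_enorm.
by rewrite sumr_const card_ord mulr_natl.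
Qed.

Lemma C1_diff f x : (forall i y, derivable f y (unit_rV i)) ->
  (forall i, 'D_(unit_rV i) f @ x --> 'D_(unit_rV i) f x) ->
  forall e, 0 < e -> \forall h \near (0 : 'rV[R]_n),
    `|f (x + h) - f x - dot (gradient f x) h| <= e * enorm h.
Proof.
move=> fd fc e e0.
have e1 : 0 < e / n.+1%:R by rewrite divr_gt0.
have /near_enormP[d d0 dP] : \forall y \near x,
    forall i, `|'D_(unit_rV i) f y - 'D_(unit_rV i) f x| <= e / n.+1%:R.
    apply: (@filter_forall _ _ _ (nbhs x)) => i.
  have /(@cvgrPdist_le R R 'rV[R]_n (nbhs x))/(_ _ e1) := fc i.
  by apply: filterS => y; rewrite distrC.
have ptE (c : 'rV[R]_n) : x + \sum_i c 0 i *: unit_rV i = x + c.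
  by congr (_ + _); rewrite [RHS]row_sum_delta.
near=> h.
have hd : enorm h < d / n.+1%:R.
  by near: h; apply/near0_enormP; exists (d / n.+1%:R) => //; rewrite divr_gt0.
have := @partials_strict R _ _ (@unit_rV R n) f x (d / n.+1%:R) (e / n.+1%:R)
  (fun i => 'D_(unit_rV i) f x) _ (fun i => h 0 i) (fun=> 0).
have -> : \sum_i (0 : R) *: unit_rV i = 0 :> 'rV[R]_n.
  by apply: big1 => i _; rewrite scale0r.
rewrite ptE addr0 => H; have {H} := H _ _ _.
have -> : \sum_i 'D_(unit_rV i) f x * (h 0 i - 0) = dot (gradient f x) h.
  by rewrite dotE; apply: eq_bigr => i _; rewrite subr0 mxE.
move=> /(_ _ _ _)/wrap[|||].
- move=> c cd i; split; first exact: fd.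
  have cE : \sum_i c i *: unit_rV i = \row_i c i :> 'rV[R]_n.
    by rewrite [RHS]row_sum_delta; apply: eq_bigr => j _; rewrite mxE.
  apply: dP; rewrite addrC addKr cE.
  rewrite (le_lt_trans (enorm_le_norm _))//.
  have [n0|n0] := eqVneq n 0%N.
    have -> : n%:R = 0 :> R by rewrite n0.
    by rewrite mul0r.
  have n1 : (0 : R) < n%:R by rewrite ltr0n lt0n.
  rewrite mulrC -ltr_pdivlMr// [ltLHS]/Num.Def.normr/= mx_normrE.
  apply/bigmax_ltP; split; first by rewrite divr_gt0.
  move=> [a j] _ /=; rewrite mxE (lt_le_trans (cd j))//.
  by rewrite ler_pM2l// lef_pV2 ?posrE// ler_nat.
- by move=> j; rewrite (le_lt_trans (coord_le_enorm _ _)).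
- by move=> j; rewrite normr0 divr_gt0.
move=> /le_trans; apply.
under eq_bigr do rewrite subr0.
rewrite -mulrA ler_pM2l// mulrC ler_pdivrMr//.
rewrite (le_trans (sum_norm_le _))// mulrC ler_wpM2l ?enorm_ge0// ler_nat//.
Unshelve. all: by end_near. Qed.

Lemma within_setT_cvg (V : normedModType R) (f : V -> R) (x : V) :
  {within setT, continuous f} -> f @ x --> f x.
Proof.
move=> /subspace_continuousP/(_ x I) fx P Px.
have : \forall y \near x, setT y -> P (f y) by exact: fx.
by apply: filterS => y; exact.
Qed.

(** The remainder along the segment from [x] to x + h has as derivative
    the sum over the coordinates of [h] of each coordinate times the first order
    remainder of a partial derivative, which is o(|h|). *)
Lemma C2_jet u : C2_on unit_rV setT u ->
  forall x, jet2 u x (gradient u x) (hessian u x).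
Proof.
move=> [_ u1 u2] x e e0.
have ud i y : derivable u y (unit_rV i) by have [+ _] := u1 i; exact.
have uc i y : 'D_(unit_rV i) u @ y --> 'D_(unit_rV i) u y.
  by have [_] := u1 i; exact: within_setT_cvg.
have e1 : 0 < e / n.+1%:R by rewrite divr_gt0.
have : \forall h \near (0 : 'rV[R]_n), forall i,
    `|'D_(unit_rV i) u (x + h) - 'D_(unit_rV i) u x
      - dot (gradient ('D_(unit_rV i) u) x) h| <= e / n.+1%:R * enorm h.
  apply: (@filter_forall _ _ _ (nbhs (0 : 'rV[R]_n))) => i.
  apply: C1_diff; last exact: e1.
    by move=> j y; have [+ _] := u2 i j; exact.
  by move=> j; have [_] := u2 i j; exact: within_setT_cvg.
move=> /near0_enormP[d d0 dP]; apply/near0_enormP; exists d => // h hd.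
pose g s := u (x + s *: h) - dot (gradient u x) h * s
            - 2^-1 * dot (h *m hessian u x) h * s ^+ 2.
pose dg s := dot (gradient u (x + s *: h)) h - dot (gradient u x) h
             - dot (h *m hessian u x) h * s.
have gd (s : R) : Num.min 0 1 <= s <= Num.max 0 1 -> is_derive s 1 g (dg s).
  move=> _.
  have us : is_derive s 1 (fun s => u (x + s *: h)) (dot (gradient u (x + s *: h)) h).
    apply/is_deriveP_le => e' e'0.
    have e'1 : 0 < e' / (enorm h + 1) by rewrite divr_gt0// ltr_wpDl// enorm_ge0.
    have /near0_enormP[d1 d10 d1P] :=
      C1_diff ud (fun i => uc i (x + s *: h)) e'1.
    near=> k; rewrite scalerDl addrA.
    have kd : enorm (k *: h) < d1.
      rewrite enormZ (@le_lt_trans _ _ (`|k| * (enorm h + 1)))//.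
        by rewrite ler_wpM2l// lerDl.
      rewrite -ltr_pdivlMr ?ltr_wpDl ?enorm_ge0//.
      by near: k; apply: near0_lt; rewrite divr_gt0// ltr_wpDl// enorm_ge0.
    have := d1P _ kd; rewrite dotZr (mulrC k) => /le_trans; apply.
    rewrite enormZ mulrCA mulrC ler_wpM2r// mulrAC ler_pdivrMr ?ltr_wpDl ?enorm_ge0//.
    by rewrite ler_pM2l// lerDl.
  have -> : g = (fun s => u (x + s *: h)) \- (dot (gradient u x) h \*: id) \-
      ((2^-1 * dot (h *m hessian u x) h) \*: (id * id)).
    by apply/funext => r; rewrite /g expr2.
  apply: is_derive_eq.
  change (dot (gradient u (x + s *: h)) h - dot (gradient u x) h * 1 -
    (2^-1 * dot (h *m hessian u x) h) * (s * 1 + s * 1) = dg s).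
  by rewrite /dg; field.
have : `|g 1 - g 0| <= e * sqnorm h * `|1 - 0|.
  apply: MVT_bound gd _ => s; rewrite min_l// max_r// => /andP[s0 s1].
  have -> : dg s = \sum_i ('D_(unit_rV i) u (x + s *: h) - 'D_(unit_rV i) u x
      - dot (gradient ('D_(unit_rV i) u) x) (s *: h)) * h 0 i.
    rewrite /dg dot_mulmxE 2!dotE -sumrB mulr_suml -sumrB; apply: eq_bigr => i _.
    rewrite !mxE -!mulrBl dotZr dotE [RHS]mulrBl; congr (_ - _).
    rewrite mulrC -mulrA; congr (_ * _); rewrite mulr_suml.
    by apply: eq_bigr => j _; rewrite !mxE; ring.
  apply: le_trans (ler_norm_sum _ _ _) _.
  apply: (@le_trans _ _ (\sum_(i < n) (e / n.+1%:R * enorm h * enorm h))).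
    apply: ler_sum => i _; rewrite normrM ler_pM// ?coord_le_enorm//.
    have sh : enorm (s *: h) <= enorm h.
      by rewrite enormZ ger0_norm// ler_piMl// enorm_ge0.
    rewrite (le_trans (dP _ _ i)) ?(le_lt_trans sh)// ler_wpM2l// ltW//.
  rewrite sumr_const card_ord -mulrA -expr2 enorm_sqr -[leLHS]mulr_natl mulrA.
  rewrite ler_wpM2r ?sqnorm_ge0// mulrCA ger_pMr// ler_pdivrMr// mul1r ler_nat//.
by rewrite /g scale0r scale1r addr0 subr0 normr1 mulr1; congr (`|_| <= _); ring.
Unshelve. all: by end_near. Qed.

Lemma C2_cvg u : C2_on unit_rV setT u ->
  (forall x, gradient u @ x --> gradient u x) /\
  (forall x, hessian u @ x --> hessian u x).
Proof.
move=> [_ u1 u2]; split=> x.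
  apply: (@cvg_mx R _ (nbhs x) _ _ _ (gradient u)) => i j; rewrite mxE.
  under eq_fun do rewrite mxE.
  by have [_] := u1 j; exact: within_setT_cvg.
apply: (@cvg_mx R _ (nbhs x) _ _ _ (hessian u)) => i j.
have E : (fun y => hessian u y i j) = 'D_(unit_rV j) ('D_(unit_rV i) u).
  by apply/funext => y; rewrite mxE.
have Dc : 'D_(unit_rV j) ('D_(unit_rV i) u) @ x --> 'D_(unit_rV j) ('D_(unit_rV i) u) x.
  by have [_] := u2 i j; exact: within_setT_cvg.
have Ex : hessian u x i j = 'D_(unit_rV j) ('D_(unit_rV i) u) x by rewrite mxE.
by rewrite -Ex -E in Dc.
Qed.

End C2Jets.

(** * The elliptic function on symmetric matrices *)

Section PositiveMatrices.
Context {R : realType} {n : nat}.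
Implicit Types (G P E M : 'M[R]_n) (x y z : 'rV[R]_n).

Definition psd P := P^T = P /\ forall z, 0 <= dot (z *m P) z.

Lemma sym_mxP M : sym_mx M <-> M^T = M.
Proof.
rewrite /sym_mx/= is_hermitianmxE expr0 scale1r.
rewrite (_ : map_mx _ _ = M^T); last by apply/matrixP => i j; rewrite !mxE.
by split=> [/eqP<-|->].
Qed.

Lemma sym_entry M i j : M^T = M -> M i j = M j i.
Proof. by move=> Ms; rewrite -{1}Ms mxE. Qed.

Lemma posdef_mxP P : posdef_mx P <->
  P^T = P /\ forall z, z != 0 -> 0 < dot (z *m P) z.
Proof. by rewrite /posdef_mx/= sym_mxP. Qed.

Lemma posdef_psd P : posdef_mx P -> psd P.
Proof.
move=> /posdef_mxP[Ps P0]; split=> // z.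
have [->|/P0/ltW//] := eqVneq z 0; by rewrite mul0mx dot0l.
Qed.

Lemma dot_delta M i j : dot (delta_mx 0 i *m M) (delta_mx 0 j) = M i j.
Proof. by rewrite -rowE dotC /dot -rowE !mxE. Qed.

Lemma psd_diag P i : psd P -> 0 <= P i i.
Proof. by move=> [_ P0]; rewrite -dot_delta P0. Qed.

(** If the diagonal entry at [i] vanishes, then so does the whole row:
    otherwise the form would be negative at some x e_i + e_j. *)
Lemma psd_diag0 P i j : psd P -> P i i = 0 -> P i j = 0.
Proof.
move=> [Ps P0] Pii; apply/eqP; apply: contraT => Pij.
have /(_ (- (P j j + 1) / P i j / 2)) : forall a, 0 <= 2 * a * P i j + P j j.
  move=> a; have := P0 (a *: delta_mx 0 i + delta_mx 0 j).
  rewrite mulmxDl dotDl !dotDr -!scalemxAl !dotZl !dotZr !dot_delta Pii.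
  by rewrite (sym_entry j i Ps); lra.
have -> : 2 * (- (P j j + 1) / P i j / 2) * P i j = - (P j j + 1) by field.
lra.
Qed.

Lemma dot_mulmxC P x y : P^T = P -> dot (x *m P) y = dot (y *m P) x.
Proof. by move=> Ps; rewrite dot_mulmx Ps dotC. Qed.

Lemma mxtrace_rank1 G x : \tr (G *m (x^T *m x)) = dot (x *m G) x.
Proof. by rewrite mulmxA mxtrace_mulC mulmxA trace_mx11. Qed.

(** Subtracting squares of rows, as in a Cholesky decomposition, clears the
    diagonal entries of [P] one at a time; each square contributes a value of
    the form [G]. *)
Lemma psd_tr_ge0 G P : psd G -> psd P -> 0 <= \tr (G *m P).
Proof.
move=> psdG; have [k] := ubnP #|[pred i | P i i != 0]|.
elim: k P => // k IH P Pk psdP; have [Ps P0] := psdP.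
have [PD|] := boolP [forall i, P i i == 0].
  have -> : P = 0.
    by apply/matrixP => i j; rewrite mxE psd_diag0//; apply/eqP/(forallP PD).
  by rewrite mulmx0 mxtrace0.
rewrite negb_forall => /existsP[i Pii].
have Pi0 : 0 < P i i by rewrite lt0r Pii psd_diag.
pose w := row i P; pose P' := P - (P i i)^-1 *: (w^T *m w).
have wE z : dot z w = dot (z *m P) (delta_mx 0 i).
  by rewrite dot_mulmx Ps -rowE.
have quad z : dot (z *m P') z = dot (z *m P) z - (P i i)^-1 * dot z w ^+ 2.
  by rewrite mulmxBr dotBl -scalemxAr mulmx_rank1 !dotZl (dotC w) expr2.
have psdP' : psd P'.
  split; first by rewrite /P' linearB/= linearZ/= trmx_mul trmxK Ps.
  move=> z; rewrite quad; pose a := dot z w / P i i.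
  have := P0 (z - a *: delta_mx 0 i).
  rewrite mulmxBl dotBl !dotBr -!scalemxAl !dotZl !dotZr dot_delta.
  rewrite (dot_mulmxC (delta_mx 0 i) _ Ps) -wE /a.
  rewrite (_ : _ - _ = dot (z *m P) z - (P i i)^-1 * dot z w ^+ 2)//.
  by field.
have P'le j : P' j j <= P j j.
  rewrite !mxE lerBlDr lerDl mulr_ge0 ?invr_ge0 ?(ltW Pi0)// big_ord1 !mxE.
  by rewrite -expr2 sqr_ge0.
have -> : P = P' + (P i i)^-1 *: (w^T *m w) by rewrite subrK.
rewrite mulmxDr mxtraceD -scalemxAr mxtraceZ mxtrace_rank1.
rewrite addr_ge0//; last by rewrite mulr_ge0 ?invr_ge0 ?(ltW Pi0)//; exact: psdG.2.
apply: IH => //; rewrite -ltnS (leq_trans _ Pk)// ltnS; apply: proper_card.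
apply/properP; split.
  apply/fintype.subsetP => j; rewrite !inE; apply: contraNN => /eqP Pj0.
  by rewrite eq_le psd_diag// andbT -Pj0 P'le.
exists i; first by rewrite inE.
rewrite inE/= negbK !mxE big_ord1 !mxE.
by apply/eqP; field.
Qed.

Lemma psdZ a P : 0 <= a -> psd P -> psd (a *: P).
Proof.
move=> a0 [Ps P0]; split; first by rewrite linearZ/= Ps.
by move=> z; rewrite -scalemxAr dotZl mulr_ge0.
Qed.

Lemma psd_posdefD P a : psd P -> 0 < a -> posdef_mx (P + a%:M).
Proof.
move=> [Ps P0] a0; apply/posdef_mxP; split.
  by rewrite linearD/= Ps tr_scalar_mx.
move=> z z0; rewrite mulmxDr dotDl dot_scalar_mx ltr_wpDl//.
by rewrite mulr_gt0// -sqnormE sqnorm_gt0.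
Qed.

Lemma norm1_le (E : 'M[R]_n) : norm1 E <= n%:R ^+ 2 * `|E|.
Proof.
rewrite /norm1 (@le_trans _ _ (\sum_(i < n) \sum_(j < n) `|E|))//.
  by apply: ler_sum => i _; apply: ler_sum => j _; exact: mx_coord_le_norm.
by rewrite !sumr_const card_ord -mulrnA -[leLHS]mulr_natl natrM expr2.
Qed.

Lemma mxtrace_mul_le (G E : 'M[R]_n) : `|\tr (G *m E)| <= norm1 G * `|E|.
Proof.
rewrite /mxtrace /norm1 mulr_suml (le_trans (ler_norm_sum _ _ _))//.
apply: ler_sum => i _; rewrite mxE mulr_suml (le_trans (ler_norm_sum _ _ _))//.
apply: ler_sum => j _; rewrite normrM ler_wpM2l// mx_coord_le_norm//.
Qed.

Lemma scalar_mx_norm_le (a : R) : `|a%:M : 'M[R]_n| <= `|a|.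
Proof.
rewrite [leLHS]/Num.Def.normr/= mx_normrE; apply/bigmax_leP; split=> //.
by move=> [i j] _ /=; rewrite mxE; case: eqP => _ /=; rewrite ?mulr1n// normr0.
Qed.

End PositiveMatrices.

Section EllipticFunction.
Context {R : realType} {n : nat}.
Variables (U : set 'M[R]_n) (F : 'M[R]_n -> R).
Hypothesis U_sym : U `<=` sym_mx.
Hypothesis U_open : open (U : set (subspace (@sym_mx R n))).
Hypothesis U_convex : forall M N : 'M[R]_n, sym_mx M -> posdef_mx N ->
  convex_set (U `&` [set M + t *: N | t in [set t : R | 0 < t]]
              : set (convex_lmodType 'M[R]_n)).
Hypothesis F_C2 : C2_on unit_sym U F.
Hypothesis F_elliptic : forall M : 'M[R]_n, U M -> posdef_mx (mx_gradient F M).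

Lemma U_ball M : U M -> exists2 d, 0 < d &
  forall N, N^T = N -> `|N - M| < d -> U N.
Proof.
move=> UM; have := U_open; rewrite openE => /(_ M UM).
move=> UN; have {UN} : \forall N \near M, sym_mx N -> U N.
  have : within sym_mx (nbhs M) U by rewrite (nbhs_subspace_in (U_sym UM)).
  exact.
case/nbhs_normP => d /= d0 dP; exists d => // N /sym_mxP Ns NM.
by apply: dP => //=; rewrite distrC.
Qed.

Lemma sum_unit_symE (c : 'I_n * 'I_n -> R) :
  \sum_ij c ij *: unit_sym ij = \matrix_(i, j) (2^-1 * (c (i, j) + c (j, i))).
Proof.
pose C : 'M[R]_n := \matrix_(i, j) c (i, j).
have CE : C = \sum_ij c ij *: delta_mx ij.1 ij.2.
  rewrite [LHS]matrix_sum_delta pair_bigA/=.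
  by apply: eq_bigr => -[i j] _ /=; rewrite mxE.
transitivity (2^-1 *: (C + C^T)); last by apply/matrixP => i j; rewrite !mxE.
rewrite {2}CE {1}CE linear_sum/= -big_split/= scaler_sumr; apply: eq_bigr => ij _.
have -> : (c ij *: delta_mx ij.1 ij.2)^T = c ij *: delta_mx ij.2 ij.1 :> 'M[R]_n.
  by rewrite linearZ/= trmx_delta.
by rewrite /unit_sym -scalerDr !scalerA mulrC.
Qed.

(** [F] is differentiable at points of [U] in the strong sense needed for a
    perturbation argument: both points may vary. *)
Lemma F_strict M : U M -> forall eta, 0 < eta -> exists2 d, 0 < d &
  forall N N', N^T = N -> N'^T = N' -> `|N - M| < d -> `|N' - M| < d ->
    U N /\
    `|F N - F N' - \tr (mx_gradient F M *m (N - N'))| <= eta * norm1 (N - N').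
Proof.
move=> UM eta eta0; have [d1 d10 d1P] := U_ball UM.
have [_ F1 _] := F_C2.
have : \forall N \near M, forall ij, U N ->
    `|'D_(unit_sym ij) F N - 'D_(unit_sym ij) F M| <= eta.
  apply: (@filter_forall _ _ _ (nbhs M)) => ij.
  have [_ /subspace_continuousP/(_ M UM)] := F1 ij.
  move=> /(@cvgrPdist_le R R 'M[R]_n (within U (nbhs M)))/(_ _ eta0) H.
  have {}H : \forall N \near M, U N -> `|'D_(unit_sym ij) F M - 'D_(unit_sym ij) F N| <= eta by exact: H.
  by apply: filterS H => N; rewrite distrC.
move=> /nbhs_normP[d2 /= d20 d2P].
pose d := Num.min d1 d2; have d0 : 0 < d by rewrite lt_min d10.
have Ms : M^T = M by apply/sym_mxP/U_sym.
exists d => // N N' Ns N's NM N'M; split.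
  by apply: d1P => //; rewrite (lt_le_trans NM)// ge_min lexx.
have ptE A : A^T = A ->
    M + \sum_ij (fun ij => (A - M) ij.1 ij.2) ij *: unit_sym ij = A.
  move=> As; rewrite sum_unit_symE; apply/matrixP => i j; rewrite !mxE/=.
  by rewrite (sym_entry j i As) (sym_entry j i Ms); field.
have cd A : `|A - M| < d -> forall ij : 'I_n * 'I_n, `|(A - M) ij.1 ij.2| < d.
  by move=> AM ij; rewrite (le_lt_trans (mx_coord_le_norm _ _ _)).
have := @partials_strict R _ _ (@unit_sym R n) F M d eta
  (fun ij => 'D_(unit_sym ij) F M) _ (fun ij => (N - M) ij.1 ij.2)
  (fun ij => (N' - M) ij.1 ij.2) (cd N NM) (cd N' N'M).
rewrite !ptE// => H.
have {H} := H _; set lhs := (X in X -> _).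
have -> : \tr (mx_gradient F M *m (N - N')) =
    \sum_ij 'D_(unit_sym ij) F M * ((N - M) ij.1 ij.2 - (N' - M) ij.1 ij.2).
  rewrite /mxtrace; under eq_bigr do rewrite mxE.
  rewrite pair_bigA/=; apply: eq_bigr => -[i j] _ /=; rewrite !mxE.
  by rewrite (sym_entry j i Ns) (sym_entry j i N's); congr (_ * _); ring.
have -> : norm1 (N - N') = \sum_ij `|(N - M) ij.1 ij.2 - (N' - M) ij.1 ij.2|.
  rewrite /norm1 pair_bigA/=; apply: eq_bigr => -[i j] _ /=; rewrite !mxE.
  by congr `|_|; ring.
apply; rewrite /lhs => c ccd ij; rewrite sum_unit_symE.
set A := M + _.
have As : A^T = A.
  by rewrite /A linearD/= Ms; congr (_ + _); apply/matrixP => i j; rewrite !mxE addrC.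
have AM : `|A - M| < d.
  rewrite /A addrC addKr [ltLHS]/Num.Def.normr/= mx_normrE.
  apply/bigmax_ltP; split=> // -[i j] _ /=; rewrite mxE.
  have := ccd (i, j); have := ccd (j, i); rewrite !ltr_norml => /andP[? ?] /andP[? ?].
  by apply/andP; split; lra.
have UA : U A by apply: d1P => //; rewrite (lt_le_trans AM)// ge_min lexx.
split; first by have [+ _] := F1 ij; exact.
by apply: d2P => //=; rewrite distrC (lt_le_trans AM)// ge_min lexx orbT.
Qed.

(** Ellipticity makes [F] increasing along segments; the convexity hypothesis
    is what keeps the segment inside [U]. *)
Let F_mono_posdef M P : U M -> posdef_mx P -> U (M + P) -> F M <= F (M + P).
Proof.
move=> UM pP UMP; have Ms : M^T = M by apply/sym_mxP/U_sym.
have [Ps P0] := (posdef_mxP P).1 pP.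
have [d d0 dP] := U_ball UM.
(* The open half-line must contain [M] itself, hence a base point before it. *)
pose s := d / (`|P| + 1) / 2.
have P10 : 0 < `|P| + 1 by rewrite ltr_wpDl.
have s0 : 0 < s by rewrite !divr_gt0.
pose M0 := M - s *: P.
have M0s : sym_mx M0 by apply/sym_mxP; rewrite /M0 linearB/= linearZ/= Ms Ps.
have seg t : 0 <= t <= 1 -> U (M + t *: P).
  move=> /andP[t0 t1].
  have := U_convex M0s pP.
  set A := (X in convex_set X) => cA.
  have AM : M \in A.
    apply/mem_set; split=> //; exists s => //.
    by rewrite /M0 subrK.
  have AMP : M + P \in A.
    apply/mem_set; split=> //; exists (s + 1) => /=; first by rewrite addr_gt0.
    by rewrite /M0 scalerDl scale1r addrA subrK.
  have t01 : 0 <= 1 - t <= 1 by lra.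
  have [+ _] := set_mem (cA _ _ (Itv01 (andP t01).1 (andP t01).2) AM AMP).
  congr U; transitivity ((1 - t) *: M + t *: (M + P)).
    change ((1 - t) *: M + (1 - (1 - t)) *: (M + P) = (1 - t) *: M + t *: (M + P)).
    by congr (_ *: _ + _ *: _); ring.
  by rewrite scalerDr addrA -scalerDl subrK scale1r.
have gd (t : R) : Num.min 0 1 <= t <= Num.max 0 1 ->
    is_derive t 1 (fun t => F (M + t *: P)) (\tr (mx_gradient F (M + t *: P) *m P)).
  rewrite min_l// max_r// => /seg Ut; apply/is_deriveP_le => e e0.
  have e1 : 0 < e / (norm1 P + 1) by rewrite divr_gt0// ltr_wpDl// norm1_ge0.
  have [r r0 rP] := F_strict Ut e1.
  have Mts a : (M + a *: P)^T = M + a *: P by rewrite linearD/= linearZ/= Ms Ps.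
  near=> h.
  have hE : M + (t + h) *: P - (M + t *: P) = h *: P.
    by rewrite scalerDl opprD addrACA subrr add0r addrAC subrr add0r.
  have hr : `|(M + (t + h) *: P) - (M + t *: P)| < r.
    rewrite hE normrZ.
    rewrite (@le_lt_trans _ _ (`|h| * (`|P| + 1)))//.
      by rewrite ler_wpM2l// lerDl.
    by rewrite -ltr_pdivlMr//; near: h; apply: near0_lt; rewrite divr_gt0.
  have [|_] := rP _ _ (Mts (t + h)) (Mts t) hr; first by rewrite subrr normr0.
  rewrite hE -scalemxAr mxtraceZ (mulrC h) => /le_trans; apply.
  have -> : norm1 (h *: P) = `|h| * norm1 P.
    rewrite /norm1 mulr_sumr; apply: eq_bigr => i _; rewrite mulr_sumr.
    by apply: eq_bigr => j _; rewrite mxE normrM.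
  rewrite mulrCA mulrC ler_wpM2r// mulrAC ler_pdivrMr ?ltr_wpDl ?norm1_ge0//.
  by rewrite ler_pM2l// lerDl.
have [c] := MVT_between gd; rewrite min_l// max_r// => /seg Uc.
rewrite scale1r scale0r addr0 subr0 mulr1 => FE; rewrite -subr_ge0 FE.
by apply: psd_tr_ge0; apply: posdef_psd => //; exact: F_elliptic.
Unshelve. all: by end_near. Qed.

(** A semidefinite difference is reached from the definite case by adding a
    small multiple of the identity to [N], which changes [F] little. *)
Lemma F_mono M N : U M -> U N -> psd (N - M) -> F M <= F N.
Proof.
move=> UM UN psdNM; rewrite leNgt; apply/negP => FNM.
have Ns : N^T = N by apply/sym_mxP/U_sym.
have [d d0 dP] := F_strict UN ltr01.
set G := mx_gradient F N in dP.
have C0 : 0 < norm1 G + n%:R ^+ 2 + 1.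
  by rewrite ltr_wpDl// addr_ge0 ?norm1_ge0// exprn_ge0.
pose a := Num.min (d / 2) ((F M - F N) / (norm1 G + n%:R ^+ 2 + 1) / 2).
have a0 : 0 < a by rewrite lt_min !divr_gt0// subr_gt0.
have Ia : `|a%:M : 'M[R]_n| <= a.
  by rewrite (le_trans (scalar_mx_norm_le _))// gtr0_norm.
have ad : a < d.
  by rewrite (@le_lt_trans _ _ (d / 2))// ?ge_min ?lexx// ltr_pdivrMr// mulr_natr mulr2n ltrDl.
have [||| UNa] := dP (N + a%:M) N _ Ns.
- by rewrite linearD/= Ns tr_scalar_mx.
- by rewrite addrC addKr (le_lt_trans Ia).
- by rewrite subrr normr0.
rewrite (addrC N) addrK mul1r => FNa.
have FMNa : F M <= F (a%:M + N).
  rewrite -(subrKC M (a%:M + N)).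
  have pP : posdef_mx (a%:M + N - M).
    by rewrite -addrA addrC; exact: psd_posdefD.
  by apply: F_mono_posdef => //; rewrite subrKC addrC.
have : F M - F N <= (norm1 G + n%:R ^+ 2) * a.
  rewrite (le_trans (lerB FMNa (lexx _)))// -[leLHS](subrK (\tr (G *m a%:M))).
  rewrite mulrDl addrC lerD//.
    by rewrite (le_trans (ler_norm _))// (le_trans (mxtrace_mul_le _ _))// ler_wpM2l// norm1_ge0.
  rewrite (le_trans (ler_norm _))// (le_trans FNa)// (le_trans (norm1_le _))//.
  by rewrite ler_wpM2l// exprn_ge0.
apply/negP; rewrite -ltNge.
have : a * (norm1 G + n%:R ^+ 2 + 1) <= (F M - F N) / 2.
  by rewrite -ler_pdivlMr// mulrAC ge_min lexx orbT.
have : 0 < F M - F N by rewrite subr_gt0.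
by nra.
Qed.

End EllipticFunction.

(** * Compact sets and closed conditions *)

Section Compactness.
Context {R : realType} {n : nat}.
Implicit Types (A : set 'rV[R]_n) (f : 'rV[R]_n -> R) (x y : 'rV[R]_n).

Lemma closed_fun_ge f a : (forall y, f @ y --> f y) -> closed [set y | a <= f y].
Proof.
move=> fc; apply: (@preimage_closed _ _ f [set t | a <= t]); last exact: closed_ge.
by move=> y _; exact: fc.
Qed.

Lemma closed_fun_le f a : (forall y, f @ y --> f y) -> closed [set y | f y <= a].
Proof.
move=> fc; apply: (@preimage_closed _ _ f [set t | t <= a]); last exact: closed_le.
by move=> y _; exact: fc.
Qed.

Lemma compact_enorm A r : closed A -> (forall y, A y -> enorm y <= r) -> compact A.
Proof.
move=> cA Ar; apply: bounded_closed_compact => //.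
exists r; split; first exact: num_real.
move=> M rM y /Ar yr; apply: le_trans (norm_le_enorm _) _.
by rewrite (le_trans yr)// ltW.
Qed.

Lemma compact_min A f : A !=set0 -> compact A -> (forall y, A y -> f @ y --> f y) ->
  exists2 c, A c & forall y, A y -> f c <= f y.
Proof.
move=> A0 cA fc; have [|c cI cmin] := EVT_min_rV A0 cA (f := f).
  by apply: continuous_in_subspaceT => y /set_mem; exact: fc.
by exists c => [|y Ay]; [exact: set_mem|apply: cmin; exact: mem_set].
Qed.

Lemma cvg_enormB y0 y : enorm (z - y0) @[z --> y] --> enorm (y - y0).
Proof. apply: (@cvg_enorm R _ (nbhs y)); apply: (@cvgB _ _ _ (nbhs y)).
  exact: (@cvg_id _ (nbhs y)).
exact: (@cvg_cst _ y0 _ (nbhs y)). Qed.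

Lemma cvg_dotr y0 y : dot y0 z @[z --> y] --> dot y0 y.
Proof. apply: (@cvg_dot R _ (nbhs y)).
  exact: (@cvg_cst _ y0 _ (nbhs y)).
exact: (@cvg_id _ (nbhs y)). Qed.

Lemma cvg_enorm_id y : enorm z @[z --> y] --> enorm y.
Proof. by apply: (@cvg_enorm R _ (nbhs y)); exact: (@cvg_id _ (nbhs y)). Qed.

End Compactness.

(** * The Hopf lemma *)

Section ConformalMatrix.
Context {R : realType} {n : nat}.

(** The conformal Hessian of [u] in terms of the jet [s], [p], [H] of
    v = u^(-2/(n-2)), in which it is polynomial. *)
Definition conf_mx (s : R) (p : 'rV[R]_n) (H : 'M[R]_n) : 'M[R]_n :=
  s *: H - (2^-1 * sqnorm p)%:M.

Lemma conf_mx_sym s p H : H^T = H -> (conf_mx s p H)^T = conf_mx s p H.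
Proof. by move=> Hs; rewrite /conf_mx linearB/= linearZ/= Hs tr_scalar_mx. Qed.

Lemma cvg_conf_mx T (Fi : set_system T) (FF : Filter Fi)
    (s : T -> R) (p : T -> 'rV[R]_n) (H : T -> 'M[R]_n) s0 p0 H0 :
  s @ Fi --> s0 -> p @ Fi --> p0 -> H @ Fi --> H0 ->
  conf_mx (s t) (p t) (H t) @[t --> Fi] --> conf_mx s0 p0 H0.
Proof.
move=> ss pp HH; apply: cvgB; first exact: cvgZ.
by apply: cvg_scalar_mx; apply: cvgM; [exact: cvg_cst|exact: cvg_sqnorm].
Qed.

Lemma powR_lip (tau s0 S a b : R) : 0 <= tau -> 0 < s0 -> s0 <= a -> a <= b ->
  b <= S -> b `^ tau - a `^ tau <= tau * S `^ tau / s0 * (b - a).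
Proof.
move=> tau0 s00 s0a ab bS.
have gd (t : R) : Num.min a b <= t <= Num.max a b ->
    is_derive t 1 (fun t => t `^ tau) (tau * t `^ (tau - 1)).
  rewrite min_l// => /andP[at_ _]; apply: is_derive1_powR.
  by rewrite (lt_le_trans s00)// (le_trans s0a).
have [c] := MVT_between gd; rewrite min_l// max_r// => /andP[ac cb] ->.
rewrite ler_wpM2r ?subr_ge0// -!mulrA ler_wpM2l//.
have c0 : 0 < c by rewrite (lt_le_trans s00)// (le_trans s0a).
rewrite powRB; last by rewrite (gt_eqF c0) implybT.
rewrite powRr1 ?(ltW c0)// ler_pM ?powR_ge0 ?invr_ge0 ?(ltW c0)//.
  by rewrite ge0_ler_powR ?nnegrE ?(ltW c0)// ?(le_trans cb)// (le_trans (ltW c0))// (le_trans cb).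
by rewrite lef_pV2 ?posrE// (le_trans s0a).
Qed.

Lemma half_sqr_le (a b : R) : 0 <= a -> a <= 1 -> 0 <= b -> b <= 3 ->
  2^-1 * (a * b) ^+ 2 <= 5 * a.
Proof.
move=> a0 a1 b0 b3; have ab : a * b <= 3 by rewrite -[3]mul1r ler_pM.
have ab' : a * b <= a * 3 by rewrite ler_wpM2l.
have : (a * b) ^+ 2 <= 3 * (a * 3) by rewrite expr2 ler_pM// mulr_ge0.
lra.
Qed.

End ConformalMatrix.

(** What comparison arguments need of [U] and [F]: near each point of [U] two
    values of [F] differ by the trace against a fixed positive definite matrix,
    up to a relatively small error, and [F] respects the order of symmetric
    matrices even between distant points of [U]. *)
Definition strictly_elliptic {R : realType} {n : nat}
    (U : set 'M[R]_n) (F : 'M[R]_n -> R) :=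
  (forall M, U M -> exists2 G, posdef_mx G & forall eta, 0 < eta ->
     exists2 d, 0 < d & forall N N', N^T = N -> N'^T = N' ->
       `|N - M| < d -> `|N' - M| < d ->
       U N /\ `|F N - F N' - \tr (G *m (N - N'))| <= eta * norm1 (N - N')) /\
  (forall M N, U M -> U N -> psd (N - M) -> F M <= F N).

Section Hopf.
Context {R : realType} {n : nat}.
Variables (U : set 'M[R]_n) (F : 'M[R]_n -> R) (tau : R).
Hypothesis UF : strictly_elliptic U F.
Hypothesis tau_ge0 : 0 <= tau.

Variables (v w : 'rV[R]_n -> R) (gv gw : 'rV[R]_n -> 'rV[R]_n).
Variables (Hv Hw : 'rV[R]_n -> 'M[R]_n) (y0 : 'rV[R]_n).

Let level y := dot y0 (y - y0).
Let barrier K y := level y + K * level y ^+ 2.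

Let barrier_jet K y : jet2 (barrier K) y ((1 + 2 * K * level y) *: y0)
  ((2 * K) *: (y0^T *m y0)).
Proof.
have jl : jet2 level y y0 0.
  apply: jet2_eq (jet2D (jet2_dot y0 y) (jet2_cst (- dot y0 y0) y)) => //.
  - by move=> z; rewrite /level /= dotBr.
  - by rewrite addr0.
  - by rewrite addr0.
apply: jet2_eq (jet2D jl (jet2Z K (jet2M jl jl))) => [z| |].
- by rewrite /barrier /= expr2.
- rewrite scalerDr !scalerA -scalerDl -[X in X + _ = _](scale1r y0) -scalerDl.
  by congr (_ *: _); ring.
- rewrite add0r !scaler0 !add0r scalerDr -scalerDl; congr (_ *: _); ring.
Qed.

Hypothesis y0_neq0 : y0 != 0.
Hypothesis v_gt0 : forall y, 0 < v y.
Hypothesis v_jet : forall y, jet2 v y (gv y) (Hv y).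
Hypothesis Hv_sym : forall y, (Hv y)^T = Hv y.
Hypothesis v_adm : forall y, U (conf_mx (v y) (gv y) (Hv y)).
Hypothesis v_eq : forall y, F (conf_mx (v y) (gv y) (Hv y)) = v y `^ tau.
Hypothesis w_jet : \forall y \near y0, jet2 w y (gw y) (Hw y).
Hypothesis Hw_sym : \forall y \near y0, (Hw y)^T = Hw y.
Hypothesis w_le : \forall y \near y0, 0 <= level y ->
  F (conf_mx (w y) (gw y) (Hw y)) <= w y `^ tau.
Hypothesis gw_cont : gw @ y0 --> gw y0.
Hypothesis Hw_cont : Hw @ y0 --> Hw y0.
Hypothesis w_adm : U (conf_mx (w y0) (gw y0) (Hw y0)).
Hypothesis vw_eq : v y0 = w y0.
Hypothesis vw_lt : \forall y \near y0, 0 <= level y -> y != y0 -> v y < w y.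

(** The matrix of the barrier perturbation: if w - v - eps * barrier has an
    interior minimum at [y], then the conformal matrix of [v] is at most that
    of [w] plus [pert]. *)
Let pert K eps y :=
  - (2 * eps * K * v y) *: (y0^T *m y0) - (w y - v y) *: Hw y
  + (eps * (1 + 2 * K * level y) * dot (gw y) y0
     - 2^-1 * (eps * (1 + 2 * K * level y)) ^+ 2 * sqnorm y0)%:M.

Let touch K eps y : jet2 w y (gw y) (Hw y) -> (Hw y)^T = Hw y ->
  (\forall z \near y, w y - v y - eps * barrier K y
                   <= w z - v z - eps * barrier K z) ->
  psd (conf_mx (w y) (gw y) (Hw y) + pert K eps y
       - conf_mx (v y) (gv y) (Hv y)).
Proof.
move=> jw Hs ymin.
have := jet2B (jet2B jw (v_jet y)) (jet2Z eps (barrier_jet K y)).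
move=> /jet2_min/(_ ymin)[/subr0_eq/eqP].
rewrite scalerA subr_eq addrC -subr_eq => /eqP <- Hge.
rewrite (_ : _ - _ = v y *: (Hw y - Hv y - eps *: ((2 * K) *: (y0^T *m y0)))).
  apply: psdZ; first exact: ltW.
  by split => //; rewrite !linearB/= Hs Hv_sym !linearZ/= trmx_mul trmxK.
rewrite /conf_mx /pert sqnormB dotZr sqnormZ.
set Y := y0^T *m y0; set a := sqnorm y0; set c := eps * _.
apply/matrixP => i j; rewrite !mxE; case: eqP => _ /=; rewrite ?mulr1n ?mulr0n.
  by field.
by ring.
Qed.

(** If a supersolution [w] lies above the solution [v] on the outer side of the
    hyperplane through [y0] orthogonal to [y0] and touches it at [y0], then
    w - v grows linearly along the normal. The difference dominates
    eps * barrier on a half ball: it does so on the boundary for small [eps],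
    and at an interior negative minimum of w - v - eps * barrier the matrix
    inequality [touch], the monotonicity of [F] and the linearization of [F]
    contradict each other as soon as [K] is large, because the second
    derivative of the barrier along [y0] then outweighs all other terms. *)
Lemma hopf : exists2 eps, 0 < eps & exists2 t0, 0 < t0 &
  forall t, 0 <= t <= t0 -> eps * t <= w (y0 + t *: y0) - v (y0 + t *: y0).
Proof.
have N0 : 0 < sqnorm y0 by rewrite sqnorm_gt0.
have e0 : 0 < enorm y0 by rewrite enorm_gt0.
have [strict mono] := UF.
have [G posG dG] := strict _ w_adm.
have psdG := posdef_psd posG.
have g0 : 0 < dot (y0 *m G) y0 by have [_] := (posdef_mxP G).1 posG; exact.
set g := dot _ _ in g0.
have trG : 0 <= \tr G.
  rewrite -[G]mulmx1; apply: psd_tr_ge0 => //; split; first exact: trmx1.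
  by move=> z; rewrite mulmx1 -sqnormE sqnorm_ge0.
pose s0 := v y0 / 2; pose S := 2 * v y0.
have v00 := v_gt0 y0.
have s00 : 0 < s0 by rewrite divr_gt0.
have w_cont : w @ y0 --> w y0 by apply: jet2_cont; exact: nbhs_singleton w_jet.
pose C1 := `|dot (gw y0) y0| + 1; pose C2 := `|Hw y0| + 1.
have C10 : 0 < C1 by rewrite ltr_wpDl.
have C20 : 0 < C2 by rewrite ltr_wpDl.
pose C3 := tau * S `^ tau / s0.
have C30 : 0 <= C3 by rewrite !mulr_ge0 ?powR_ge0// invr_ge0 ltW.
(* [bad] * eps bounds all contributions that do not carry the factor [K]. *)
pose bad := 2 * norm1 G * C2 + 3 * C1 * \tr G + 2 * C3 + 2.
have bad0 : 0 < bad.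
  have p1 : 0 <= norm1 G * C2 by rewrite mulr_ge0 ?norm1_ge0// ltW.
  have p2 : 0 <= C1 * \tr G by rewrite mulr_ge0// ltW.
  by rewrite /bad -!mulrA; lra.
pose K := bad / (2 * s0 * g) + 1.
have K1 : 1 <= K by rewrite lerDr divr_ge0 ?mulr_ge0// ltW.
have K0 : 0 < K by exact: lt_le_trans K1.
have Kbad : bad <= 2 * K * s0 * g.
  have sg : 0 < 2 * s0 * g by rewrite !mulr_gt0.
  have : bad <= K * (2 * s0 * g).
    by rewrite mulrDl divfK ?gt_eqF// mul1r lerDl ltW.
  by rewrite (_ : K * _ = 2 * K * s0 * g)//; ring.
clearbody K.
(* The perturbation at an interior minimum has norm at most eps * [CE]. *)
pose CE := 2 * K * S * `|y0^T *m y0| + 2 * C2 + 3 * C1 + 5 * sqnorm y0.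
have CE0 : 0 < CE.
  have q : 0 <= 2 * K * S * `|y0^T *m y0| by rewrite !mulr_ge0// ltW.
  by rewrite /CE; lra.
have nCE : 0 <= n%:R ^+ 2 * CE by rewrite mulr_ge0 ?exprn_ge0// ltW.
pose eta := (n%:R ^+ 2 * CE + 1)^-1.
have eta0 : 0 < eta by rewrite invr_gt0 ltr_wpDl.
have etaE : eta * (n%:R ^+ 2 * CE) <= 1.
  by rewrite mulrC ler_pdivrMr ?mul1r ?lerDl// ltr_wpDl.
have lc y : level z @[z --> y] --> level y.
  have -> : level = fun z => dot y0 z - dot y0 y0.
    by apply/funext => z; rewrite /level dotBr.
  apply: (@cvgB _ _ _ (nbhs y)); first exact: cvg_dotr.
  exact: (@cvg_cst _ (dot y0 y0) _ (nbhs y)).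
have [d d0 dP] := dG _ eta0.
have d20 : 0 < d / 2 by rewrite divr_gt0.
have : \forall y \near y0,
  [/\ jet2 w y (gw y) (Hw y), (Hw y)^T = Hw y,
      (0 <= level y -> F (conf_mx (w y) (gw y) (Hw y)) <= w y `^ tau) &
      [/\ s0 <= v y, w y <= S, `|dot (gw y) y0| <= C1, `|Hw y| <= C2 &
      [/\ `|conf_mx (w y) (gw y) (Hw y) - conf_mx (w y0) (gw y0) (Hw y0)| < d / 2,
          level y <= K^-1 & (0 <= level y -> y != y0 -> v y < w y)]]].
  have cw : conf_mx (w y) (gw y) (Hw y) @[y --> y0] --> conf_mx (w y0) (gw y0) (Hw y0).
    exact: (@cvg_conf_mx R n _ (nbhs y0)).
  have cg : dot (gw y) y0 @[y --> y0] --> dot (gw y0) y0.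
    apply: (@cvg_dot R _ (nbhs y0)) => //.
    exact: (@cvg_cst _ y0 _ (nbhs y0)).
  have n1 : \forall y \near y0, s0 <= v y.
    apply: (@cvgr_ge _ _ (nbhs y0) _ _ (v y0) (jet2_cont (v_jet y0))).
    by rewrite /s0 ltr_pdivrMr// mulr_natr mulr2n ltrDl.
  have n2 : \forall y \near y0, w y <= S.
    apply: (@cvgr_le _ _ (nbhs y0) _ _ (w y0) w_cont).
    by rewrite -vw_eq /S mulr_natl mulr2n ltrDl.
  have n3 : \forall y \near y0, `|dot (gw y) y0| <= C1.
    apply: (@cvgr_norm_le _ _ _ (nbhs y0) _ _ (dot (gw y0) y0) cg).
    by rewrite ltrDl.
  have n4 : \forall y \near y0, `|Hw y| <= C2.
    apply: (@cvgr_norm_le _ _ _ (nbhs y0) _ _ (Hw y0) Hw_cont).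
    by rewrite ltrDl.
  have n5 : \forall y \near y0,
    `|conf_mx (w y) (gw y) (Hw y) - conf_mx (w y0) (gw y0) (Hw y0)| < d / 2.
    have /(@cvgrPdist_lt _ _ _ (nbhs y0))/(_ _ d20) := cw.
    by apply: filterS => y; rewrite distrC.
  have n6 : \forall y \near y0, level y <= K^-1.
    by apply: (@cvgr_le _ _ (nbhs y0) _ _ (level y0) (lc y0)); rewrite /level subrr dot0r invr_gt0.
  near=> y; do ![split] => //; try (by near: y).
move=> /near_enormP[r r0 rP]; clearbody C1 C2.
pose r' := r / 2; have r'0 : 0 < r' by rewrite divr_gt0.
have r'r : r' < r by rewrite ltr_pdivrMr// mulr_natr mulr2n ltrDl.
pose D := [set y | 0 <= level y] `&` [set y | enorm (y - y0) <= r'].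
have Dnear y : D y -> enorm (y - y0) < r by move=> [_ /= yr]; exact: le_lt_trans r'r.
have closedD : closed D.
  apply: closedI; first exact: closed_fun_ge.
  by apply: closed_fun_le => y; exact: cvg_enormB.
have boundD y : D y -> enorm y <= r' + enorm y0.
  by move=> [_ /= yr]; rewrite -[y](subrK y0) (le_trans (ler_enormD _ _))// lerD2r.
have compactD : compact D by exact: compact_enorm boundD.
have W_cont y : D y -> w z - v z @[z --> y] --> w y - v y.
  move=> /Dnear/rP[jw _ _ _].
  apply: (@cvgB _ _ _ (nbhs y)); [exact: jet2_cont jw|exact: jet2_cont (v_jet y)].
have W_gt0 y : D y -> y != y0 -> 0 < w y - v y.
  by move=> Dy yy0; rewrite subr_gt0; have [_ _ _ [_ _ _ _ [_ _]]] := rP y (Dnear y Dy); apply=> //; case: Dy.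
have W_ge0 y : D y -> 0 <= w y - v y.
  move=> Dy; have [->|/(W_gt0 _ Dy)/ltW//] := eqVneq y y0.
  by rewrite -vw_eq subrr.
(* On the round part of the boundary w - v is bounded below by a positive
   constant; on the flat part the barrier vanishes. *)
have [c c0 cP] : exists2 c, 0 < c &
    forall y, D y -> enorm (y - y0) = r' -> c <= w y - v y.
  pose S1 := D `&` [set y | r' <= enorm (y - y0)].
  have [[z S1z]|S10] := pselect (S1 !=set0); last first.
    by exists 1 => // y Dy yr; case: S10; exists y; split => //=; rewrite yr.
  have cS1 : compact S1.
    apply: (@compact_enorm _ _ _ (r' + enorm y0)) => [|y [Dy _]]; last exact: boundD.
    by apply: closedI => //; apply: closed_fun_ge => y; exact: cvg_enormB.
  have [|y [Dy yr] ymin] := compact_min (ex_intro _ z S1z) cS1 (f := fun y => w y - v y).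
    by move=> y [Dy _]; exact: W_cont.
  exists (w y - v y).
    apply: W_gt0 => //; apply: contraTneq yr => /= ->.
    by rewrite subrr enorm0 -ltNge.
  by move=> y' Dy' yr'; apply: ymin; split => //=; rewrite yr'.
pose eps := Num.min 1 (Num.min (d / 2 / CE / 2) (c / 4)).
have eps0 : 0 < eps by rewrite !lt_min ltr01 !divr_gt0.
have eps1 : eps <= 1 by rewrite ge_min lexx.
have epsd : eps * CE < d / 2.
  have : eps <= d / 2 / CE / 2 by rewrite !ge_min lexx orbT.
  rewrite ler_pdivlMr// ler_pdivlMr// => h.
  have : 0 < eps * CE by rewrite mulr_gt0.
  by lra.
have epsc : 2 * eps < c.
  have : eps <= c / 4 by rewrite !ge_min lexx !orbT.
  by lra.
clearbody eps.
have K_level y : D y -> [/\ 0 <= level y, level y <= 1, 0 <= K * level y & K * level y <= 1].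
  move=> Dy; have l0 : 0 <= level y by case: Dy.
  have [_ _ _ [_ _ _ _ [_ lK _]]] := rP y (Dnear y Dy).
  have Kl : K * level y <= 1 by rewrite mulrC -ler_pdivlMr// div1r.
  split=> //; last by rewrite mulr_ge0// ltW.
  by rewrite (le_trans _ Kl)// ler_peMl.
have barrierE y : barrier K y = level y * (1 + K * level y) by rewrite /barrier; ring.
have barrier_le2 y : D y -> barrier K y <= 2.
  move=> /K_level[l0 l1 Kl0 Kl1]; rewrite barrierE -[leRHS]mul1r ler_pM//; first exact: addr_ge0.
  by rewrite -[2]/(1 + 1 : R) lerD2l.
pose psi y := w y - v y - eps * barrier K y.
have Dy0 : D y0 by split; rewrite /= /level ?subrr ?dot0r// enorm0 ltW.
have psi_ge0 y : D y -> 0 <= psi y.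
  have [|y1 Dy1 y1min] := compact_min (ex_intro _ y0 Dy0) compactD (f := psi).
    move=> z Dz; apply: (@cvgB _ _ _ (nbhs z)); first exact: W_cont.
    apply: (@cvgM _ _ (nbhs z)); first exact: (@cvg_cst _ eps _ (nbhs z)).
    exact: jet2_cont (barrier_jet K z).
  suff psi1 : 0 <= psi y1 by move=> Dy; exact: le_trans (y1min _ Dy).
  rewrite leNgt; apply/negP => psi1.
  have [l0 l1 Kl0 Kl1] := K_level _ Dy1.
  have lpos : 0 < level y1.
    rewrite lt0r l0 andbT; apply: contraTneq psi1 => l10.
    by rewrite -leNgt /psi barrierE l10 mul0r mulr0 subr0 W_ge0.
  have rlt : enorm (y1 - y0) < r'.
    rewrite lt_neqAle; apply/andP; split; last by case: Dy1.
    apply: contraTneq psi1 => yr; rewrite -leNgt /psi subr_ge0.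
    rewrite (le_trans _ (cP _ Dy1 yr))// (le_trans _ (ltW epsc))//.
    by rewrite mulrC ler_wpM2r ?(ltW eps0)// barrier_le2.
  have [jw Hs /(_ l0) wle [s0v wS gC HC [Adist _ _]]] := rP _ (Dnear _ Dy1).
  have locmin : \forall z \near y1, psi y1 <= psi z.
    have nl : \forall z \near y1, 0 < level z.
      exact: (@cvgr_gt _ _ (nbhs y1) _ _ (level y1) (lc y1)).
    have nr : \forall z \near y1, enorm (z - y0) < r'.
      exact: (@cvgr_lt _ _ (nbhs y1) _ (fun z => enorm (z - y0)) _ (@cvg_enormB R n y0 y1)).
    near=> z; apply: y1min; split => /=; apply: ltW; by near: z.
  have tpsd := touch jw Hs locmin.
  set E := pert K eps y1 in tpsd; set A := conf_mx (w y1) _ _ in tpsd Adist wle.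
  pose th := w y1 - v y1.
  have th0 : 0 <= th by exact: W_ge0.
  have th2 : th <= 2 * eps.
    have : th < eps * barrier K y1 by rewrite -subr_lt0.
    move=> /ltW/le_trans; apply.
    by rewrite mulrC ler_wpM2r ?(ltW eps0)// barrier_le2.
  pose ka := 1 + 2 * K * level y1.
  have ka1 : 1 <= ka by rewrite lerDl -mulrA mulr_ge0.
  have ka0 : 0 <= ka by exact: le_trans ka1.
  have ka3 : ka <= 3.
    by rewrite /ka -mulrA -[3]/(1 + 2 : R) lerD2l ger_pMr.
  have vS : v y1 <= S by rewrite (le_trans _ wS)// -subr_ge0.
  have As : A^T = A by exact: conf_mx_sym.
  have Es : E^T = E.
    rewrite /E /pert linearD/= linearB/= !linearZ/= trmx_mul trmxK Hs.
    by rewrite tr_scalar_mx.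
  have Enorm : `|E| <= eps * CE.
    rewrite /E /pert -/th -/ka.
    pose rhs := 2 * eps * K * S * `|y0^T *m y0| + 2 * eps * C2
                + (3 * eps * C1 + 5 * eps * sqnorm y0).
    apply: (@le_trans _ _ rhs); last by rewrite /rhs /CE le_eqVlt; apply/orP; left; apply/eqP; ring.
    apply: le_trans (ler_normD _ _) _; apply: lerD.
      apply: le_trans (ler_normB _ _) _; apply: lerD.
        rewrite normrZ normrN ler_wpM2r// ger0_norm.
          by rewrite ler_wpM2l// !mulr_ge0// ltW.
        by rewrite !mulr_ge0// ltW.
      by rewrite normrZ ger0_norm// ler_pM.
    apply: le_trans (scalar_mx_norm_le _) _.
    apply: le_trans (ler_normB _ _) _; apply: lerD.
      rewrite normrM ler_pM// ger0_norm ?mulr_ge0 ?(ltW eps0)//.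
      by rewrite mulrC ler_wpM2r// ltW.
    rewrite ger0_norm; last by rewrite mulr_ge0 ?(ltW N0)// mulr_ge0 ?invr_ge0// sqr_ge0.
    by rewrite ler_wpM2r ?(ltW N0)// half_sqr_le// ltW.
  have [UAE FAE] : U (A + E) /\
      `|F (A + E) - F A - \tr (G *m E)| <= eta * norm1 E.
    have := dP (A + E) A; rewrite linearD/= As Es => /(_ erefl erefl).
    rewrite (addrC A E) addrK; apply.
      rewrite (addrC E) -addrA addrCA [ltRHS]splitr.
      by rewrite (le_lt_trans (ler_normD _ _))// ltr_leD// ?(le_lt_trans Enorm)// ltW.
    by rewrite (lt_trans Adist)// ltr_pdivrMr// mulr_natr mulr2n ltrDl.
  have Fv := mono _ _ (v_adm y1) UAE tpsd.
  have trE : \tr (G *m E) <= eps * (- (2 * K * s0 * g) + 2 * norm1 G * C2 + 3 * C1 * \tr G).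
    rewrite /E /pert -/th -/ka mulmxDr mulmxBr !mxtraceD linearN/=.
    rewrite -!scalemxAr !mxtraceZ mxtrace_rank1 -/g mul_mx_scalar mxtraceZ.
    rewrite [leRHS]mulrDr [X in _ <= X + _]mulrDr; apply: lerD; first apply: lerD.
    - rewrite mulrN mulNr lerN2.
      rewrite (_ : 2 * eps * K * v y1 * g = eps * (2 * K * v y1 * g)); last by ring.
      rewrite ler_wpM2l ?(ltW eps0)// ler_wpM2r ?(ltW g0)// ler_wpM2l//.
      by rewrite mulr_ge0// ltW.
    - rewrite -mulrN; have GH : - \tr (G *m Hw y1) <= norm1 G * C2.
        rewrite (le_trans (ler_norm _))// normrN (le_trans (mxtrace_mul_le _ _))//.
        by rewrite ler_wpM2l// norm1_ge0.
      have gC0 : 0 <= norm1 G * C2 by rewrite mulr_ge0 ?norm1_ge0// ltW.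
      rewrite (le_trans (ler_wpM2l th0 GH))//.
      by rewrite (le_trans (ler_wpM2r gC0 th2))// -!mulrA le_eqVlt; apply/orP; left; apply/eqP; ring.
    - rewrite [leRHS]mulrA ler_wpM2r//.
      have q0 : 0 <= 2^-1 * (eps * ka) ^+ 2 * sqnorm y0.
        by rewrite mulr_ge0 ?(ltW N0)// mulr_ge0 ?invr_ge0// sqr_ge0.
      have : eps * ka * dot (gw y1) y0 <= eps * (3 * C1).
        rewrite -mulrA ler_wpM2l ?(ltW eps0)// (le_trans (ler_norm _))// normrM.
        by rewrite ler_pM// ger0_norm.
      by move=> le1; rewrite (le_trans _ le1)// gerBl.
  have nE : eta * norm1 E <= eps.
    rewrite (@le_trans _ _ (eta * (n%:R ^+ 2 * (eps * CE))))//.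
      rewrite ler_wpM2l ?(ltW eta0)// (le_trans (norm1_le _))//.
      by rewrite ler_wpM2l// exprn_ge0.
    rewrite [leLHS](_ : _ = eps * (eta * (n%:R ^+ 2 * CE))); last by ring.
    by rewrite ger_pMr.
  have := powR_lip tau_ge0 s00 s0v (_ : v y1 <= w y1) wS.
  rewrite -subr_ge0 => /(_ th0); rewrite -/C3 -/th => lip.
  have c3 : C3 * th <= C3 * (2 * eps) by exact: ler_wpM2l.
  move: FAE => /ler_normlP[_ FAE].
  rewrite v_eq in Fv.
  have : eps * (bad - 2 * K * s0 * g) <= 0 by rewrite mulr_ge0_le0 ?(ltW eps0)// subr_le0.
  rewrite /bad; lra.
exists (eps * sqnorm y0); first by rewrite mulr_gt0.
exists (r' / enorm y0); first by rewrite divr_gt0.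
move=> t /andP[t0 tr]; rewrite ler_pdivlMr// in tr.
have lt : level (y0 + t *: y0) = t * sqnorm y0.
  by rewrite /level addrC addKr dotZr -sqnormE.
have Dt : D (y0 + t *: y0).
  split => /=; first by rewrite lt mulr_ge0// ltW.
  by rewrite addrC addKr enormZ ger0_norm.
rewrite (le_trans _ (_ : eps * barrier K (y0 + t *: y0) <= _))//; last first.
  by rewrite -subr_ge0; exact: psi_ge0.
rewrite mulrAC -mulrA ler_wpM2l ?(ltW eps0)// barrierE lt (mulrC t).
rewrite ler_peMr ?mulr_ge0 ?(ltW N0)// lerDl.
by rewrite -(mulrC t) -lt; have [] := K_level _ Dt.
Unshelve. all: by end_near. Qed.

End Hopf.

(** * The Kelvin transform *)

Section Kelvin.
Context {R : realType} {n : nat}.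
Implicit Types (y p h : 'rV[R]_n) (H : 'M[R]_n) (v : 'rV[R]_n -> R) (l : R).

Definition sphere_inv l y := (l ^+ 2 / sqnorm y) *: y.

(** For u = v^(-(n-2)/2) this is the power -2/(n-2) of the Kelvin transform
    (l / |y|)^(n-2) u(l^2 y / |y|^2). *)
Definition kelvin l v y := sqnorm y / l ^+ 2 * v (sphere_inv l y).

Definition refl_mx y : 'M[R]_n := 1%:M - (2 / sqnorm y) *: (y^T *m y).

Definition kelvin_grad l v (p : 'rV[R]_n) y :=
  (2 * v (sphere_inv l y) / l ^+ 2) *: y + p *m refl_mx y.

Definition kelvin_hess l v (p : 'rV[R]_n) H y : 'M[R]_n :=
  (2 * (v (sphere_inv l y) / l ^+ 2 - dot p y / sqnorm y))%:M
  + (l ^+ 2 / sqnorm y) *: (refl_mx y *m H *m refl_mx y).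

Lemma refl_mx_sym y : (refl_mx y)^T = refl_mx y.
Proof. by rewrite /refl_mx linearB/= trmx1 linearZ/= trmx_mul trmxK. Qed.

Lemma kelvin_hess_sym l v p H y : H^T = H ->
  (kelvin_hess l v p H y)^T = kelvin_hess l v p H y.
Proof.
move=> Hs; rewrite /kelvin_hess; set B := refl_mx y *m H *m _.
have BT : B^T = B by rewrite /B !trmx_mul refl_mx_sym Hs mulmxA.
by rewrite linearD/= tr_scalar_mx; congr (_ + _); rewrite linearZ/= BT.
Qed.

Lemma mul_refl_mx y h : h *m refl_mx y = h - (2 / sqnorm y * dot h y) *: y.
Proof. by rewrite mulmxBr mulmx1 -scalemxAr mulmx_rank1 scalerA. Qed.

Lemma mul_refl_mxK y h : y != 0 -> h *m refl_mx y *m refl_mx y = h.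
Proof.
move=> y0; have N0 : sqnorm y != 0 by rewrite sqnorm_eq0.
have d : dot (h *m refl_mx y) y = - dot h y.
  by rewrite mul_refl_mx dotBl dotZl -sqnormE; field.
by rewrite mul_refl_mx d mul_refl_mx mulrN scaleNr opprK subrK.
Qed.

Lemma refl_mxK y : y != 0 -> refl_mx y *m refl_mx y = 1%:M.
Proof.
move=> y0; apply/row_matrixP => i.
by rewrite rowE mulmxA mul_refl_mxK// -row1 rowE mulmx1.
Qed.

Lemma refl_mx_self y : y != 0 -> y *m refl_mx y = - y.
Proof.
move=> y0; have N0 : sqnorm y != 0 by rewrite sqnorm_eq0.
rewrite mul_refl_mx -sqnormE divfK// -[X in X - _]scale1r -scalerBl.
by rewrite (_ : 1 - 2 = -1) ?scaleN1r//; ring.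
Qed.

Lemma sqnorm_refl y h : y != 0 -> sqnorm (h *m refl_mx y) = sqnorm h.
Proof.
move=> y0; rewrite !sqnormE dot_mulmx refl_mx_sym -mulmxA refl_mxK// mulmx1//.
Qed.

Lemma enorm_refl y h : y != 0 -> enorm (h *m refl_mx y) = enorm h.
Proof. by move=> y0; rewrite /enorm sqnorm_refl. Qed.

Lemma o2_near (r s : 'rV[R]_n -> R) :
  (\forall h \near (0 : 'rV[R]_n), r h = s h) -> o2 r -> o2 s.
Proof.
move=> rs ro e e0; near=> h; rewrite -(near rs h)//.
by near: h; exact: ro.
Unshelve. all: by end_near. Qed.

Lemma bigO_near k (r s : 'rV[R]_n -> R) :
  (\forall h \near (0 : 'rV[R]_n), r h = s h) -> bigO k r -> bigO k s.
Proof.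
move=> rs [C C0 rC]; exists C => //; near=> h; rewrite -(near rs h)//.
by near: h.
Unshelve. all: by end_near. Qed.

(** The expansion of [v] at the inverse point is substituted in the exact
    expansion of the inversion, and all terms of order 3 are discarded. *)
Lemma kelvin_jet l v p H y : 0 < l -> y != 0 ->
  jet2 v (sphere_inv l y) p H ->
  jet2 (kelvin l v) y (kelvin_grad l v p y) (kelvin_hess l v p H y).
Proof.
move=> l0 y0; set z := sphere_inv l y => jv.
have N0 : 0 < sqnorm y by rewrite sqnorm_gt0.
have Nn0 : sqnorm y != 0 by rewrite gt_eqF.
have ln0 : l != 0 by rewrite gt_eqF.
have e0 : 0 < enorm y by rewrite enorm_gt0.
pose kap h := sqnorm (y + h) / l ^+ 2.
pose kap0 := sqnorm y / l ^+ 2.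
have kap00 : 0 < kap0 by rewrite divr_gt0// exprn_gt0.
pose m h := h *m refl_mx y - (sqnorm h / sqnorm y) *: y.
pose k h := (kap h)^-1 *: m h.
(* The increment of the inversion is exactly m h / kap h, where [m] is a
   quadratic polynomial whose linear part is the reflection. *)
have invE h : y + h != 0 -> sphere_inv l (y + h) = z + k h.
  move=> yh0; have M0 : sqnorm (y + h) != 0 by rewrite sqnorm_eq0.
  rewrite /k /m /z /sphere_inv mul_refl_mx /kap.
  have -> : dot h y = (sqnorm (y + h) - sqnorm y - sqnorm h) / 2.
    by rewrite sqnormD dotC; field.
  move: (sqnorm (y + h)) M0 => M M0.
  by apply/rowP => j; rewrite !mxE; field; rewrite M0 Nn0 ln0.
pose r h := v (z + h) - v z - dot p h - 2^-1 * dot (h *m H) h.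
pose rem h := kap h * r (k h)
  + 2^-1 * (((kap h)^-1 - kap0^-1) * dot (m h *m H) (m h)
  + kap0^-1 * (dot (m h *m H) (m h) - dot (h *m refl_mx y *m H) (h *m refl_mx y))).
have kap_near : \forall h \near (0 : 'rV[R]_n), kap0 / 2 <= kap h <= 2 * kap0.
  have kc : kap h @[h --> (0 : 'rV[R]_n)] --> kap0.
    rewrite /kap0 -[in X in _ --> X](addr0 y).
    apply: (@cvgM _ _ (nbhs (0 : 'rV[R]_n))); last exact: (@cvg_cst _ _ _ (nbhs (0 : 'rV[R]_n))).
    apply: (@cvg_sqnorm R _ (nbhs (0 : 'rV[R]_n))).
    apply: (@cvgD _ _ _ (nbhs (0 : 'rV[R]_n))); last exact: (@cvg_id _ (nbhs (0 : 'rV[R]_n))).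
    exact: (@cvg_cst _ y _ (nbhs (0 : 'rV[R]_n))).
  near=> h; apply/andP; split; near: h.
    apply: (@cvgr_ge _ _ (nbhs (0 : 'rV[R]_n)) _ _ _ kc).
    by rewrite ltr_pdivrMr// mulr_natr mulr2n ltrDl.
  apply: (@cvgr_le _ _ (nbhs (0 : 'rV[R]_n)) _ _ _ kc).
  by rewrite mulr_natl mulr2n ltrDl.
have nz : \forall h \near (0 : 'rV[R]_n), y + h != 0.
  near=> h; apply/eqP => yh0.
  have : kap0 / 2 <= kap h <= 2 * kap0 by near: h.
  by rewrite /kap yh0 sqnorm0 mul0r => /andP[]; rewrite leNgt divr_gt0.
suff remo : o2 rem.
  apply: o2_near remo; near=> h.
  have yh0 : y + h != 0 by near: h.
  have K0 : kap h != 0 by rewrite mulf_neq0 ?invr_eq0 ?expf_neq0 ?sqnorm_eq0.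
  have kap00' : kap0 != 0 by rewrite gt_eqF.
  have kE : dot y h = ((kap h - kap0) * l ^+ 2 - sqnorm h) / 2.
    by rewrite /kap sqnormD /kap0; field.
  have gE : dot (kelvin_grad l v p y) h =
      2 * v z / l ^+ 2 * dot y h + dot p (h *m refl_mx y).
    by rewrite dotDl dotZl dot_mulmx refl_mx_sym.
  have HE : dot (h *m kelvin_hess l v p H y) h =
      2 * (v z / l ^+ 2 - dot p y / sqnorm y) * sqnorm h +
      kap0^-1 * dot (h *m refl_mx y *m H) (h *m refl_mx y).
    rewrite mulmxDr dotDl dot_scalar_mx -sqnormE -scalemxAr dotZl !mulmxA.
    by rewrite (dot_mulmx _ (refl_mx y)) refl_mx_sym /kap0 invf_div.
  have k1 : dot p (k h) = (kap h)^-1 * (dot p (h *m refl_mx y) - sqnorm h / sqnorm y * dot p y).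
    by rewrite /k /m dotZr dotBr dotZr.
  have k2 : dot (k h *m H) (k h) = (kap h)^-1 * ((kap h)^-1 * dot (m h *m H) (m h)).
    by rewrite /k -scalemxAl dotZl dotZr.
  have vE : kelvin l v (y + h) = kap h * v (z + k h) by rewrite /kelvin invE.
  have vE0 : kelvin l v y = kap0 * v z by [].
  rewrite /rem /r vE vE0 gE HE k1 k2 kE.
  move: (kap h) (kap0) K0 kap00' => K K' K0 K'0.
  by field; rewrite K0 K'0 Nn0 ln0.
have m_le : \forall h \near (0 : 'rV[R]_n), enorm (m h) <= 2 * enorm h.
  near=> h; have hy : enorm h <= enorm y by near: h; exact: near_enorm_le.
  rewrite (le_trans (ler_enormB _ _))// enorm_refl// mulr_natl mulr2n lerD2l.
  rewrite enormZ ger0_norm ?divr_ge0 ?sqnorm_ge0//.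
  rewrite mulrAC ler_pdivrMr// -!enorm_sqr !expr2 -mulrA.
  by rewrite ler_wpM2l ?enorm_ge0// ler_wpM2r ?enorm_ge0.
have part1 : o2 (fun h => kap h * r (k h)).
  move=> e e_gt0; pose e' := e * kap0 / 32.
  have e'0 : 0 < e' by rewrite divr_gt0// mulr_gt0.
  have /near0_enormP[d d0 dP] := jv _ e'0.
  near=> h.
  have /andP[k1 k2] : kap0 / 2 <= kap h <= 2 * kap0 by near: h.
  have kh0 : 0 < kap h by rewrite (lt_le_trans _ k1)// divr_gt0.
  have mh : enorm (m h) <= 2 * enorm h by near: h.
  have kh : enorm (k h) <= 4 / kap0 * enorm h.
    rewrite enormZ ger0_norm ?invr_ge0 ?(ltW kh0)//.
    rewrite [leRHS](_ : _ = (kap0 / 2)^-1 * (2 * enorm h)); last by field; rewrite gt_eqF.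
    by rewrite ler_pM ?enorm_ge0 ?invr_ge0 ?(ltW kh0)// lef_pV2 ?posrE// divr_gt0.
  have hd : enorm h <= d * kap0 / 8.
    by near: h; apply: near_enorm_le; rewrite divr_gt0// mulr_gt0.
  have khd : enorm (k h) < d.
    rewrite (le_lt_trans kh)// (@le_lt_trans _ _ (4 / kap0 * (d * kap0 / 8)))//.
      by rewrite ler_wpM2l// divr_ge0// ltW.
    rewrite [ltLHS](_ : _ = d / 2); last by field; rewrite gt_eqF.
    by rewrite ltr_pdivrMr// mulr_natr mulr2n ltrDl.
  have kh2 : sqnorm (k h) <= (4 / kap0) ^+ 2 * sqnorm h.
    have kk0 : 0 <= 4 / kap0 by rewrite divr_ge0// ltW.
    by rewrite -!enorm_sqr -exprMn lerXn2r ?nnegrE ?enorm_ge0 ?(mulr_ge0 kk0)// enorm_ge0.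
  rewrite normrM (gtr0_norm kh0).
  apply: (@le_trans _ _ (2 * kap0 * (e' * ((4 / kap0) ^+ 2 * sqnorm h)))).
    rewrite ler_pM ?(ltW kh0)// (le_trans (dP _ khd))// ler_wpM2l// ltW//.
  by rewrite /e' le_eqVlt; apply/orP; left; apply/eqP; field; rewrite gt_eqF.
have mm : bigO 2 (fun h => dot (m h *m H) (m h)).
  exists (norm1 H * 4); rewrite ?mulr_ge0 ?norm1_ge0//; near=> h.
  have mh : enorm (m h) <= 2 * enorm h by near: h.
  rewrite (le_trans (dot_mulmx_le _ _ _))// -!mulrA ler_wpM2l ?norm1_ge0//.
  rewrite [leRHS](_ : _ = (2 * enorm h) * (2 * enorm h)); last by ring.
  by rewrite ler_pM ?enorm_ge0.
have kap_inv : bigO 0 (fun h => (kap h)^-1).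
  exists (kap0 / 2)^-1; first by rewrite invr_ge0 divr_ge0// ltW.
  near=> h.
  have /andP[k1 k2] : kap0 / 2 <= kap h <= 2 * kap0 by near: h.
  have kh0 : 0 < kap h by rewrite (lt_le_trans _ k1)// divr_gt0.
  rewrite expr0 mulr1 ger0_norm ?invr_ge0 ?(ltW kh0)// lef_pV2 ?posrE//.
  by rewrite divr_gt0.
have part2 : o2 (fun h => ((kap h)^-1 - kap0^-1) * dot (m h *m H) (m h)).
  apply: bigO3_o2; apply: (@bigOM _ _ 1 2) => //.
  pose q h := (- 2 / l ^+ 2 / kap0) * dot y h + (- (l ^- 2) / kap0) * sqnorm h.
  have qO : bigO 1 q.
    apply: bigOD; first exact: (bigOM (bigO_cst _) (bigO_dot y)).
    by apply: bigOS; exact: (bigOM (bigO_cst _) bigO_sqnorm).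
  apply: bigO_near (bigOM kap_inv qO); near=> h.
  have /andP[k1 k2] : kap0 / 2 <= kap h <= 2 * kap0 by near: h.
  have kh0 : kap h != 0 by rewrite gt_eqF// (lt_le_trans _ k1)// divr_gt0.
  have kE : dot y h = ((kap h - kap0) * l ^+ 2 - sqnorm h) / 2.
    by rewrite /kap sqnormD /kap0; field.
  have kap00' : kap0 != 0 by rewrite gt_eqF.
  rewrite /q kE; move: (kap h) (kap0) kh0 kap00' => K K' K0 K'0.
  by field; rewrite K0 K'0 ln0.
have part3 : o2 (fun h => dot (m h *m H) (m h)
    - dot (h *m refl_mx y *m H) (h *m refl_mx y)).
  apply: bigO3_o2.
  have lin q : bigO 1 (fun h => dot (h *m refl_mx y) q).
    apply: bigO_eq (bigO_dot (q *m (refl_mx y)^T)) => h.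
    by rewrite [RHS]dot_mulmx dotC.
  pose c h := (sqnorm y)^-1 * sqnorm h.
  have cO : bigO 2 c by exact: (bigOM (bigO_cst _) bigO_sqnorm).
  have brO : bigO 1 (fun h => c h * dot (y *m H) y
      + (-1 * dot (h *m refl_mx y) (y *m H^T) + -1 * dot (h *m refl_mx y) (y *m H))).
    apply: bigOD; first by apply: bigOS; exact: (bigOM cO (bigO_cst _)).
    by apply: bigOD; apply: (@bigOM _ _ 0 1 _ _ (bigO_cst _)); exact: lin.
  apply: bigO_eq (bigOM cO brO) => h.
  rewrite /c /m; set q := h *m _; rewrite mulmxBl dotBl !dotBr -!scalemxAl !dotZl !dotZr.
  by rewrite (dot_mulmx q H y) (dotC (y *m H) q); field.
apply: o2_eq (o2D part1 (o2D (o2Z 2^-1 part2) (o2Z (2^-1 * kap0^-1) part3))) => h /=.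
by rewrite /rem; ring.
Unshelve. all: by end_near. Qed.

(** Conformal invariance: the gradient terms cancel in the conformal matrix. *)
Lemma kelvin_conf_mx l v p H y : 0 < l -> y != 0 ->
  conf_mx (kelvin l v y) (kelvin_grad l v p y) (kelvin_hess l v p H y) =
  refl_mx y *m conf_mx (v (sphere_inv l y)) p H *m refl_mx y.
Proof.
move=> l0 y0; have Nn0 : sqnorm y != 0 by rewrite sqnorm_eq0.
have ln0 : l != 0 by rewrite gt_eqF.
have RMR (s c : R) : refl_mx y *m (s *: H - c%:M) *m refl_mx y =
    s *: (refl_mx y *m H *m refl_mx y) - c%:M.
  move: (refl_mx y) (refl_mxK y0) => M MM.
  by rewrite mulmxBr mulmxBl -scalemxAr -!scalemxAl mul_mx_scalar -!scalemxAl MM scalemx1.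
rewrite /conf_mx RMR.
rewrite /kelvin_grad sqnormD sqnormZ sqnorm_refl// dotZl.
have -> : dot y (p *m refl_mx y) = - dot p y.
  by rewrite dotC dot_mulmx refl_mx_sym refl_mx_self// dotNr.
rewrite /kelvin_hess /kelvin; set z := sphere_inv l y; set A := refl_mx y *m H *m _.
apply/matrixP => i j; rewrite !mxE.
case: eqP => _; rewrite ?mulr1n ?mulr0n; field; rewrite ?Nn0 ?ln0//.
Qed.

End Kelvin.

(** * Moving spheres *)

Section MovingSpheres.
Context {R : realType} {n : nat}.
Variables (U : set 'M[R]_n) (F : 'M[R]_n -> R) (tau : R).
Hypothesis UF : strictly_elliptic U F.
Hypothesis tau_ge0 : 0 <= tau.
Hypothesis UF_refl : forall M y, U M -> y != 0 ->
  U (refl_mx y *m M *m refl_mx y) /\ F (refl_mx y *m M *m refl_mx y) = F M.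

Variables (v : 'rV[R]_n -> R) (g : 'rV[R]_n -> 'rV[R]_n) (H : 'rV[R]_n -> 'M[R]_n).
Hypothesis v_gt0 : forall y, 0 < v y.
Hypothesis v_jet : forall y, jet2 v y (g y) (H y).
Hypothesis H_sym : forall y, (H y)^T = H y.
Hypothesis g_cont : forall y, g @ y --> g y.
Hypothesis H_cont : forall y, H @ y --> H y.
Hypothesis v_adm : forall y, U (conf_mx (v y) (g y) (H y)).
Hypothesis v_eq : forall y, F (conf_mx (v y) (g y) (H y)) = v y `^ tau.

Variable beta : R.
Hypothesis beta_ge0 : 0 <= beta.
Hypothesis v_far : forall kap, 0 < kap -> exists2 r, 0 < r &
  forall y, r <= enorm y -> v y <= (beta + kap) * sqnorm y.

Let v_cont y : v @ y --> v y.
Proof. exact: jet2_cont (v_jet y). Qed.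

Definition below_kelvin l := forall y, l <= enorm y -> v y <= kelvin l v y.

Let radial y := v y - dot (g y) y.

Let radial_cont y : radial @ y --> radial y.
Proof.
apply: (@cvgB _ _ _ (nbhs y)); first exact: v_cont.
by apply: (@cvg_dot R _ (nbhs y)); [exact: g_cont|exact: (@cvg_id _ (nbhs y))].
Qed.

Section Continuity.
Context {T : Type} {Fi : set_system T} {FF : Filter Fi}.
Variables (l : T -> R) (z : T -> 'rV[R]_n) (l0 : R) (z0 : 'rV[R]_n).
Hypothesis z0_neq0 : z0 != 0.
Hypothesis l_cvg : l @ Fi --> l0.
Hypothesis z_cvg : z @ Fi --> z0.

Let z0_n0 : sqnorm z0 != 0.
Proof. by rewrite sqnorm_eq0. Qed.

Lemma cvg_sphere_inv : sphere_inv (l t) (z t) @[t --> Fi] --> sphere_inv l0 z0.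
Proof.
apply: cvgZ => //; apply: cvgM; last by apply: cvgV => //; exact: cvg_sqnorm.
by under eq_fun do rewrite expr2; rewrite expr2; exact: cvgM.
Qed.

Let cvg_at (V : topologicalType) (f : 'rV[R]_n -> V) (x : T -> 'rV[R]_n) x0 :
  (forall y, f @ y --> f y) -> x @ Fi --> x0 -> f (x t) @[t --> Fi] --> f x0.
Proof. by move=> fc xx; exact: (@cvg_comp _ _ _ x f _ _ _ xx (fc x0)). Qed.

Let si := cvg_sphere_inv.

Lemma cvg_kelvin : l0 != 0 -> kelvin (l t) v (z t) @[t --> Fi] --> kelvin l0 v z0.
Proof.
move=> l00; apply: cvgM; last exact: (cvg_at (@v_cont) si).
apply: cvgM; first exact: cvg_sqnorm.
apply: cvgV; first by rewrite expf_neq0.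
by under eq_fun do rewrite expr2; rewrite expr2; exact: cvgM.
Qed.

Lemma cvg_refl_mx : refl_mx (z t) @[t --> Fi] --> refl_mx z0.
Proof.
apply: cvgB; first exact: cvg_cst.
apply: cvgZ; last by apply: cvg_mulmx => //; exact: cvg_trmx.
apply: cvgM; first exact: cvg_cst.
by apply: cvgV => //; exact: cvg_sqnorm.
Qed.

Lemma cvg_kelvin_grad : l0 != 0 ->
  kelvin_grad (l t) v (g (sphere_inv (l t) (z t))) (z t) @[t --> Fi] -->
  kelvin_grad l0 v (g (sphere_inv l0 z0)) z0.
Proof.
move=> l00; apply: cvgD; last first.
  apply: cvg_mulmx; last exact: cvg_refl_mx.
  exact: (cvg_at g_cont si).
apply: cvgZ => //; apply: cvgM.
  apply: cvgM; first exact: cvg_cst.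
  exact: (cvg_at (@v_cont) si).
apply: cvgV; first by rewrite expf_neq0.
by under eq_fun do rewrite expr2; rewrite expr2; exact: cvgM.
Qed.

Lemma cvg_kelvin_hess : l0 != 0 ->
  kelvin_hess (l t) v (g (sphere_inv (l t) (z t))) (H (sphere_inv (l t) (z t))) (z t)
    @[t --> Fi] -->
  kelvin_hess l0 v (g (sphere_inv l0 z0)) (H (sphere_inv l0 z0)) z0.
Proof.
move=> l00.
have ll : l t ^+ 2 @[t --> Fi] --> l0 ^+ 2.
  by under eq_fun do rewrite expr2; rewrite expr2; exact: cvgM.
apply: cvgD.
  apply: cvg_scalar_mx; apply: cvgM; first exact: cvg_cst.
  apply: cvgB.
    apply: cvgM; first exact: (cvg_at (@v_cont) si).
    by apply: cvgV => //; rewrite expf_neq0.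
  apply: cvgM; first by apply: cvg_dot => //; exact: (cvg_at g_cont si).
  by apply: cvgV => //; exact: cvg_sqnorm.
apply: cvgZ.
  by apply: cvgM => //; apply: cvgV => //; exact: cvg_sqnorm.
apply: cvg_mulmx; last exact: cvg_refl_mx.
by apply: cvg_mulmx; [exact: cvg_refl_mx|exact: (cvg_at H_cont si)].
Qed.

End Continuity.

(** The derivative of v (s *: y) / s in [s] is - radial (s *: y) / s^2. *)
Lemma ray_mono mu y : 0 < mu -> mu <= 1 ->
  (forall s, mu <= s <= 1 -> 0 <= radial (s *: y)) -> mu * v y <= v (mu *: y).
Proof.
move=> mu0 mu1 rad.
pose f s := s^-1 * v (s *: y).
have fd (s : R) : Num.min mu 1 <= s <= Num.max mu 1 ->
    is_derive s 1 f (- (s ^- 2) * radial (s *: y)).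
  rewrite min_l// => /andP[mus _].
  have s0 : s != 0 by rewrite gt_eqF// (lt_le_trans mu0).
  have vd := jet2_ray (v_jet (s *: y)).
  have id : is_derive s 1 (fun t : R => t^-1) (- (s ^- 2)).
    have := @realfun.is_deriveV R id s 1 1 s0 (is_derive_id s (1 : R)).
    by rewrite [X in is_derive _ _ _ X](_ : _ = - (s ^- 2))//; exact: mulr1.
  have -> : f = (fun t : R => t^-1) * (fun t => v (t *: y)) by [].
  apply: is_derive_eq.
  change (s^-1 * dot (g (s *: y)) y + v (s *: y) * (- (s ^- 2)) = - s ^- 2 * radial (s *: y)).
  by rewrite /radial dotZr; field.
have [c] := MVT_between fd; rewrite min_l// max_r// => /andP[muc c1].
rewrite /f invr1 mul1r scale1r => fE.
have : v y - mu^-1 * v (mu *: y) <= 0.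
  rewrite fE mulr_le0_ge0 ?subr_ge0// mulNr oppr_le0 mulr_ge0 ?rad ?muc//.
  by rewrite invr_ge0 sqr_ge0.
by rewrite subr_le0 mulrC ler_pdivlMr// mulrC.
Qed.

Lemma kelvinE l y : 0 < l -> y != 0 ->
  kelvin l v y = (l ^+ 2 / sqnorm y)^-1 * v ((l ^+ 2 / sqnorm y) *: y).
Proof. by move=> l0 y0; rewrite invf_div. Qed.

Lemma ray_below l y : 0 < l -> l <= enorm y ->
  (forall s, l ^+ 2 / sqnorm y <= s <= 1 -> 0 <= radial (s *: y)) ->
  v y <= kelvin l v y.
Proof.
move=> l0 ly rad.
have y0 : y != 0 by rewrite -enorm_gt0 (lt_le_trans l0).
have N0 : 0 < sqnorm y by rewrite sqnorm_gt0.
have mu0 : 0 < l ^+ 2 / sqnorm y by rewrite divr_gt0// exprn_gt0.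
rewrite kelvinE// mulrC ler_pdivlMr// mulrC ray_mono//.
by rewrite ler_pdivrMr// mul1r -enorm_sqr lerXn2r ?nnegrE ?enorm_ge0// ltW.
Qed.

Let enorm_inv (l : R) (y : 'rV[R]_n) : 0 < l -> y != 0 -> enorm (sphere_inv l y) = l ^+ 2 / enorm y.
Proof.
move=> l0 y0; have e0 : enorm y != 0 by rewrite gt_eqF// enorm_gt0.
rewrite enormZ ger0_norm ?divr_ge0 ?sqr_ge0 ?sqnorm_ge0//.
by rewrite -enorm_sqr; field.
Qed.

(** Near the origin [radial] is positive, which compares [y] with its inverse
    point along the ray; farther out v = O(|y|^2), whereas the Kelvin transform
    is of order |y|^2 / l^2. *)
Lemma below_kelvin_small : exists2 l0, 0 < l0 &
  forall l, 0 < l -> l <= l0 -> below_kelvin l.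
Proof.
have v0 := v_gt0 0.
have rad0 : \forall y \near (0 : 'rV[R]_n), 0 < radial y.
  apply: (@cvgr_gt _ _ (nbhs (0 : 'rV[R]_n)) _ _ _ (@radial_cont 0)).
  by rewrite /radial dot0r subr0.
have vhalf : \forall y \near (0 : 'rV[R]_n), v 0 / 2 <= v y.
  apply: (@cvgr_ge _ _ (nbhs (0 : 'rV[R]_n)) _ _ _ (@v_cont 0)).
  by rewrite ltr_pdivrMr// mulr_natr mulr2n ltrDl.
have /near0_enormP[r r0 rP] : \forall y \near (0 : 'rV[R]_n),
    0 < radial y /\ v 0 / 2 <= v y by near=> y; split; near: y.
have [r1 r10 r1P] := v_far ltr01.
have [c cB cmax] : exists2 c, enorm c <= r1 & forall y, enorm y <= r1 -> v y <= v c.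
  have [||y _|c cB cmin] := @compact_min R n [set y | enorm y <= r1] (fun y => - v y).
  - by exists 0; rewrite /= enorm0 ltW.
  - apply: (@compact_enorm _ _ _ r1) => //; apply: closed_fun_le => y.
    exact: cvg_enorm_id.
  - by apply: (@cvgN _ _ _ (nbhs y)); exact: v_cont.
  - by exists c => // y yB; rewrite -lerN2; exact: cmin.
pose C := (beta + 1) + v c / r ^+ 2.
have C0 : 0 < C by rewrite ltr_wpDr ?divr_ge0 ?sqr_ge0 ?ltW// ltr_wpDl.
have vC y : r <= enorm y -> v y <= C * sqnorm y.
  move=> ry; have [yr1|/ltW yr1] := leP r1 (enorm y).
    rewrite (le_trans (r1P _ yr1))// ler_wpM2r ?sqnorm_ge0// lerDl.
    by rewrite divr_ge0 ?sqr_ge0// ltW.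
  rewrite (le_trans (cmax _ yr1))// mulrDl ler_wpDl ?mulr_ge0 ?addr_ge0 ?sqnorm_ge0//.
  rewrite mulrAC ler_pdivlMr ?exprn_gt0// ler_wpM2l ?(ltW (v_gt0 _))//.
  by rewrite -enorm_sqr lerXn2r ?nnegrE ?enorm_ge0// ltW.
pose l0 := Num.min (r / 2) (Num.min 1 (v 0 / 2 / C)).
have l00 : 0 < l0 by rewrite !lt_min ltr01 !divr_gt0.
exists l0 => // l lpos ll0 y ly.
have lr : l <= r / 2 by rewrite (le_trans ll0)// ge_min lexx.
have l1 : l <= 1 by rewrite (le_trans ll0)// !ge_min lexx orbT.
have lC : l * C <= v 0 / 2 by rewrite -ler_pdivlMr// (le_trans ll0)// !ge_min lexx !orbT.
have y0 : y != 0 by rewrite -enorm_gt0 (lt_le_trans lpos).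
have N0 : 0 < sqnorm y by rewrite sqnorm_gt0.
have [ry|yr] := leP r (enorm y); last first.
  apply: ray_below => // s /andP[s0 s1]; apply: ltW.
  have s0' : 0 <= s by rewrite (le_trans _ s0)// divr_ge0 ?sqr_ge0// ltW.
  have [] // := rP (s *: y); rewrite enormZ ger0_norm// (le_lt_trans _ yr)//.
  by rewrite ler_piMl// enorm_ge0.
have vinv : v 0 / 2 <= v (sphere_inv l y).
  have [] // := rP (sphere_inv l y); rewrite enorm_inv//.
  rewrite (@le_lt_trans _ _ l)//.
    rewrite ler_pdivrMr ?enorm_gt0// expr2 ler_wpM2l// ltW//.
  by rewrite (le_lt_trans lr)// ltr_pdivrMr// mulr_natr mulr2n ltrDl.
rewrite (le_trans (vC _ ry))// /kelvin mulrAC mulrC ler_pdivlMr ?exprn_gt0//.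
rewrite -mulrA ler_wpM2l ?sqnorm_ge0//.
rewrite (le_trans _ vinv)// (le_trans _ lC)// mulrC ler_wpM2r ?(ltW C0)//.
by rewrite expr2 ler_piMl// ltW.
Unshelve. all: by end_near. Qed.

Lemma below_kelvin_closed L : 0 < L ->
  (forall l, 0 < l -> l < L -> below_kelvin l) -> below_kelvin L.
Proof.
move=> L0 below y Ly; rewrite leNgt; apply/negP => vlt.
have y0 : y != 0 by rewrite -enorm_gt0 (lt_le_trans L0).
have Ln0 : L != 0 by rewrite gt_eqF.
have kc : kelvin l v y @[l --> L] --> kelvin L v y.
  by apply: cvg_kelvin => //; exact: cvg_cst.
have /nbhs_normP[d /= d0 dP] : \forall l \near L, kelvin l v y < v y.
  exact: (@cvgr_lt _ _ (nbhs L) _ (fun l => kelvin l v y) _ kc).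
pose l := L - Num.min (d / 2) (L / 2).
have m0 : 0 < Num.min (d / 2) (L / 2) by rewrite lt_min !divr_gt0.
have md : Num.min (d / 2) (L / 2) <= d / 2 by rewrite ge_min lexx.
have mL : Num.min (d / 2) (L / 2) <= L / 2 by rewrite ge_min lexx orbT.
have l0 : 0 < l by rewrite /l; lra.
have lL : l < L by rewrite /l; lra.
have := dP l; rewrite /= /l opprB addrC subrK gtr0_norm// => /(_ _)/wrap[|].
  lra.
by apply/negP; rewrite -leNgt; apply: below => //; rewrite (le_trans (ltW lL)).
Qed.

(** Where the Kelvin transform touches [v] from above along a sphere outside of
    which it is larger, the Hopf lemma separates the radial derivatives. *)
Let touch_slope L y0 : 0 < L -> L <= enorm y0 -> v y0 = kelvin L v y0 ->
  (forall y, enorm y0 < enorm y -> v y < kelvin L v y) ->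
  0 < dot (kelvin_grad L v (g (sphere_inv L y0)) y0 - g y0) y0.
Proof.
move=> L0 Ly0 vw vlt.
have y00 : y0 != 0 by rewrite -enorm_gt0 (lt_le_trans L0).
have Ln0 : L != 0 by rewrite gt_eqF.
have near_n0 : \forall y \near y0, y != 0.
  have : \forall y \near y0, 0 < enorm y.
    apply: (@cvgr_gt _ _ (nbhs y0) _ _ (enorm y0)); last by rewrite enorm_gt0.
    exact: cvg_enorm_id.
  by apply: filterS => y; rewrite enorm_gt0.
have level_gt y : 0 <= dot y0 (y - y0) -> y != y0 -> enorm y0 < enorm y.
  move=> ly yy0; rewrite ltr_enorm ?enorm_ge0// enorm_sqr -(subrKC y0 y).
  rewrite sqnormD -addrA ltrDl ltr_wpDl ?mulr_ge0//.
  by rewrite sqnorm_gt0 subr_eq0.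
have w_jet : \forall y \near y0, jet2 (kelvin L v) y
    (kelvin_grad L v (g (sphere_inv L y)) y)
    (kelvin_hess L v (g (sphere_inv L y)) (H (sphere_inv L y)) y).
  by apply: filterS near_n0 => y yn0; exact: kelvin_jet.
have w_sym : \forall y \near y0,
    (kelvin_hess L v (g (sphere_inv L y)) (H (sphere_inv L y)) y)^T =
    kelvin_hess L v (g (sphere_inv L y)) (H (sphere_inv L y)) y.
  by apply: filterE => y; exact: kelvin_hess_sym.
have wU y : y != 0 -> U (conf_mx (kelvin L v y) (kelvin_grad L v (g (sphere_inv L y)) y)
    (kelvin_hess L v (g (sphere_inv L y)) (H (sphere_inv L y)) y)) /\
  F (conf_mx (kelvin L v y) (kelvin_grad L v (g (sphere_inv L y)) y)
    (kelvin_hess L v (g (sphere_inv L y)) (H (sphere_inv L y)) y)) =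
  v (sphere_inv L y) `^ tau.
  move=> yn0; rewrite kelvin_conf_mx//.
  by have [UM ->] := UF_refl (v_adm (sphere_inv L y)) yn0; rewrite v_eq.
have w_le : \forall y \near y0, 0 <= dot y0 (y - y0) ->
  F (conf_mx (kelvin L v y) (kelvin_grad L v (g (sphere_inv L y)) y)
    (kelvin_hess L v (g (sphere_inv L y)) (H (sphere_inv L y)) y)) <= kelvin L v y `^ tau.
  apply: filterS near_n0 => y yn0 ly; rewrite (wU y yn0).2.
  have Ly : L <= enorm y.
    by have [->//|/(level_gt _ ly)/ltW] := eqVneq y y0; exact: le_trans.
  have v0 := v_gt0 (sphere_inv L y).
  have vk : v (sphere_inv L y) <= kelvin L v y.
    rewrite /kelvin ler_peMl ?(ltW v0)// ler_pdivlMr ?exprn_gt0// mul1r -enorm_sqr.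
    by rewrite lerXn2r ?nnegrE ?enorm_ge0// ltW.
  by rewrite ge0_ler_powR ?nnegrE ?(ltW v0)// (le_trans (ltW v0)).
have w_lt : \forall y \near y0, 0 <= dot y0 (y - y0) -> y != y0 -> v y < kelvin L v y.
  by apply: filterE => y ly yy0; apply: vlt; exact: level_gt.
have gc : kelvin_grad L v (g (sphere_inv L y)) y @[y --> y0] -->
    kelvin_grad L v (g (sphere_inv L y0)) y0.
  apply: (@cvg_kelvin_grad _ (nbhs y0) _ (fun=> L) id) => //.
  exact: (@cvg_cst _ L _ (nbhs y0)).
have Hc : kelvin_hess L v (g (sphere_inv L y)) (H (sphere_inv L y)) y @[y --> y0] -->
    kelvin_hess L v (g (sphere_inv L y0)) (H (sphere_inv L y0)) y0.
  apply: (@cvg_kelvin_hess _ (nbhs y0) _ (fun=> L) id) => //.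
  exact: (@cvg_cst _ L _ (nbhs y0)).
have [eps eps0 [t0 t00 tP]] := hopf UF tau_ge0 y00 v_gt0 v_jet H_sym v_adm v_eq
  w_jet w_sym w_le gc Hc (wU y0 y00).1 vw w_lt.
rewrite (lt_le_trans eps0)//.
have jw := nbhs_singleton w_jet.
apply: (jet2_slope (jet2B jw (v_jet y0)) _ t00) => [|t /tP//].
by rewrite /= vw subrr.
Qed.

(** At infinity the Kelvin transform behaves like v(0) |y|^2 / l^2, and
    v(0) / L^2 exceeds [beta]. *)
Lemma kelvin_far L : 0 < L -> beta * L ^+ 2 < v 0 -> exists2 r, 0 < r &
  \forall l \near L, forall y, r <= enorm y -> v y < kelvin l v y.
Proof.
move=> L0 bL; pose d := v 0 - beta * L ^+ 2.
have d0 : 0 < d by rewrite subr_gt0.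
have L20 : 0 < L ^+ 2 by rewrite exprn_gt0.
pose kap := d / 16 / L ^+ 2.
have kap0 : 0 < kap by rewrite !divr_gt0.
have [r1 r10 r1P] := v_far kap0.
have : \forall y \near (0 : 'rV[R]_n), v 0 - d / 4 < v y.
  apply: (@cvgr_gt _ _ (nbhs (0 : 'rV[R]_n)) _ _ _ (@v_cont 0)).
  by rewrite ltrBlDr ltrDl divr_gt0.
move=> /near0_enormP[r2 r20 r2P].
pose r := r1 + 8 * L ^+ 2 / r2.
have r0 : 0 < r by rewrite addr_gt0// !mulr_gt0// invr_gt0.
exists r => //.
have cl : l ^+ 2 @[l --> L] --> L ^+ 2.
  by under eq_fun do rewrite expr2; rewrite expr2; apply: cvgM; exact: cvg_id.
near=> l => y ry.
have lpos : 0 < l by near: l; exact: lt_nbhsr.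
have l4 : l ^+ 2 <= 4 * L ^+ 2.
  near: l; apply: (@cvgr_le _ _ (nbhs L) _ _ _ cl).
  by rewrite -[ltLHS]mul1r ltr_pM2r// ltr1n.
have bl : beta * l ^+ 2 < v 0 - d / 2.
  near: l; have cb : beta * l ^+ 2 @[l --> L] --> beta * L ^+ 2.
    by apply: cvgM => //; exact: cvg_cst.
  apply: (@cvgr_lt _ _ (nbhs L) _ _ _ cb).
  by rewrite /d; move: d0; rewrite /d; lra.
have y0 : y != 0 by rewrite -enorm_gt0 (lt_le_trans r0).
have e0 : 0 < enorm y by rewrite enorm_gt0.
have N0 : 0 < sqnorm y by rewrite sqnorm_gt0.
have inv_small : enorm (sphere_inv l y) < r2.
  rewrite enorm_inv// ltr_pdivrMr// (le_lt_trans l4)//.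
  have : 8 * L ^+ 2 / r2 <= enorm y by rewrite (le_trans _ ry)// lerDr ltW.
  rewrite ler_pdivrMr// => h; rewrite [ltRHS]mulrC (lt_le_trans _ h)//.
  by rewrite ltr_pM2r// ltr_nat.
have vy : v y <= (beta + kap) * sqnorm y.
  apply: r1P; rewrite (le_trans _ ry)// lerDl !mulr_ge0 ?invr_ge0 ?exprn_ge0// ltW//.
rewrite (le_lt_trans vy)// /kelvin mulrAC ltr_pdivlMr ?exprn_gt0//.
rewrite mulrAC mulrC ltr_pM2l// (lt_trans _ (r2P _ inv_small))//.
have : kap * l ^+ 2 <= d / 4.
  rewrite (le_trans (ler_wpM2l (ltW kap0) l4))// /kap.
  by rewrite le_eqVlt; apply/orP; left; apply/eqP; field; rewrite gt_eqF.
rewrite [ltLHS]mulrDl => kl; rewrite (lt_le_trans (ltr_leD bl kl))//; lra.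
Unshelve. all: by end_near. Qed.

Let cvg_kelvin_at (L : R) (y : 'rV[R]_n) : 0 < L -> y != 0 -> kelvin L v @ y --> kelvin L v y.
Proof.
move=> L0 y0; apply: (@cvg_kelvin _ (nbhs y) _ (fun=> L) id) => //.
- exact: (@cvg_cst _ L _ (nbhs y)).
- by rewrite gt_eqF.
Qed.

(** A contact point farthest from the origin would admit [touch_slope], while
    it is an interior minimum of the difference. The Hopf lemma thus also plays
    the role of the strong maximum principle. *)
Lemma kelvin_strict L : 0 < L -> beta * L ^+ 2 < v 0 -> below_kelvin L ->
  forall y, L < enorm y -> v y < kelvin L v y.
Proof.
move=> L0 bL below y1 Ly1; rewrite ltNge; apply/negP => vy1.
have [r r0 /nbhs_singleton rP] := kelvin_far L0 bL.
pose Z := [set y | enorm y1 <= enorm y /\ kelvin L v y <= v y].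
have Zr y : Z y -> enorm y <= r.
  by move=> [_ vy]; rewrite leNgt; apply/negP => /ltW/rP; rewrite ltNge vy.
have Zn0 y : Z y -> y != 0.
  by move=> [y1y _]; rewrite -enorm_gt0 (lt_le_trans _ y1y)// (lt_trans L0).
have enc := @cvg_enorm_id R n.
have cZ : closed Z.
  move=> y clZ.
  have y1y : enorm y1 <= enorm y.
    have cA : closed [set z : 'rV[R]_n | enorm y1 <= enorm z] by exact: closed_fun_ge.
    by apply: cA; apply: closureS clZ => z [].
  have y0 : y != 0 by rewrite -enorm_gt0 (lt_le_trans _ y1y)// (lt_trans L0).
  split=> //; rewrite leNgt; apply/negP => vlt.
  have wc : kelvin L v z - v z @[z --> y] --> kelvin L v y - v y.
    apply: (@cvgB _ _ _ (nbhs y)); first exact: cvg_kelvin_at.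
    exact: v_cont.
  have : \forall z \near y, 0 < kelvin L v z - v z.
    by apply: (@cvgr_gt _ _ (nbhs y) _ _ _ wc); rewrite subr_gt0.
  by move=> /clZ[z [[_ vz]]]; rewrite /= subr_gt0 ltNge vz.
have [||y _|y0 Zy0 y0max] := @compact_min R n Z (fun y => - enorm y).
- by exists y1; split.
- exact: compact_enorm Zr.
- by apply: (@cvgN _ _ _ (nbhs y)); exact: enc.
have [y1y0 vy0] := Zy0.
have Ly0 : L < enorm y0 by exact: lt_le_trans y1y0.
have vw : v y0 = kelvin L v y0.
  by apply/eqP; rewrite eq_le vy0 andbT below// ltW.
have out y : enorm y0 < enorm y -> v y < kelvin L v y.
  move=> y0y; rewrite ltNge; apply/negP => vy.
  have /y0max : Z y by split => //; rewrite (le_trans y1y0)// ltW.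
  by rewrite lerN2 leNgt y0y.
have := touch_slope L0 (ltW Ly0) vw out.
have jw := jet2B (kelvin_jet L0 (Zn0 _ Zy0) (v_jet (sphere_inv L y0))) (v_jet y0).
have [|-> _] := jet2_min jw; last by rewrite dot0l ltxx.
have : \forall y \near y0, L < enorm y.
  exact: (@cvgr_gt _ _ (nbhs y0) _ _ _ (enc y0)).
by apply: filterS => y Ly; rewrite /= -vw subrr subr_ge0 below// ltW.
Qed.

(** On the sphere itself [v] and its Kelvin transform agree, and their radial
    derivatives differ by a multiple of [radial]. *)
Lemma kelvin_radial L : 0 < L -> beta * L ^+ 2 < v 0 -> below_kelvin L ->
  forall y, enorm y = L -> 0 < radial y.
Proof.
move=> L0 bL below y yL.
have y0 : y != 0 by rewrite -enorm_gt0 yL.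
have Ln0 : L != 0 by rewrite gt_eqF.
have NL : sqnorm y = L ^+ 2 by rewrite -yL enorm_sqr.
have iy : sphere_inv L y = y by rewrite /sphere_inv NL divff ?expf_neq0// scale1r.
have ky : v y = kelvin L v y by rewrite /kelvin iy NL divff ?expf_neq0// mul1r.
have := @touch_slope L y L0 _ ky; rewrite yL lexx => /(_ isT).
move=> /(_ (kelvin_strict L0 bL below)); rewrite iy /kelvin_grad iy.
rewrite dotBl dotDl dotZl (dot_mulmx (g y)) refl_mx_sym refl_mx_self// dotNr -sqnormE NL.
have -> : 2 * v y / L ^+ 2 * L ^+ 2 - dot (g y) y - dot (g y) y = 2 * radial y.
  by rewrite /radial; field.
by rewrite pmulr_rgt0.
Qed.

(** The region far away is covered by [kelvin_far]. In the remaining shell the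
    strict inequality is stable at points off the sphere of radius [L], and the
    positivity of [radial] takes over at points close to it. *)
Lemma below_kelvin_open L : 0 < L -> beta * L ^+ 2 < v 0 -> below_kelvin L ->
  \forall l \near L, L <= l -> below_kelvin l.
Proof.
move=> L0 bL below.
have [r r0 rP] := kelvin_far L0 bL.
pose A := [set y : 'rV[R]_n | L <= enorm y] `&` [set y | enorm y <= r].
have enc := @cvg_enorm_id R n.
have cA : compact A.
  apply: (@compact_enorm _ _ _ r) => [|y []//].
  by apply: closedI; [exact: closed_fun_ge|exact: closed_fun_le].
have := (compact_near_coveringP A).1 cA R (nbhs L)
  (fun l y => 0 < l -> L <= l -> l <= enorm y -> v y <= kelvin l v y).
move=> /(_ (nbhs_filter L))/(_ _)/wrap[|cover].
  move=> y [/= Ly _].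
  have y0 : y != 0 by rewrite -enorm_gt0 (lt_le_trans L0).
  move: Ly; rewrite le_eqVlt => /orP[/eqP Ly|Ly].
    have := @radial_cont y => rc.
    have : \forall z \near y, 0 < radial z.
      by apply: (@cvgr_gt _ _ (nbhs y) _ _ _ rc); exact: (kelvin_radial L0 bL below).
    move=> /near_enormP[d d0 dP].
    have d3 : 0 < d / 4 by rewrite divr_gt0.
    have : \forall z \near y, enorm (z - y) < d / 4 by apply/near_enormP; exists (d / 4).
    move=> zn; near=> z l => l0 Ll lz.
    have zy : enorm (z - y) < d / 4 by near: z.
    apply: ray_below => // s /andP[s0 s1]; apply: ltW; apply: dP.
    have ez : 0 < enorm z by exact: lt_le_trans lz.
    have zL : enorm z - L <= enorm (z - y).
      by rewrite Ly lerBlDr -{1}(subrK y z) ler_enormD.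
    (* The inverse point of [z] is almost as close to the sphere as [z]. *)
    have s1' : (1 - s) * enorm z <= 2 * (enorm z - L).
      have sz : l ^+ 2 / enorm z <= s * enorm z.
        rewrite ler_pdivrMr// -mulrA -expr2 enorm_sqr.
        by rewrite -ler_pdivrMr// sqnorm_gt0 -enorm_gt0.
      have : L ^+ 2 / enorm z <= l ^+ 2 / enorm z.
        by rewrite ler_pM2r ?invr_gt0// lerXn2r ?nnegrE// ltW.
      have : 2 * L - enorm z <= L ^+ 2 / enorm z.
        by rewrite ler_pdivlMr//; have := sqr_ge0 (enorm z - L); lra.
      by rewrite mulrBl mul1r; lra.
    have -> : s *: z - y = (z - y) - (1 - s) *: z.
      by apply/rowP => j; rewrite !mxE; ring.
    rewrite (le_lt_trans (ler_enormB _ _))// enormZ ger0_norm ?subr_ge0//.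
    by lra.
  have kc : kelvin p.2 v p.1 - v p.1 @[p --> (nbhs y, nbhs L)] --> kelvin L v y - v y.
    apply: cvgB.
      apply: cvg_kelvin => //; last by rewrite gt_eqF.
        exact: cvg_snd.
      exact: cvg_fst.
    exact: (@cvg_comp _ _ _ fst v _ _ _ cvg_fst (@v_cont y)).
  have : \forall p \near (nbhs y, nbhs L), 0 < kelvin p.2 v p.1 - v p.1.
    apply: (@cvgr_gt R _ _ _ (fun p : 'rV[R]_n * R => kelvin p.2 v p.1 - v p.1) _ kc).
    by rewrite subr_gt0; exact: kelvin_strict.
  by apply: filterS => -[z l] /= + _ _ _; rewrite subr_gt0 => /ltW.
near=> l => Ll y ly.
have l0 : 0 < l by exact: lt_le_trans Ll.
have [ry|/ltW yr] := leP r (enorm y).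
  by apply: ltW; move: y ry {ly}; near: l.
have Ay : A y by split => //=; exact: le_trans ly.
have : A `<=` (fun y => 0 < l -> L <= l -> l <= enorm y -> v y <= kelvin l v y) by near: l.
by move=> /(_ y Ay); apply.
Unshelve. all: by end_near. Qed.

(** Continuity method: the admissible radii below the threshold form a set
    that is open, closed and nonempty. *)
Theorem below_kelvin_all L : 0 < L -> beta * L ^+ 2 <= v 0 -> below_kelvin L.
Proof.
suff main L1 : 0 < L1 -> beta * L1 ^+ 2 < v 0 -> below_kelvin L1.
  move=> L0 bL; apply: below_kelvin_closed => // l l0 lL; apply: main => //.
  have [<-|b0] := eqVneq 0 beta; first by rewrite mul0r.
  rewrite (lt_le_trans _ bL)// ltr_pM2l ?lt0r 1?eq_sym ?b0//.
  by rewrite ltrXn2r ?nnegrE// ltW.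
move=> L0 bL.
pose S := [set l | 0 < l /\ forall m, 0 < m -> m <= l -> below_kelvin m].
suff [_ +] : S L1 by apply.
have [l0 l00 l0P] := below_kelvin_small.
have Sl0 : S l0 by split.
apply: contrapT => SL.
have Sub l : S l -> l <= L1.
  move=> [lpos lP]; rewrite leNgt; apply/negP => Ll; apply: SL; split=> // m m0 mL.
  by apply: lP => //; rewrite (le_trans mL)// ltW.
have hs : has_sup S by split; [exists l0|exists L1 => l /Sub].
pose s := sup S.
have l0s : l0 <= s by exact: sup_upper_bound.
have s0 : 0 < s by exact: lt_le_trans l0s.
have sL : s <= L1 by apply: ge_sup => //; exists l0.
have below_lt m : 0 < m -> m < s -> below_kelvin m.
  move=> m0 ms; have sm : 0 < s - m by rewrite subr_gt0.
  have [l [lpos lP] ml] := sup_adherent sm hs.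
  by apply: lP => //; apply: ltW; move: ml; rewrite /s opprB addrC subrK.
have below_s : below_kelvin s by exact: below_kelvin_closed.
have bs : beta * s ^+ 2 < v 0.
  rewrite (le_lt_trans _ bL)// ler_wpM2l// lerXn2r ?nnegrE ?(ltW s0)// ltW//.
have /nbhs_normP[d /= d0 dP] := below_kelvin_open s0 bs below_s.
have : S (s + d / 2).
  split; first by rewrite addr_gt0// divr_gt0.
  move=> m m0 ms; have [ms'|sm] := ltP m s; first exact: below_lt.
  apply: dP => //=; rewrite distrC ger0_norm ?subr_ge0//.
  by rewrite ltrBlDl (le_lt_trans ms)// ltrD2l ltr_pdivrMr// mulr_natr mulr2n ltrDl.
move=> /(sup_upper_bound hs); apply/negP; rewrite -ltNge ltrDl.
by rewrite divr_gt0.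
Qed.

End MovingSpheres.

(** * Superharmonic functions near infinity *)

Section Superharmonic.
Context {R : realType} {n : nat}.
Implicit Types (y b p : 'rV[R]_n) (f u : 'rV[R]_n -> R) (a e r : R).

Lemma mxtrace_sum_dot (M : 'M[R]_n) :
  \tr M = \sum_i dot (delta_mx 0 i *m M) (delta_mx 0 i).
Proof. by apply: eq_bigr => i _; rewrite dot_delta. Qed.

Lemma mxtrace_outer p b : \tr (p^T *m b) = dot b p.
Proof. by rewrite mxtrace_mulC trace_mx11. Qed.

Lemma jet2_min_trace f x p (M : 'M[R]_n) : jet2 f x p M ->
  (\forall y \near x, f x <= f y) -> 0 <= \tr M.
Proof.
move=> jf /(jet2_min jf)[_ M0]; rewrite mxtrace_sum_dot.
by apply: sumr_ge0 => i _; exact: M0.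
Qed.

(** As [u] is positive and the subharmonic [f] has a nonpositive upper limit at
    infinity, a negative value of u - f inside a large shell is smaller than
    all values on the outer sphere, so that the minimum is interior. *)
Lemma exterior_min u gu (Hu : 'rV[R]_n -> 'M[R]_n) f r : 0 < r ->
  (forall y, 0 < u y) -> (forall y, jet2 u y (gu y) (Hu y)) ->
  (forall y, \tr (Hu y) <= 0) ->
  (forall y, y != 0 -> exists p M, jet2 f y p M /\ 0 < \tr M) ->
  (forall e, 0 < e -> exists r', forall y, r' <= enorm y -> f y <= e) ->
  (forall y, enorm y = r -> f y <= u y) ->
  forall y, r <= enorm y -> f y <= u y.
Proof.
move=> r0 u0 uj utr fj f_far fr y1 ry1; rewrite leNgt; apply/negP => uf.
pose e := (f y1 - u y1) / 2.
have e0 : 0 < e by rewrite divr_gt0// subr_gt0.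
have [r1 r1P] := f_far _ e0.
pose r2 := Num.max (enorm y1) r1.
pose A := [set y : 'rV[R]_n | r <= enorm y] `&` [set y | enorm y <= r2].
have An0 y : A y -> y != 0 by move=> [/= ry _]; rewrite -enorm_gt0 (lt_le_trans r0).
have Ay1 : A y1 by split => //=; rewrite /r2 le_max lexx.
have [||y Ay|c Ac cmin] := @compact_min R n A (fun y => u y - f y).
- by exists y1.
- apply: (@compact_enorm _ _ _ r2) => [|y []//].
  by apply: closedI; [apply: closed_fun_ge|apply: closed_fun_le] => z; exact: cvg_enorm_id.
- apply: (@cvgB _ _ _ (nbhs y)); first exact: jet2_cont (uj y).
  by have [p [M [/jet2_cont]]] := fj y (An0 _ Ay).
have [p [M [jM trM]]] := fj c (An0 _ Ac).
have fc : u c - f c <= - (2 * e).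
  by rewrite (le_trans (cmin _ Ay1))// /e; lra.
have [/= rc cr] := Ac.
have rc' : r < enorm c.
  rewrite lt_neqAle rc andbT; apply/eqP => /esym/fr; rewrite -subr_ge0 => ufc.
  by move: fc e0 ufc; lra.
have cr' : enorm c < r2.
  rewrite lt_neqAle cr andbT; apply/eqP => cE.
  have : f c <= e by apply: r1P; rewrite cE /r2 le_max lexx orbT.
  by have := u0 c; move: fc e0; lra.
have cm : \forall y \near c, u c - f c <= u y - f y.
  have n1 : \forall y \near c, r < enorm y.
    exact: (@cvgr_gt _ _ (nbhs c) _ _ _ (@cvg_enorm_id R n c)).
  have n2 : \forall y \near c, enorm y < r2.
    exact: (@cvgr_lt _ _ (nbhs c) _ _ _ (@cvg_enorm_id R n c)).
  by near=> y; apply: cmin; split => /=; apply: ltW; near: y.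
have := jet2_min_trace (jet2B (uj c) jM) cm.
by rewrite linearB/= subr_ge0 => /le_trans/(_ (utr c)); rewrite leNgt trM.
Unshelve. all: by end_near. Qed.

Lemma jet2_powR_sqnorm a y : y != 0 ->
  jet2 (fun z => sqnorm z `^ a) y ((a * sqnorm y `^ (a - 1)) *: (2 *: y))
    ((a * sqnorm y `^ (a - 1)) *: (2 *: 1%:M) +
     (a * (a - 1) * sqnorm y `^ (a - 2)) *: ((2 *: y)^T *m (2 *: y))).
Proof.
by rewrite -sqnorm_gt0 => y0; exact: (jet2_comp (sjet_powR a y0) (jet2_sqnorm y)).
Qed.

Lemma powR_sub1 (s a : R) : 0 < s -> s `^ (a - 1) = s `^ a / s.
Proof.
move=> s0; rewrite powRB ?powRr1 ?(ltW s0)//.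
by rewrite (gt_eqF s0) implybT.
Qed.

Lemma powR_sub2 (s a : R) : 0 < s -> s `^ (a - 2) = s `^ a / s ^+ 2.
Proof.
move=> s0; rewrite (_ : a - 2 = a - 1 - 1); last by rewrite -addrA -opprD.
by rewrite !powR_sub1// expr2 invfM mulrA.
Qed.

Lemma trace_powR_sqnorm a y : y != 0 ->
  \tr ((a * sqnorm y `^ (a - 1)) *: (2 *: 1%:M) +
     (a * (a - 1) * sqnorm y `^ (a - 2)) *: ((2 *: y)^T *m (2 *: y))) =
  a * (2 * n%:R + 4 * (a - 1)) * (sqnorm y `^ a / sqnorm y) :> R.
Proof.
rewrite -sqnorm_gt0 => y0.
rewrite mxtraceD !mxtraceZ mxtrace1 mxtrace_outer dotZl dotZr -sqnormE.
rewrite powR_sub1// powR_sub2//; field; by rewrite gt_eqF.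
Qed.

Definition decay : R := (n%:R - 2) / 2.

(** A radial fundamental solution with its first two even corrections; their
    coefficients decide the sign of the Laplacian. *)
Definition ext_barrier (A B C : R) b y : R :=
  A * sqnorm y `^ (- decay) + B * sqnorm y `^ (- decay - 1)
  + C * (sqnorm y `^ (- decay - 2) * dot b y ^+ 2).

Lemma ext_barrierE A B C b y : y != 0 -> ext_barrier A B C b y =
  sqnorm y `^ (- decay) * (A + B / sqnorm y + C * dot b y ^+ 2 / sqnorm y ^+ 2).
Proof.
rewrite -sqnorm_gt0 => y0; rewrite /ext_barrier powR_sub1// powR_sub2//.
by field; rewrite gt_eqF.
Qed.

Lemma ext_barrier_jet A B C b y : y != 0 -> exists p M,
  jet2 (ext_barrier A B C b) y p M /\
  \tr M = 2 * (n%:R * B + C * sqnorm b) * sqnorm y `^ (- decay - 2).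
Proof.
move=> y0; have N0 : 0 < sqnorm y by rewrite sqnorm_gt0.
have j1 := jet2_powR_sqnorm (- decay) y0.
have j2 := jet2_powR_sqnorm (- decay - 1) y0.
have j3 := jet2_powR_sqnorm (- decay - 2) y0.
have jt := jet2M (jet2_dot b y) (jet2_dot b y).
have j := jet2D (jet2D (jet2Z A j1) (jet2Z B j2)) (jet2Z C (jet2M j3 jt)).
do 2!eexists; split.
  by apply: jet2_eq j => // z; rewrite /ext_barrier /= expr2.
have t1 := trace_powR_sqnorm (- decay) y0.
have t2 := trace_powR_sqnorm (- decay - 1) y0.
have t3 := trace_powR_sqnorm (- decay - 2) y0.
have t4 : \tr (dot b y *: (0 : 'M[R]_n) + dot b y *: 0 + b^T *m b + b^T *m b) =
    2 * sqnorm b.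
  by rewrite !scaler0 !add0r mxtraceD mxtrace_outer -sqnormE; ring.
rewrite 2!mxtraceD !mxtraceZ t1 t2 3!mxtraceD !mxtraceZ t3 t4.
rewrite !mxtrace_outer !dotZr !dotZl !dotDl !dotDr !dotZl !dotZr (dotC y b).
rewrite powR_sub1// !powR_sub2// powR_sub1// /decay.
by field; rewrite gt_eqF.
Qed.

Lemma powR_neg_small a e : a < 0 -> 0 < e -> exists2 r, 0 < r &
  forall y, r <= enorm y -> sqnorm y `^ a <= e.
Proof.
move=> a0 e0; pose s := e `^ a^-1.
have s0 : 0 < s by exact: powR_gt0.
exists (Num.sqrt s) => [|y ry]; first by rewrite sqrtr_gt0.
have sy : s <= sqnorm y.
  rewrite -enorm_sqr -[leLHS](sqr_sqrtr (ltW s0)).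
  by rewrite lerXn2r ?nnegrE ?sqrtr_ge0 ?enorm_ge0.
have -> : e = s `^ a by rewrite /s -powRrM mulVf ?lt_eqF// powRr1// ltW.
have powE (t : R) : t `^ a = (t `^ (- a))^-1 by rewrite powRN invrK.
rewrite !powE lef_pV2 ?posrE ?powR_gt0//.
  by rewrite ge0_ler_powR ?nnegrE ?oppr_ge0 ?sqnorm_ge0// ltW.
exact: lt_le_trans sy.
Qed.

Hypothesis n_ge3 : (3 <= n)%N.

Lemma decay_gt0 : 0 < decay.
Proof. by rewrite divr_gt0// subr_gt0 ltr_nat. Qed.

Lemma ext_barrier_far A B C b : 0 <= C ->
  forall e, 0 < e -> exists r, forall y, r <= enorm y -> ext_barrier A B C b y <= e.
Proof.
move=> C0 e e0; pose K := `|A| + `|B| + C * sqnorm b + 1.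
have K0 : 0 < K.
  by rewrite ltr_wpDl// !addr_ge0// mulr_ge0// sqnorm_ge0.
have d0 : - decay < 0 by rewrite oppr_lt0 decay_gt0.
have [r r0 rP] := powR_neg_small d0 (divr_gt0 e0 K0).
exists (Num.max r 1) => y; rewrite ge_max => /andP[ry y1].
have y0 : y != 0 by rewrite -enorm_gt0 (lt_le_trans ltr01).
have N1 : 1 <= sqnorm y by rewrite -enorm_sqr -(expr1n _ 2) lerXn2r ?nnegrE ?enorm_ge0.
have N0 : 0 < sqnorm y by exact: lt_le_trans N1.
rewrite ext_barrierE// -(divfK (lt0r_neq0 K0) e).
apply: (@le_trans _ _ (sqnorm y `^ (- decay) * K)); last first.
  by rewrite ler_wpM2r ?(ltW K0)//; exact: rP.
rewrite ler_wpM2l ?powR_ge0// /K -!addrA; apply: lerD; first exact: ler_norm.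
apply: lerD.
  rewrite ler_pdivrMr// (le_trans (ler_norm _))// ler_peMr//.
rewrite (@le_trans _ _ (C * sqnorm b))// ?lerDl//.
rewrite ler_pdivrMr ?exprn_gt0// -mulrA ler_wpM2l//.
rewrite (le_trans (dot_sqr_le _ _))// ler_wpM2l ?sqnorm_ge0//.
by rewrite expr2 ler_peMl// ltW.
Qed.

(** Comparison with [ext_barrier] outside the unit ball. For v = u^(-2/(n-2))
    the conclusion is the growth bound v = O(|y|^2). *)
Lemma superharmonic_lower u gu (Hu : 'rV[R]_n -> 'M[R]_n) :
  (forall y, 0 < u y) -> (forall y, jet2 u y (gu y) (Hu y)) ->
  (forall y, \tr (Hu y) <= 0) ->
  exists2 c, 0 < c & forall y, 1 <= enorm y -> c * sqnorm y `^ (- decay) <= u y.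
Proof.
move=> u0 uj utr.
have [||y _|z _ zmin] := @compact_min R n [set y | enorm y <= 1] u.
- by exists 0; rewrite /= enorm0.
- by apply: (@compact_enorm _ _ _ 1) => //; exact: closed_fun_le (@cvg_enorm_id R n).
- exact: jet2_cont (uj y).
pose c := u z / 2; have c0 : 0 < c by rewrite divr_gt0.
exists c => // y y1.
have y0 : y != 0 by rewrite -enorm_gt0 (lt_le_trans ltr01).
have n0 : (0 : R) < n%:R by rewrite ltr0n (leq_trans _ n_ge3).
have := @exterior_min u gu Hu (ext_barrier c c 0 0) 1 ltr01 u0 uj utr.
move=> /(_ _ _ _ y y1)/wrap[|||].
- move=> x x0; have [p [M [jM tM]]] := ext_barrier_jet c c 0 0 x0.
  exists p, M; split=> //; rewrite tM mulr_gt0 ?powR_gt0 ?sqnorm_gt0//.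
  by rewrite mul0r addr0 !mulr_gt0.
- exact: ext_barrier_far.
- move=> x x1; have x0 : x != 0 by rewrite -enorm_gt0 x1.
  rewrite ext_barrierE// -enorm_sqr x1 expr1n powR1 !mul0r !divr1 addr0 mul1r.
  by rewrite /c -splitr; apply: zmin; rewrite /= x1.
apply: le_trans; rewrite ext_barrierE// mulrC ler_wpM2l ?powR_ge0//.
by rewrite !mul0r addr0 lerDl divr_ge0 ?sqnorm_ge0// ltW.
Qed.

Lemma powR_tangent (c s s0 : R) : 0 <= c -> 0 < s -> 0 < s0 ->
  s0 `^ (- c) + c * s0 `^ (- c - 1) * (s0 - s) <= s `^ (- c).
Proof.
move=> c0 ss s00; have z0 : 0 < s / s0 by rewrite divr_gt0.
set z := s / s0 in z0.
have -> : s `^ (- c) = z `^ (- c) * s0 `^ (- c).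
  by rewrite -powRM ?(ltW z0) ?(ltW s00)// /z divfK ?gt_eqF.
rewrite powR_sub1//.
have -> : s0 `^ (- c) + c * (s0 `^ (- c) / s0) * (s0 - s) =
    (1 - c * (z - 1)) * s0 `^ (- c).
  by rewrite /z; field; rewrite gt_eqF.
rewrite ler_wpM2r ?powR_ge0// /powR gt_eqF//.
rewrite (le_trans _ (expR_ge1Dx _))// lerD2l mulNr lerN2 ler_wpM2l//.
have z1 : -1 < z - 1 by rewrite ltrBrDl subrr.
by have := le_ln1Dx z1; rewrite subrKC.
Qed.

(** By convexity of t^(-decay) the upper bound on [v] bounds u = v^(-decay)
    below by |y|^(2-n) (beta^(-decay) + c |b . y| / |y|^2) on a large sphere, up
    to a small error. The correction has a positive mean, so that a subharmonic barrier which
    starts below it on the sphere decays with a leading coefficient larger than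
    beta^(-decay): for [v] this means a coefficient smaller than [beta]. The
    quadratic term of the barrier follows the profile |b . y| from below, and
    its Laplacian pays for the negative coefficient [B]. *)
Lemma no_competing_slopes v gu (Hu : 'rV[R]_n -> 'M[R]_n) beta b : 0 < beta ->
  (forall y, 0 < v y) ->
  (forall y, jet2 (fun z => v z `^ (- decay)) y (gu y) (Hu y)) ->
  (forall y, \tr (Hu y) <= 0) ->
  (forall eta, 0 < eta -> exists r, forall y, r <= enorm y ->
     v y <= beta * sqnorm y - `|dot b y| + eta * enorm y) ->
  (forall beta', (exists r, forall y, r <= enorm y -> v y <= beta' * sqnorm y) ->
     beta <= beta') ->
  b = 0.
Proof.
move=> beta0 v0 uj utr vup bmin; apply/eqP; apply: contraT => b0.
have nb0 : 0 < enorm b by rewrite enorm_gt0.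
have n0 : (0 : R) < n%:R by rewrite ltr0n (leq_trans _ n_ge3).
have dc0 := decay_gt0.
set nb := enorm b in nb0.
pose g' := decay * beta `^ (- decay - 1).
have g'0 : 0 < g' by rewrite mulr_gt0// powR_gt0.
have eta0 : 0 < nb / (8 * n%:R) by rewrite divr_gt0// mulr_gt0.
have [r0 r0P] := vup _ eta0.
pose r := Num.max r0 1.
have r_gt0 : 0 < r by rewrite /r lt_max ltr01 orbT.
pose al := beta `^ (- decay).
have al0 : 0 < al by exact: powR_gt0.
pose B0 := g' * nb / (2 * n%:R).
have B00 : 0 < B0 by rewrite divr_gt0// mulr_gt0.
pose A := al + B0 / 2 / r; pose B := - B0 * r; pose C := g' * r / nb.
have C0 : 0 < C by rewrite divr_gt0// mulr_gt0.
have uE y : y != 0 -> v y `^ (- decay) = sqnorm y `^ (- decay) * (v y / sqnorm y) `^ (- decay).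
  rewrite -sqnorm_gt0 => N0; rewrite -powRM ?(ltW N0) ?divr_ge0 ?(ltW (v0 _)) ?(ltW N0)//.
  by rewrite mulrC divfK ?gt_eqF.
have tle y : `|dot b y| <= nb * enorm y by exact: dot_le.
have below y : r <= enorm y -> ext_barrier A B C b y <= v y `^ (- decay).
  apply: (@exterior_min (fun z => v z `^ (- decay)) gu Hu (ext_barrier A B C b) r) => //.
  - by move=> z; exact: powR_gt0.
  - move=> x x0; have [p [M [jM tM]]] := ext_barrier_jet A B C b x0.
    exists p, M; split=> //; rewrite tM mulr_gt0 ?powR_gt0 ?sqnorm_gt0//.
    rewrite mulr_gt0// -enorm_sqr -/nb /B /C /B0.
    have -> : n%:R * (- (g' * nb / (2 * n%:R)) * r) + g' * r / nb * nb ^+ 2 =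
      g' * nb * r / 2 by field; rewrite !gt_eqF.
    by rewrite divr_gt0// mulr_gt0// mulr_gt0.
  - exact/ext_barrier_far/ltW.
  move=> x xr; have x0 : x != 0 by rewrite -enorm_gt0 xr.
  have N0 : 0 < sqnorm x by rewrite sqnorm_gt0.
  rewrite ext_barrierE// uE// ler_wpM2l ?powR_ge0//.
  have := @powR_tangent decay (v x / sqnorm x) beta (ltW dc0) (divr_gt0 (v0 _) N0) beta0.
  apply: le_trans; rewrite -/al -/g'.
  have NE : sqnorm x = r ^+ 2 by rewrite -xr enorm_sqr.
  set t := dot b x.
  have t2 : t ^+ 2 <= nb * r * `|t|.
    by rewrite -real_normK ?num_real// expr2 ler_wpM2r// -xr tle.
  have vx : v x / sqnorm x <= beta - `|t| / r ^+ 2 + nb / (8 * n%:R) / r.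
    rewrite ler_pdivrMr// NE.
    have -> : (beta - `|t| / r ^+ 2 + nb / (8 * n%:R) / r) * r ^+ 2 =
        beta * r ^+ 2 - `|t| + nb / (8 * n%:R) * r by field; rewrite !gt_eqF.
    by rewrite -NE -xr; apply: r0P; rewrite xr /r le_max lexx.
  have key : B0 / 2 / r - B0 / r + g' / r ^+ 2 * `|t| <=
      g' * (`|t| / r ^+ 2 - nb / (8 * n%:R) / r).
    have -> : g' * (`|t| / r ^+ 2 - nb / (8 * n%:R) / r) =
      B0 / 2 / r - B0 / r + g' / r ^+ 2 * `|t| + B0 / r / 4.
      by rewrite /B0; field; rewrite !gt_eqF.
    by rewrite lerDl ltW// divr_gt0// divr_gt0.
  have Ct : C * t ^+ 2 / sqnorm x ^+ 2 <= g' / r ^+ 2 * `|t|.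
    rewrite NE ler_pdivrMr ?exprn_gt0//.
    have -> : g' / r ^+ 2 * `|t| * (r ^+ 2) ^+ 2 = C * (nb * r * `|t|).
      by rewrite /C; field; rewrite !gt_eqF.
    by rewrite ler_wpM2l// ltW.
  have gv : g' * (`|t| / r ^+ 2 - nb / (8 * n%:R) / r) <= g' * (beta - v x / sqnorm x).
    by rewrite ler_wpM2l ?(ltW g'0)//; lra.
  rewrite /A -!addrA lerD2l; apply: le_trans gv; apply: le_trans key.
  rewrite addrA lerD// lerD2l /B NE le_eqVlt; apply/orP; left; apply/eqP.
  by field; rewrite gt_eqF.
clearbody B0 C.
(* The leading coefficient [A], up to half of its excess over [al]. *)
pose al1 := al + B0 / 4 / r.
have al10 : al < al1 by rewrite ltrDl divr_gt0// divr_gt0.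
have al1_0 : 0 < al1 by exact: lt_trans al10.
have : beta <= al1 `^ (- decay^-1).
  apply: bmin; exists (Num.max r (4 * r)) => y; rewrite ge_max => /andP[ry r4y].
  have y0 : y != 0 by rewrite -enorm_gt0 (lt_le_trans r_gt0).
  have N0 : 0 < sqnorm y by rewrite sqnorm_gt0.
  have := below y ry; rewrite ext_barrierE// uE// ler_pM2l ?powR_gt0// => le1.
  have le2 : al1 <= (v y / sqnorm y) `^ (- decay).
    rewrite (le_trans _ le1)// -addrA /A /al1 -addrA lerD2l.
    have q0 : 0 <= C * dot b y ^+ 2 / sqnorm y ^+ 2.
      by rewrite divr_ge0 ?sqr_ge0// mulr_ge0 ?sqr_ge0// ltW.
    have : B0 * r / sqnorm y <= B0 / 4 / r.
      rewrite ler_pdivrMr//.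
      have -> : B0 / 4 / r * sqnorm y = B0 * (sqnorm y / (4 * r)) by field; rewrite gt_eqF.
      rewrite ler_wpM2l ?(ltW B00)// ler_pdivlMr ?mulr_gt0// -enorm_sqr.
      rewrite expr2 ler_pM ?(ltW r_gt0)// ?mulr_ge0// ltW//.
    by rewrite /B mulNr mulNr; lra.
  rewrite -ler_pdivrMr//.
  have q0 : 0 < v y / sqnorm y by rewrite divr_gt0.
  have -> : v y / sqnorm y = ((v y / sqnorm y) `^ (- decay)) `^ (- decay^-1).
    by rewrite -powRrM mulrNN divff ?gt_eqF// powRr1// ltW.
  rewrite !(powRN _ decay^-1) lef_pV2 ?posrE ?powR_gt0//.
  by rewrite ge0_ler_powR ?nnegrE ?invr_ge0 ?powR_ge0 ?(ltW dc0)// ltW.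
move=> bal; suff : al1 `^ (- decay^-1) < beta by rewrite ltNge bal.
rewrite [ltRHS](_ : beta = al `^ (- decay^-1)); last first.
  by rewrite /al -powRrM mulrNN divff ?gt_eqF// powRr1// ltW.
rewrite !(powRN _ decay^-1) ltf_pV2 ?posrE ?powR_gt0//.
by rewrite gt0_ltr_powR ?nnegrE ?invr_gt0// ltW.
Qed.

End Superharmonic.

(** * Classification of entire solutions *)

Section Classification.
Context {R : realType} {n : nat}.
Hypothesis n_ge3 : (3 <= n)%N.
Variables (U : set 'M[R]_n) (F : 'M[R]_n -> R) (tau : R).
Hypothesis UF : strictly_elliptic U F.
Hypothesis tau_ge0 : 0 <= tau.
Hypothesis UF_refl : forall M y, U M -> y != 0 ->
  U (refl_mx y *m M *m refl_mx y) /\ F (refl_mx y *m M *m refl_mx y) = F M.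

Variables (v : 'rV[R]_n -> R) (g : 'rV[R]_n -> 'rV[R]_n) (H : 'rV[R]_n -> 'M[R]_n).
Hypothesis v_gt0 : forall y, 0 < v y.
Hypothesis v_jet : forall y, jet2 v y (g y) (H y).
Hypothesis H_sym : forall y, (H y)^T = H y.
Hypothesis g_cont : forall y, g @ y --> g y.
Hypothesis H_cont : forall y, H @ y --> H y.
Hypothesis v_adm : forall y, U (conf_mx (v y) (g y) (H y)).
Hypothesis v_eq : forall y, F (conf_mx (v y) (g y) (H y)) = v y `^ tau.

Let d : R := @decay R n.
Variables (gu : 'rV[R]_n -> 'rV[R]_n) (Hu : 'rV[R]_n -> 'M[R]_n).
Hypothesis u_jet : forall y, jet2 (fun z => v z `^ (- d)) y (gu y) (Hu y).
Hypothesis u_super : forall y, \tr (Hu y) <= 0.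

Let d_gt0 : 0 < d.
Proof. exact: decay_gt0. Qed.

(** Its infimum [beta] is the upper limit of v(y) / |y|^2. *)
Let far_bounds := [set b | exists r, forall y, r <= enorm y -> v y <= b * sqnorm y].

Let beta := inf far_bounds.

Let n_gt0 : (0 < n)%N.
Proof. exact: leq_trans n_ge3. Qed.

Let far_point (r : R) : exists2 y : 'rV[R]_n, r <= enorm y & y != 0.
Proof.
pose y : 'rV[R]_n := (`|r| + 1) *: delta_mx 0 (Ordinal n_gt0).
have e1 : enorm (delta_mx 0 (Ordinal n_gt0) : 'rV[R]_n) = 1.
  by rewrite /enorm sqnormE /dot -rowE !mxE !eqxx sqrtr1.
have yE : enorm y = `|r| + 1 by rewrite enormZ e1 mulr1 ger0_norm// addr_ge0.
exists y; first by rewrite yE (le_trans (ler_norm r))// lerDl.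
by rewrite -enorm_gt0 yE ltr_wpDl.
Qed.

Let far_bounds_ge0 b : far_bounds b -> 0 <= b.
Proof.
move=> [r rP]; have [y ry y0] := far_point r.
rewrite leNgt; apply/negP => b0.
have := lt_le_trans (v_gt0 y) (rP y ry); rewrite ltNge pmulr_lle0 ?sqnorm_gt0//.
by rewrite ltW.
Qed.

Let far_bounds_inf : has_inf far_bounds.
Proof.
split; last by exists 0 => b /far_bounds_ge0.
have [c c0 cP] := superharmonic_lower n_ge3 (fun y => powR_gt0 (- d) (v_gt0 y)) u_jet u_super.
exists (c `^ (- d^-1)); exists 1 => y y1.
have y0 : y != 0 by rewrite -enorm_gt0 (lt_le_trans ltr01).
have N0 : 0 < sqnorm y by rewrite sqnorm_gt0.
have dd : - d * - d^-1 = 1 by rewrite mulrNN divff// gt_eqF.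
have -> : v y = (v y `^ (- d)) `^ (- d^-1).
  by rewrite -powRrM dd powRr1// ltW.
have -> : sqnorm y = (sqnorm y `^ (- d)) `^ (- d^-1).
  by rewrite -powRrM dd powRr1// ltW.
rewrite -powRM ?powR_ge0 ?(ltW c0)// !(powRN _ d^-1).
rewrite lef_pV2 ?posrE ?powR_gt0 ?mulr_gt0 ?powR_gt0//.
rewrite ge0_ler_powR ?nnegrE ?invr_ge0 ?(ltW d_gt0) ?powR_ge0 ?mulr_ge0 ?powR_ge0 ?(ltW c0)//.
exact: cP.
Qed.

Let beta_ge0 : 0 <= beta.
Proof.
apply: lb_le_inf; first by case: far_bounds_inf.
by move=> b /far_bounds_ge0.
Qed.

Let beta_min b : far_bounds b -> beta <= b.
Proof. by move=> fb; apply: ge_inf => //; case: far_bounds_inf. Qed.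

Let beta_far kap : 0 < kap -> far_bounds (beta + kap).
Proof.
move=> k0; have [b [r rP] bk] := inf_adherent k0 far_bounds_inf.
exists r => y ry; rewrite (le_trans (rP y ry))// ler_wpM2r ?sqnorm_ge0//.
exact: ltW.
Qed.

Let far_shift (f : 'rV[R]_n -> R) b kap x : 0 <= b -> 0 < kap ->
  (exists r, forall y, r <= enorm y -> f y <= b * sqnorm y) ->
  exists2 r, 0 < r & forall y, r <= enorm y -> f (x + y) <= (b + kap) * sqnorm y.
Proof.
move=> b0 k0 [r rP].
pose r1 := Num.max r 0 + enorm x + 1 + b * (2 * enorm x + sqnorm x) / kap.
have m0 : 0 <= Num.max r 0 by rewrite le_max lexx orbT.
have x0 := enorm_ge0 x; have x20 := sqnorm_ge0 x.
have q0 : 0 <= b * (2 * enorm x + sqnorm x) / kap.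
  by rewrite divr_ge0 ?(ltW k0)// mulr_ge0// addr_ge0// mulr_ge0.
have r10 : 0 < r1 by rewrite /r1; lra.
exists r1 => // y ry.
have y1 : 1 <= enorm y by rewrite (le_trans _ ry)// /r1; lra.
have yx : r <= enorm (x + y).
  have : enorm y - enorm x <= enorm (x + y) by rewrite [x + y]addrC lerB_enormD.
  have : r <= Num.max r 0 by rewrite le_max lexx.
  by move: ry; rewrite /r1; lra.
rewrite (le_trans (rP _ yx))// sqnormD.
have xy : dot x y <= enorm x * enorm y by rewrite (le_trans (ler_norm _)) ?dot_le.
have sx : sqnorm x <= sqnorm x * enorm y by rewrite ler_peMr.
have h1 : b * (sqnorm x + 2 * dot x y) <= b * ((2 * enorm x + sqnorm x) * enorm y).
  by rewrite ler_wpM2l//; lra.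
have h2 : b * ((2 * enorm x + sqnorm x) * enorm y) <= kap * sqnorm y.
  rewrite -(enorm_sqr y) expr2 (mulrA kap) (mulrA b) ler_wpM2r ?enorm_ge0//.
  rewrite (mulrC kap) -ler_pdivrMr//.
  have : b * (2 * enorm x + sqnorm x) / kap <= r1 by rewrite /r1; lra.
  by move=> /le_trans/(_ ry).
by move: (le_trans h1 h2); lra.
Qed.

Let shift_cvg (x y : 'rV[R]_n) : x + z @[z --> y] --> x + y.
Proof.
apply: (@cvgD _ _ _ (nbhs y)); last exact: (@cvg_id _ (nbhs y)).
exact: (@cvg_cst _ x _ (nbhs y)).
Qed.

(** The threshold for spheres centred at [x] involves the same [beta], as a
    translation does not affect the growth at infinity. *)
Let sphere x L : 0 < L -> beta * L ^+ 2 <= v x -> forall y, L <= enorm y ->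
  v (x + y) <= sqnorm y / L ^+ 2 * v (x + (L ^+ 2 / sqnorm y) *: y).
Proof.
move=> L0 bL.
apply: (@below_kelvin_all R n U F tau UF tau_ge0 UF_refl (fun y => v (x + y))
  (fun y => g (x + y)) (fun y => H (x + y)) _ _ _ _ _ _ _ beta) => //.
- move=> y; apply: o2_eq (v_jet (x + y)) => h /=; by rewrite addrA.
- move=> y; apply: (@cvg_comp _ _ _ (+%R x) g (nbhs y) (nbhs (x + y))).
    exact: shift_cvg.
  exact: g_cont.
- move=> y; apply: (@cvg_comp _ _ _ (+%R x) H (nbhs y) (nbhs (x + y))).
    exact: shift_cvg.
  exact: H_cont.
- move=> kap k0; have k20 : 0 < kap / 2 by rewrite divr_gt0.
  have bk : 0 <= beta + kap / 2 by rewrite addr_ge0// ltW.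
  have [r r0 rP] := far_shift x bk k20 (beta_far k20).
  by exists r => // y /rP; rewrite -addrA -splitr.
- by rewrite addr0.
Qed.

(** If all spheres are admissible, the points [y] and [z] are exchanged by
    spheres of arbitrarily large radius, centred on the line through them; the
    weight 1 + 1/s tends to 1. *)
Let constant_case : beta = 0 -> forall y z, v y <= v z.
Proof.
move=> b0 y z; have [->//|yz] := eqVneq y z.
rewrite leNgt; apply/negP => vzy.
pose e := y - z; have e0 : e != 0 by rewrite subr_eq0.
have N0 : 0 < sqnorm e by rewrite sqnorm_gt0.
(* With this choice the weight times v z is the mean of v y and v z. *)
pose s := 2 * v z / (v y - v z).
have s0 : 0 < s by rewrite divr_gt0 ?mulr_gt0// subr_gt0.
have s1 : 0 < 1 + s by rewrite addr_gt0.
pose L := Num.sqrt (s * (1 + s) * sqnorm e).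
have L20 : 0 < s * (1 + s) * sqnorm e by rewrite mulr_gt0// mulr_gt0.
have L2 : L ^+ 2 = s * (1 + s) * sqnorm e by rewrite sqr_sqrtr// ltW.
have L0 : 0 < L by rewrite sqrtr_gt0.
have := @sphere (z - s *: e) L L0 _ ((1 + s) *: e).
rewrite b0 mul0r => /(_ (ltW (v_gt0 _)))/(_ _)/wrap[|].
  rewrite -(@ler_pXn2r _ 2)// ?nnegrE ?(ltW L0) ?enorm_ge0// enorm_sqr L2 sqnormZ.
  by rewrite ler_pM2r// expr2 ler_pM2r// lerDr.
have -> : z - s *: e + (1 + s) *: e = y.
  by rewrite scalerDl scale1r addrA addrAC subrK addrC /e subrK.
rewrite sqnormZ L2 scalerA.
have -> : s * (1 + s) * sqnorm e / ((1 + s) ^+ 2 * sqnorm e) * (1 + s) = s.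
  by field; rewrite !gt_eqF.
rewrite subrK.
have -> : (1 + s) ^+ 2 * sqnorm e / (s * (1 + s) * sqnorm e) = 1 + s^-1.
  by field; rewrite !gt_eqF.
have -> : s^-1 = (v y - v z) / 2 / v z.
  by rewrite /s; field; rewrite !gt_eqF// subr_gt0.
rewrite mulrDl mul1r divfK ?gt_eqF// => h.
by move: h vzy; lra.
Qed.

Section PositiveBeta.
Hypothesis beta_gt0 : 0 < beta.

(** The largest admissible sphere has radius L with beta L^2 = v(x); the inverse
    point tends to [x], where [v] is expanded to first order. *)
Let expansion x eta : 0 < eta -> exists r, forall y, r <= enorm y ->
  v (x + y) <= beta * sqnorm y + dot (g x) y + eta * enorm y.
Proof.
move=> eta0; have [C C0 /near0_enormP[r r0 rP]] := jet2_rem1 (v_jet x).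
pose L := Num.sqrt (v x / beta).
have L2 : L ^+ 2 = v x / beta by rewrite sqr_sqrtr// divr_ge0 ?(ltW beta_gt0)// ltW.
have L0 : 0 < L by rewrite sqrtr_gt0 divr_gt0.
have L20 : 0 < L ^+ 2 by rewrite exprn_gt0.
exists (L + 2 * L ^+ 2 / r + C * L ^+ 2 / eta) => y ry.
have a0 : 0 < 2 * L ^+ 2 / r by rewrite divr_gt0// mulr_gt0.
have b0 : 0 <= C * L ^+ 2 / eta by rewrite divr_ge0 ?(ltW eta0)// mulr_ge0// ltW.
have Ly : L <= enorm y by move: ry; lra.
have y0 : y != 0 by rewrite -enorm_gt0 (lt_le_trans L0).
have e0 : 0 < enorm y by rewrite enorm_gt0.
have N0 : 0 < sqnorm y by rewrite sqnorm_gt0.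
set h := (L ^+ 2 / sqnorm y) *: y.
have hE : enorm h = L ^+ 2 / enorm y.
  rewrite enormZ gtr0_norm ?divr_gt0// -enorm_sqr; field; by rewrite gt_eqF.
have hr : enorm h < r.
  rewrite hE ltr_pdivrMr//.
  have : 2 * L ^+ 2 / r <= enorm y by move: ry; lra.
  rewrite ler_pdivrMr// => h1; rewrite mulrC (lt_le_trans _ h1)//.
  by rewrite ltr_pMl// ltr1n.
have bL : beta * L ^+ 2 <= v x by rewrite L2 mulrC divfK ?gt_eqF.
rewrite (le_trans (sphere L0 bL Ly))// -/h mulrC.
have vh : v (x + h) <= v x + dot (g x) h + C * enorm h ^+ 2.
  by have := rP h hr => /ler_normlP[_]; lra.
have q0 : 0 <= sqnorm y / L ^+ 2 by rewrite divr_ge0 ?ltW.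
rewrite mulrC (le_trans (ler_wpM2l q0 vh))//.
have vxE : v x = beta * L ^+ 2 by rewrite L2 mulrC divfK ?gt_eqF.
have -> : sqnorm y / L ^+ 2 * (v x + dot (g x) h + C * enorm h ^+ 2) =
    beta * sqnorm y + dot (g x) y + C * L ^+ 2.
  rewrite hE dotZr vxE -(enorm_sqr y); move: L20 e0; set L_2 := L ^+ 2; move=> *.
  by field; rewrite !gt_eqF.
have : C * L ^+ 2 / eta <= enorm y by move: ry; lra.
by rewrite ler_pdivrMr// (mulrC (enorm y)) lerD2l.
Qed.

Let slope x := (2 * beta) *: x - g x.

(** The linear term seen from another centre depends on [x] only through its
    slope. *)
Let expansion_from x c eta : 0 < eta -> exists r, forall y, r <= enorm y ->
  v (c + y) <= beta * sqnorm y + dot ((2 * beta) *: c - slope x) y + eta * enorm y.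
Proof.
move=> eta0; have eta20 : 0 < eta / 2 by rewrite divr_gt0.
have [r rP] := expansion x eta20; pose e := c - x.
pose K := beta * sqnorm e + dot (g x) e + eta / 2 * enorm e.
have e0 := enorm_ge0 e.
exists (`|r| + enorm e + `|K| / (eta / 2)) => y ry.
have K0 : 0 <= `|K| / (eta / 2) by rewrite divr_ge0// ltW.
have yr : r <= enorm (y + e).
  have := lerB_enormD y e; have := ler_norm r; move: ry; lra.
have -> : c + y = x + (y + e) by rewrite /e addrCA subrKC addrC.
rewrite (le_trans (rP _ yr))//.
have Ky : K <= eta / 2 * enorm y.
  rewrite mulrC -ler_pdivrMr//.
  have : K / (eta / 2) <= `|K| / (eta / 2) by rewrite ler_pM2r ?invr_gt0// ler_norm.
  by move: ry (normr_ge0 r); lra.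
have De : eta / 2 * enorm (y + e) <= eta / 2 * enorm y + eta / 2 * enorm e.
  by rewrite -mulrDr ler_wpM2l ?(ltW eta20)// ler_enormD.
have -> : dot ((2 * beta) *: c - slope x) y = 2 * beta * dot y e + dot (g x) y.
  by rewrite /slope /e !dotBl dotBr !dotZl (dotC c) (dotC x); ring.
rewrite sqnormD dotDr; move: Ky De; rewrite /K; lra.
Qed.

(** Seen from the centre [c] chosen between the two slopes, both expansions
    bound the same function and have opposite linear terms. *)
Let slope_cst x1 x2 : slope x1 = slope x2.
Proof.
have bb : 2 * beta != 0 by rewrite gt_eqF// mulr_gt0.
pose b := 2^-1 *: (slope x2 - slope x1).
pose c := (2 * beta)^-1 *: (2^-1 *: (slope x1 + slope x2)).
have half (q1 q2 : 'rV[R]_n) : 2^-1 *: (q1 + q2) - q1 = 2^-1 *: (q2 - q1).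
  by apply/rowP => i; rewrite !mxE; field.
have cE : (2 * beta) *: c = 2^-1 *: (slope x1 + slope x2) by rewrite scalerA mulfV// scale1r.
have c1 : (2 * beta) *: c - slope x1 = b by rewrite cE half.
have c2 : (2 * beta) *: c - slope x2 = - b.
  rewrite cE [slope x1 + _]addrC half /b.
  by rewrite -[slope x1 - _]opprB scalerN.
clearbody b c.
suff b0 : b = 0.
  by move: c1 c2; rewrite b0 oppr0 => /subr0_eq <- /subr0_eq ->.
apply: (@no_competing_slopes R n n_ge3 (fun y => v (c + y))
  (fun y => gu (c + y)) (fun y => Hu (c + y)) beta) => //.
- by move=> y; apply: o2_eq (u_jet (c + y)) => h /=; rewrite addrA.
- move=> eta eta0.
  have [r1 r1P] := expansion_from x1 c eta0; have [r2 r2P] := expansion_from x2 c eta0.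
  exists (Num.max r1 r2) => y; rewrite ge_max => /andP[/r1P h1 /r2P h2].
  move: h1 h2; rewrite c1 c2 dotNl => h1 h2.
  by case: (ler0P (dot b y)) => _; lra.
move=> beta' [r rP].
have beta'0 : 0 <= beta'.
  have [y ry y0] := far_point r; rewrite leNgt; apply/negP => b0.
  have := lt_le_trans (v_gt0 (c + y)) (rP y ry); rewrite ltNge pmulr_lle0 ?sqnorm_gt0//.
  by rewrite ltW.
apply/ler_addgt0Pr => kap k0; apply: beta_min.
have [|r' _ r'P] := @far_shift (fun y => v (c + y)) beta' kap (- c) beta'0 k0.
  by exists r.
by exists r' => y /r'P; rewrite addNKr.
Qed.

(** A constant slope prescribes the gradient of [v]. *)
Lemma paraboloid : exists xbar k, 0 < k /\ forall y, v y = beta * sqnorm (y - xbar) + k.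
Proof.
pose q := slope 0.
have gE y : g y = (2 * beta) *: y - q by rewrite /q -(slope_cst y 0) /slope opprB addrC subrK.
pose f y := v y - beta * sqnorm y + dot q y.
have f_cst y : f y = v 0.
  have fd (s : R) : Num.min 0 1 <= s <= Num.max 0 1 ->
      is_derive s 1 (fun t => f (t *: y)) 0.
    move=> _; rewrite -(dot0l y); apply: jet2_ray.
    have := jet2D (jet2B (v_jet (s *: y)) (jet2Z beta (jet2_sqnorm (s *: y)))) (jet2_dot q (s *: y)).
    apply: jet2_eq => //.
    by rewrite gE scalerA [beta * 2]mulrC addrAC subrK subrr.
  have [c _] := MVT_between fd.
  rewrite scale1r scale0r mul0r => /subr0_eq ->.
  by rewrite /f sqnorm0 mulr0 subr0 dot0r addr0.
pose xbar := (2 * beta)^-1 *: q.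
have vE y : v y = beta * sqnorm (y - xbar) + (v 0 - beta * sqnorm xbar).
  have := f_cst y; rewrite /f sqnormB.
  have -> : dot y xbar = (2 * beta)^-1 * dot q y by rewrite dotZr dotC.
  move=> <-; by field; rewrite gt_eqF.
exists xbar, (v 0 - beta * sqnorm xbar); split=> //.
by have := v_gt0 xbar; rewrite vE subrr sqnorm0 mulr0 add0r.
Qed.

End PositiveBeta.

Theorem entire_paraboloid : (exists c, forall y, v y = c) \/
  exists xbar b k, [/\ 0 < b, 0 < k & forall y, v y = b * sqnorm (y - xbar) + k].
Proof.
have [b0|b0] := eqVneq beta 0.
  left; exists (v 0) => y; apply/eqP.
  by rewrite eq_le !constant_case.
right; have bp : 0 < beta by rewrite lt0r b0 beta_ge0.
by have [xbar [k [k0 vE]]] := paraboloid bp; exists xbar, beta, k.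
Qed.

End Classification.

(** * The change of unknown *)

Section ChangeOfUnknown.
Context {R : realType} {n : nat}.
Implicit Types (x y xbar : 'rV[R]_n) (s b k : R) (p : 'rV[R]_n) (H : 'M[R]_n).

Lemma conf_mx_symK s p H : s != 0 -> (conf_mx s p H)^T = conf_mx s p H -> H^T = H.
Proof.
move=> s0; rewrite /conf_mx linearB/= linearZ/= tr_scalar_mx => /addIr.
by move=> /(scalerI s0).
Qed.

Lemma refl_mx_orthogonal y : y != 0 ->
  orthogonal_mx (refl_mx y) /\ invmx (refl_mx y) = refl_mx y.
Proof.
move=> y0; have OO := refl_mxK y0.
split; first by rewrite /orthogonal_mx /= refl_mx_sym.
by have [uO _] := mulmx1_unit OO; rewrite -[RHS](mulKmx uO) OO mulmx1.
Qed.

Lemma tr_hessian (u : 'rV[R]_n -> R) x : \tr (hessian u x) = laplacian u x.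
Proof. by apply: eq_bigr => i _; rewrite mxE. Qed.

Hypothesis n_ge3 : (3 <= n)%N.
Let d : R := @decay R n.

Let m_gt0 : 0 < n%:R - 2 :> R.
Proof. by rewrite subr_gt0 ltr_nat. Qed.

(** The entries match because of the exponents: with a = -2/(n-2),
    2 a - 1 = -(n+2)/(n-2) and 2 a - 2 = -2n/(n-2). *)
Lemma conf_mx_powR (u : 'rV[R]_n -> R) x : 0 < u x ->
  conf_mx (u x `^ (- d^-1)) ((- d^-1 * u x `^ (- d^-1 - 1)) *: gradient u x)
    ((- d^-1 * u x `^ (- d^-1 - 1)) *: hessian u x +
     (- d^-1 * (- d^-1 - 1) * u x `^ (- d^-1 - 2)) *:
       ((gradient u x)^T *m gradient u x)) = conf_hessian u x.
Proof.
move=> u0; rewrite /conf_mx /conf_hessian.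
have powD (r t : R) : u x `^ r * u x `^ t = u x `^ (r + t).
  by rewrite powRD// (gt_eqF u0) implybT.
have dE : - d^-1 = - 2 / (n%:R - 2).
  by rewrite /d /decay; field; rewrite gt_eqF.
have e1 : - d^-1 + (- d^-1 - 1) = - ((n%:R + 2) / (n%:R - 2)).
  by rewrite dE; field; rewrite gt_eqF.
have e2 : - d^-1 + (- d^-1 - 2) = - (2 * n%:R / (n%:R - 2)).
  by rewrite dE; field; rewrite gt_eqF.
have e3 : (- d^-1 - 1) + (- d^-1 - 1) = - (2 * n%:R / (n%:R - 2)).
  by rewrite -e2; ring.
rewrite scalerDr !scalerA sqnormZ; congr (_ *: _ + _ *: _ - _%:M).
- by rewrite mulrCA powD e1 dE; field; rewrite gt_eqF.
- by rewrite mulrCA powD e2 dE; field; rewrite gt_eqF.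
- rewrite exprMn [u x `^ _ ^+ 2]expr2 powD e3 dE; field; by rewrite gt_eqF.
Qed.

Lemma jet2_paraboloid b xbar k y :
  jet2 (fun z => b * sqnorm (z - xbar) + k) y ((2 * b) *: (y - xbar)) ((2 * b)%:M).
Proof.
have js : jet2 (fun z => sqnorm (z - xbar)) y (2 *: (y - xbar)) (2 *: 1%:M).
  by apply: o2_eq (jet2_sqnorm (y - xbar)) => h /=; rewrite (addrAC y (- xbar) h).
apply: jet2_eq (jet2D (jet2Z b js) (jet2_cst k y)) => //.
  by rewrite addr0 scalerA mulrC.
by rewrite addr0 scalerA scalemx1 mulrC.
Qed.

Lemma conf_mx_paraboloid b xbar k y :
  conf_mx (b * sqnorm (y - xbar) + k) ((2 * b) *: (y - xbar)) ((2 * b)%:M) =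
  (2 * b * k)%:M.
Proof.
rewrite /conf_mx scale_scalar_mx -raddfB/= sqnormZ; congr _%:M.
by field.
Qed.

End ChangeOfUnknown.

Theorem theorem1 (R : realType) (n : nat) (n_ge3 : (3 <= n)%N)
    (U : set 'M[R]_n)
    (U_sym : U `<=` sym_mx)
    (U_open : open (U : set (subspace (@sym_mx R n))))
    (U_inv : forall O : 'M[R]_n, orthogonal_mx O ->
       [set invmx O *m M *m O | M in U] = U)
    (U_convex : forall M N : 'M[R]_n, sym_mx M -> posdef_mx N ->
       convex_set (U `&` [set M + t *: N | t in [set t : R | 0 < t]]
                   : set (convex_lmodType 'M[R]_n)))
    (F : 'M[R]_n -> R)
    (F_C2 : C2_on unit_sym U F)
    (F_inv : forall M O : 'M[R]_n, U M -> orthogonal_mx O ->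
       F (invmx O *m M *m O) = F M)
    (F_elliptic : forall M : 'M[R]_n, U M -> posdef_mx (mx_gradient F M))
    (p : R) (p_le : p <= (n%:R + 2) / (n%:R - 2))
    (u : 'rV[R]_n -> R)
    (u_C2 : C2_on unit_rV setT u)
    (u_superharmonic : forall x, laplacian u x <= 0)
    (u_eq : forall x,
       F (conf_hessian u x) = u x `^ (p - (n%:R + 2) / (n%:R - 2)))
    (u_adm : forall x, U (conf_hessian u x))
    (u_gt0 : forall x, 0 < u x) :
  (exists c : R, forall x, u x = c) \/
  (p = (n%:R + 2) / (n%:R - 2) /\
   exists (xbar : 'rV[R]_n) (a b : R),
     [/\ 0 < a, 0 < b,
         U (2 * b ^+ 2 * a ^- 2)%:M,
         F (2 * b ^+ 2 * a ^- 2)%:M = 1 &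
         forall x, u x =
           (a / (1 + b ^+ 2 * sqnorm (x - xbar))) `^ ((n%:R - 2) / 2)]).
Proof.
set crit := (n%:R + 2) / (n%:R - 2) in p_le u_eq *.
pose d : R := @decay R n.
have d0 : 0 < d by exact: decay_gt0.
pose a := - d^-1; pose tau := d * (crit - p).
have tau0 : 0 <= tau by rewrite mulr_ge0 ?subr_ge0 ?(ltW d0).
pose v y := u y `^ a.
pose g y := (a * u y `^ (a - 1)) *: gradient u y.
pose H y : 'M[R]_n := (a * u y `^ (a - 1)) *: hessian u y +
  (a * (a - 1) * u y `^ (a - 2)) *: ((gradient u y)^T *m gradient u y).
have v0 y : 0 < v y by exact: powR_gt0.
have uj := C2_jet u_C2.
have uE y : v y `^ (- d) = u y.
  by rewrite -powRrM mulrNN mulVf ?gt_eqF// powRr1// ltW.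
have vj y : jet2 v y (g y) (H y) by exact: (jet2_comp (sjet_powR a (u_gt0 y)) (uj y)).
have powR_cont (r : R) y : u z `^ r @[z --> y] --> u y `^ r.
  exact: (jet2_cont (jet2_comp (sjet_powR r (u_gt0 y)) (uj y))).
have [grad_cont hess_cont] := C2_cvg u_C2.
have coef_cont (r t : R) y : r * u z `^ t @[z --> y] --> r * u y `^ t.
  apply: (@cvgM _ _ (nbhs y)); last exact: powR_cont.
  exact: (@cvg_cst _ r _ (nbhs y)).
have g_cont y : g @ y --> g y.
  by apply: (@cvgZ _ _ _ (nbhs y)); [exact: coef_cont|exact: grad_cont].
have H_cont y : H @ y --> H y.
  apply: (@cvgD _ _ _ (nbhs y)); apply: (@cvgZ _ _ _ (nbhs y)); try exact: coef_cont.
    exact: hess_cont.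
  apply: (@cvg_mulmx _ _ (nbhs y)); last exact: grad_cont.
  by apply: (@cvg_trmx _ _ (nbhs y)); exact: grad_cont.
have confE y : conf_mx (v y) (g y) (H y) = conf_hessian u y.
  exact: (conf_mx_powR n_ge3 (u_gt0 y)).
have H_sym y : (H y)^T = H y.
  apply: (@conf_mx_symK _ _ (v y) (g y)); first by rewrite gt_eqF.
  by rewrite confE; apply/sym_mxP/U_sym.
have v_adm y : U (conf_mx (v y) (g y) (H y)) by rewrite confE.
have v_eq y : F (conf_mx (v y) (g y) (H y)) = v y `^ tau.
  rewrite confE u_eq -powRrM; congr (_ `^ _).
  by rewrite /a /tau; field; rewrite gt_eqF.
have UF : strictly_elliptic U F.
  split=> [M UM|M N]; last exact: F_mono.
  exists (mx_gradient F M); first exact: F_elliptic.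
  exact: F_strict.
have UF_refl M y : U M -> y != 0 ->
    U (refl_mx y *m M *m refl_mx y) /\ F (refl_mx y *m M *m refl_mx y) = F M.
  move=> UM /refl_mx_orthogonal[Oy invO]; split.
    by rewrite -{1}invO -(U_inv _ Oy); exists M.
  by rewrite -{1}invO F_inv.
have u_jet y : jet2 (fun z => v z `^ (- d)) y (gradient u y) (hessian u y).
  by apply: jet2_eq (uj y) => // z; rewrite uE.
have u_tr y : \tr (hessian u y) <= 0 by rewrite tr_hessian.
have [[c vc]|[xbar [b [k [b0 k0 vE]]]]] := entire_paraboloid n_ge3 UF tau0 UF_refl
    v0 vj H_sym g_cont H_cont v_adm v_eq u_jet u_tr.
  by left; exists (c `^ (- d)) => x; rewrite -uE vc.
have confk y : conf_mx (v y) (g y) (H y) = (2 * b * k)%:M.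
  have vj' : jet2 v y ((2 * b) *: (y - xbar)) ((2 * b)%:M).
    by apply: jet2_eq (jet2_paraboloid b xbar k y) => // z; rewrite vE.
  have [-> ->] := jet2_unique (H_sym y) (tr_scalar_mx _ _) (vj y) vj'.
  by rewrite vE conf_mx_paraboloid.
pose e : 'rV[R]_n := delta_mx 0 (Ordinal (leq_trans (isT : (0 < 3)%N) n_ge3)).
have e0 : 0 < sqnorm e.
  rewrite sqnorm_gt0; apply/eqP => /rowP/(_ (Ordinal (leq_trans (isT : (0 < 3)%N) n_ge3))).
  by rewrite !mxE !eqxx => /eqP; rewrite oner_eq0.
have vk : v xbar = k by rewrite vE subrr sqnorm0 mulr0 add0r.
have vkb : v (xbar + e) = b * sqnorm e + k by rewrite vE [xbar + e]addrC addrK.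
(* The left-hand side of the equation is now a constant, and [v] is not. *)
have tauE : tau = 0.
  apply/eqP; rewrite eq_le tau0 andbT leNgt; apply/negP => tau_gt0.
  have := v_eq xbar; rewrite confk -(confk (xbar + e)) v_eq vk vkb => powE.
  have : k `^ tau < (b * sqnorm e + k) `^ tau.
    by rewrite gt0_ltr_powR ?nnegrE ?addr_ge0 ?mulr_ge0 ?(ltW b0) ?(ltW e0) ?(ltW k0)// ltrDr mulr_gt0.
  by rewrite powE ltxx.
right; split.
  by apply/eqP; rewrite eq_sym -subr_eq0; move/eqP: tauE; rewrite mulf_eq0 (gt_eqF d0).
exists xbar, k^-1, (Num.sqrt (b / k)).
have bk0 : 0 < b / k by rewrite divr_gt0.
have bE : Num.sqrt (b / k) ^+ 2 = b / k by rewrite sqr_sqrtr// ltW.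
have cE : 2 * Num.sqrt (b / k) ^+ 2 * k^-1 ^- 2 = 2 * b * k.
  by rewrite bE; field; rewrite gt_eqF.
split; rewrite ?invr_gt0 ?sqrtr_gt0// ?cE.
- by rewrite -(confk 0).
- by rewrite -(confk 0) v_eq tauE powRr0.
move=> x; rewrite -uE vE bE.
set N := sqnorm _; have N0 : 0 <= N by exact: sqnorm_ge0.
have w0 : 0 < b * N + k by rewrite ltr_wpDl// mulr_ge0// ltW.
have -> : k^-1 / (1 + b / k * N) = (b * N + k)^-1.
  field; rewrite !gt_eqF//.
by rewrite -(powR_inv1 (ltW w0)) -powRrM mulN1r.
Qed.
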